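(* Let $K \subseteq \mathbb{C}^n$ be a circled convex body. Then there exists a complex, $(n-1)$-dimensional, linear subspace $H \subseteq \mathbb{C}^n$ with the following property: Let $f: \mathbb{C}^n \rightarrow \mathbb{C}$ be holomorphic, set $Z = f^{-1}(0)$ and assume that $Z$ is non-empty. Then for any $r > 0$, $$ \gamma_n( Z + r K ) \geq \gamma_n( H_1 + r K), $$ where $H_1 \subseteq \mathbb{C}^n$ is a translate of $H$ with $d(0, H_1) = d(0, Z)$.
   Context: $\gamma_n$ is the standard Gaussian probability measure on $\mathbb{C}^n$, with density $z \mapsto (2\pi)^{-n} \exp(-|z|^2/2)$ with respect to Lebesgue measure, where $|z| = \sqrt{\sum_j |z^j|^2}$. A convex body is a compact, convex set with non-empty interior. A convex body $K \subseteq \mathbb{C}^n$ is circled if $e^{it} K = K$ for all $t \in \mathbb{R}$. Here $\lambda K = \{\lambda z \, ; \, z \in K\}$ and $A + B = \{a + b \, ; \, a \in A, b \in B\}$. For a non-empty set $S \subseteq \mathbb{C}^n$, $d(0,S) = \inf_{z \in S} |z|$. *)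

(* Defs.v *)
From HB Require Import structures.
From mathcomp Require Import all_boot all_order all_algebra.
From mathcomp Require Import complex.
From mathcomp Require Import all_classical all_reals all_analysis.

Set Implicit Arguments.
Unset Strict Implicit.
Unset Printing Implicit Defensive.

Import Order.TTheory GRing.Theory Num.Theory.
Import numFieldNormedType.Exports.

Local Open Scope classical_set_scope.
Local Open Scope ring_scope.
Local Open Scope complex_scope.

(* The library puts a topology on an abstract numFieldType and on the alias
   R[i]^o, but not on R[i] itself.  With these instances the row vectors
   'rV[R[i]]_n form a normed module over R[i]; its norm is the maximum norm,
   so it is used only for the topology and for differentiability. *)
HB.instance Definition _ (R : realType) := GRing.ComAlgebra.copy R[i] R[i]^o.
HB.instance Definition _ (R : realType) := Vector.copy R[i] R[i]^o.
HB.instance Definition _ (R : realType) := NormedModule.copy R[i] R[i]^o.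

Section tuple_cons_measure.
Local Open Scope ereal_scope.
Context d (T : measurableType d) (R : realType) (n : nat).
Variable mu : {sigma_finite_measure set T -> \bar R}.
Variable nu : {sigma_finite_measure set (n.-tuple T) -> \bar R}.

Let tcons (p : T * n.-tuple T) : n.+1.-tuple T := [tuple of p.1 :: p.2].

Let measurable_tcons : measurable_fun [set: T * n.-tuple T] tcons.
Proof. exact: measurable_cons. Qed.

(* mu \x nu, transported along T * T^n = T^(n.+1) *)
Definition tuple_cons_measure (A : set (n.+1.-tuple T)) : \bar R :=
  pushforward (mu \x nu) tcons A.

Let tcm0 : tuple_cons_measure set0 = 0.
Proof. by rewrite /tuple_cons_measure /pushforward preimage_set0 measure0. Qed.

Let tcm_ge0 A : 0 <= tuple_cons_measure A.
Proof. exact: measure_ge0. Qed.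

Let tcm_sigma_additive : semi_sigma_additive tuple_cons_measure.
Proof.
move=> F mF tF mUF.
rewrite /tuple_cons_measure /pushforward preimage_bigcup.
apply: measure_semi_sigma_additive.
- by move=> k; rewrite -[X in measurable X]setTI; exact: measurable_tcons.
- apply/trivIsetP => /= i j _ _ ij; rewrite -preimage_setI.
  by move/trivIsetP : tF => /(_ _ _ _ _ ij) ->//; rewrite preimage_set0.
- rewrite -preimage_bigcup -[X in measurable X]setTI.
  exact: measurable_tcons.
Qed.

HB.instance Definition _ := isMeasure.Build _ _ _ tuple_cons_measure
  tcm0 tcm_ge0 tcm_sigma_additive.

Let tcm_sigma_finite : sigma_finite setT tuple_cons_measure.
Proof.
have /sigma_finiteP[F [TF ndF Foo]] := sigma_finiteT mu.
have /sigma_finiteP[G [TG ndG Goo]] := sigma_finiteT nu.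
pose tuncons (t : n.+1.-tuple T) : T * n.-tuple T :=
  (thead t, [tuple of behead t]).
have mtuncons : measurable_fun setT tuncons.
  by apply/measurable_fun_pair; [exact: measurable_tnth|
                                exact: measurable_behead].
have tconsK : tuncons \o tcons = id.
  by apply/funext => -[x t]; congr pair; exact: val_inj.
exists (fun k => tuncons @^-1` (F k `*` G k)).
  apply/esym; rewrite -subTset => t _.
  have [i _ Fi] : (\bigcup_i F i) (thead t) by rewrite -TF.
  have [j _ Gj] : (\bigcup_j G j) [tuple of behead t] by rewrite -TG.
  exists (maxn i j) => //; split.
    by move: Fi; exact/subsetPset/ndF/leq_maxl.
  by move: Gj; exact/subsetPset/ndG/leq_maxr.
move=> k; have [mF Fk] := Foo k; have [mG Gk] := Goo k; split.
  by rewrite -[X in measurable X]setTI; apply: mtuncons => //; exact: measurableX.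
rewrite /tuple_cons_measure /pushforward -comp_preimage tconsK preimage_id.
by rewrite product_measure1E// lte_mul_pinfty// ge0_fin_numE.
Qed.

HB.instance Definition _ := Measure_isSigmaFinite.Build _ _ _
  tuple_cons_measure tcm_sigma_finite.

End tuple_cons_measure.

Fixpoint tuple_measure d (T : measurableType d) (R : realType)
    (mu : {sigma_finite_measure set T -> \bar R}) (n : nat) :
    {sigma_finite_measure set (n.-tuple T) -> \bar R} :=
  match n with
  | 0 => dirac [tuple]
  | m.+1 => tuple_cons_measure mu (tuple_measure mu m)
  end.

Section complex_space.
Context (R : realType) (n : nat).
Implicit Types (z : 'rV[R[i]]_n) (A B S K : set 'rV[R[i]]_n).

Definition enorm z : R :=
  Num.sqrt (\sum_(j < n) Normc.normc (z 0 j) ^+ 2).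

Local Notation coords :=
  (n.-tuple (measurableTypeR R) * n.-tuple (measurableTypeR R))%type.

Definition cvec (p : coords) : 'rV[R[i]]_n :=
  \row_(j < n) (tnth p.1 j +i* tnth p.2 j).

(* Lebesgue measure on R^n * R^n, read as C^n through [cvec] *)
Definition lebesgue_cvec : {measure set coords -> \bar R} :=
  (tuple_measure lebesgue_measure n \x tuple_measure lebesgue_measure n)%E.

Definition gauss_density z : R :=
  (2 * pi) ^- n * expR (- (enorm z ^+ 2 / 2)).

Definition gauss_measure A : \bar R :=
  (\int[lebesgue_cvec]_(x in cvec @^-1` A) (gauss_density (cvec x))%:E)%E.

Definition minkowski_sum A B : set 'rV[R[i]]_n :=
  [set a + b | a in A & b in B].

Definition dilate (c : R[i]) A : set 'rV[R[i]]_n := [set c *: z | z in A].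

Definition dist0 S : R := inf [set enorm z | z in S].

(* In [convex_set] the weights are c : R[i] with 0 <= c <= 1; the order of
   R[i] only relates numbers with equal imaginary parts, so these are exactly
   the real weights in [0, 1]. *)
Definition convex_body K :=
  [/\ compact K, convex_set K & interior K !=set0].

Definition circled K := forall t : R, dilate (cos t +i* sin t) K = K.

Definition holomorphic (f : 'rV[R[i]]_n -> R[i]) :=
  forall z, differentiable f z.

End complex_space.

(* Main.v *)
Require Import Defs.
From HB Require Import structures.
From mathcomp Require Import all_boot all_order all_algebra.
From mathcomp Require Import complex.
From mathcomp Require Import all_classical all_reals all_analysis.
From mathcomp Require Import measurable_realfun.
From mathcomp Require Import ring lra.
Import Order.TTheory GRing.Theory Num.Theory.
Import numFieldNormedType.Exports.
Local Open Scope classical_set_scope.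
Local Open Scope ring_scope.
Local Open Scope complex_scope.
Set Implicit Arguments.
Unset Strict Implicit.
Unset Printing Implicit Defensive.

(** Why the inequality holds.

    Geometry reduces it to a slab and a tube.  Let [s] be the radius of the
    largest centered ball in [K] and [q] the unit vector pointing to a common
    boundary point of [K] and this ball.  Since [K] is convex and circled, it lies
    in the slab [|<z, q>| <= s] (lemma [circled_slab]), and the orthogonal
    complement [H] of [q] does what is asked.  Indeed [H1 + r K] lies in a slab
    of half-width [r s] around [H1], while [Z + r K] contains the tube of points at
    distance at most [r s] from [Z], so that it suffices to compare the Gaussian
    measures of this slab and of this tube ([slab_le_tube]).

    Both measures are limits of integrals of [phi (dist ^+ 2)], where [phi] is a
    decreasing combination of exponentials close to the indicator function of
    [[0, (r s) ^+ 2]] ([step_profile]).  For the slab, the integral is explicit: it is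
    [theta 1 (d ^+ 2)], where [d] is the common distance to the origin and
    [theta t] is the heat evolution of the radial function [phi (|w| ^+ 2)] on the
    plane ([integral_theta_hdot]).  For the tube, the integral is the value
    [v 1 0] of the solution [v] of the heat equation on [C^n] with initial value
    [phi (dist (x, Z) ^+ 2)].  The claim thus is
        [theta t (dist (x, Z) ^+ 2) <= v t x]
    at [t = 1] and [x = 0] ([theta_le_gauss]).  There is equality for [t = 0], and
    for all [t] if [Z] is a complex hyperplane; in general the left hand side is a
    subsolution of the heat equation off [Z], and the maximum principle applies
    ([no_interior_max], [comparison_off_zeros]).

    That it is a subsolution comes from the pseudoconvexity of the complement of
    [Z].  Let [p] be a point of [Z] closest to [x].  An analytic disc in the
    complement of [Z], centered at [x], cannot be pushed along [p - x] until its
    center reaches [p] without its boundary meeting [Z] before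
    ([zero_near_disc], from the minimum modulus principle).  For well-chosen
    discs this bounds the second derivatives of any smooth upper barrier of
    [theta t (dist (x, Z) ^+ 2)] in each complex coordinate direction by the
    value they have for the hyperplane through [p] orthogonal to [x - p]
    ([line_touch]); the sum over the coordinates is the differential inequality.
    The maximum principle is applied to a function that contains a small multiple
    of the logarithm of [|f|]; it repels the maximum from [Z] and, being
    pluriharmonic off [Z], it is harmless there. *)
Local Notation Re := complex.Re.
Local Notation Im := complex.Im.

(** * Integrals of continuous functions over segments *)

Section segment_integral.
Context {R : realType}.
Implicit Types (f g : R -> R) (a b c m : R).

Definition seg_continuous f a b := forall x, a <= x <= b -> {for x, continuous f}.

Definition segI f a b : R := \int[lebesgue_measure]_(x in `[a, b]) f x.

Lemma seg_integrable f a b : seg_continuous f a b ->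
  lebesgue_measure.-integrable `[a, b] (EFin \o f).
Proof.
move=> cf; apply: continuous_compact_integrable; first exact: segment_compact.
apply/continuous_in_subspaceT => x; rewrite inE/= in_itv/= => xab.
exact: cf.
Qed.

Lemma seg_continuousW f a b a' b' : a <= a' -> b' <= b ->
  seg_continuous f a b -> seg_continuous f a' b'.
Proof. by move=> aa bb cf x /andP[ax xb]; apply: cf; apply/andP; split; lra. Qed.

Lemma segIB f g a b : seg_continuous f a b -> seg_continuous g a b ->
  segI (fun x => f x - g x) a b = segI f a b - segI g a b.
Proof. by move=> cf cg; rewrite /segI RintegralB//; exact: seg_integrable. Qed.

Lemma segI_split f a m b : a <= m -> m <= b -> seg_continuous f a b ->
  segI f a b = segI f a m + segI f m b.
Proof.
move=> am mb cf; rewrite /segI.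
have := @Rintegral_itvB _ f (BLeft a) (BRight b) m (seg_integrable cf).
rewrite !bnd_simp => /(_ am mb).
rewrite Rintegral_itv_obnd_cbnd; last first.
  apply: (integrableS _ _ _ (seg_integrable cf)) => //.
  by move=> x /=; rewrite !in_itv/= => /andP[]; lra.
by move=> <-; lra.
Qed.

Lemma segI_cst a b k : a <= b -> segI (fun=> k) a b = k * (b - a).
Proof.
move=> ab; rewrite /segI Rintegral_cst//=.
rewrite lebesgue_measure_itv/= lte_fin; case: ltgtP ab => //= -> _.
by rewrite subrr.
Qed.

Lemma segI_le f a b k : a <= b -> seg_continuous f a b ->
  (forall x, a <= x <= b -> f x <= k) -> segI f a b <= k * (b - a).
Proof.
move=> ab cf fk; rewrite -segI_cst//; apply: le_Rintegral => //.
- exact: seg_integrable.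
- by apply: seg_integrable => x _; exact: cst_continuous.
Qed.

Lemma segI_ge f a b k : a <= b -> seg_continuous f a b ->
  (forall x, a <= x <= b -> k <= f x) -> k * (b - a) <= segI f a b.
Proof.
move=> ab cf fk; rewrite -segI_cst//; apply: le_Rintegral => //.
- by apply: seg_integrable => x _; exact: cst_continuous.
- exact: seg_integrable.
Qed.

Lemma segI_norm f a b k : a <= b -> seg_continuous f a b ->
  (forall x, a <= x <= b -> `|f x| <= k) -> `|segI f a b| <= k * (b - a).
Proof.
move=> ab cf fk; rewrite /segI; apply: le_trans (le_normr_Rintegral _ _) _ => //.
  exact: seg_integrable.
apply: (@segI_le (fun x => `|f x|)) => // x xab.
by apply: cvg_norm; exact: cf.
Qed.

End segment_integral.

(** * Goursat's theorem for rectangles *)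

Section goursat.
Context {R : realType}.
Implicit Types (U V : R -> R -> R) (a b c d e h k w x y : R).

(** Complex differentiability of [U +i* V] at one point, with derivative
    [al +i* be], in the real coordinates used for integration. *)
Definition cr_differentiable U V x y := exists al be : R,
  forall e, 0 < e -> exists2 d, 0 < d & forall h k, `|h| < d -> `|k| < d ->
    `|U (x + h) (y + k) - U x y - (al * h - be * k)| <= e * (`|h| + `|k|) /\
    `|V (x + h) (y + k) - V x y - (be * h + al * k)| <= e * (`|h| + `|k|).

Lemma continuous_of_lip (f : R -> R) x d L : 0 < d ->
  (forall h, `|h| < d -> `|f (x + h) - f x| <= L * `|h|) -> {for x, continuous f}.
Proof.
move=> d0 fL; apply/cvgrPdist_lt => e e0.
have L0 : 0 < `|L| + 1 by rewrite ltr_wpDl.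
exists (Num.min d (e / (`|L| + 1))); first by rewrite /= lt_min d0 divr_gt0.
move=> y /=; rewrite lt_min distrC => /andP[yd ye].
rewrite distrC; have := fL (y - x) yd; rewrite subrKC => /le_lt_trans; apply.
move: ye; rewrite ltr_pdivlMr// mulrC; apply: le_lt_trans.
by rewrite ler_wpM2r// (le_trans (ler_norm _))// lerDl.
Qed.

Lemma cr_lipschitz U V x y : cr_differentiable U V x y ->
  exists2 dL : R * R, 0 < dL.1 & forall h k, `|h| < dL.1 -> `|k| < dL.1 ->
    `|U (x + h) (y + k) - U x y| <= dL.2 * (`|h| + `|k|) /\
    `|V (x + h) (y + k) - V x y| <= dL.2 * (`|h| + `|k|).
Proof.
move=> [al [be]] /(_ 1 ltr01)[d d0 H].
exists (d, 1 + `|al| + `|be|) => //= h k hd kd; have [HU HV] := H h k hd kd.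
have nrm t u : `|t * u| = `|t| * `|u| by exact: normrM.
split.
- have := ler_normD (U (x + h) (y + k) - U x y - (al * h - be * k)) (al * h - be * k).
  rewrite subrK => /le_trans; apply.
  have := ler_normB (al * h) (be * k); rewrite !nrm.
  have := normr_ge0 al; have := normr_ge0 be.
  have := normr_ge0 h; have := normr_ge0 k. nra.
- have := ler_normD (V (x + h) (y + k) - V x y - (be * h + al * k)) (be * h + al * k).
  rewrite subrK => /le_trans; apply.
  have := ler_normD (be * h) (al * k); rewrite !nrm.
  have := normr_ge0 al; have := normr_ge0 be.
  have := normr_ge0 h; have := normr_ge0 k. nra.
Qed.

Lemma cr_continuous U V x y : cr_differentiable U V x y ->
  [/\ {for x, continuous (U^~ y)}, {for y, continuous (U x)},
      {for x, continuous (V^~ y)} & {for y, continuous (V x)}].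
Proof.
move=> /cr_lipschitz[[d L] /= d0 H].
split; apply: (@continuous_of_lip _ _ _ L d0) => h hd.
- by have := H h 0 hd; rewrite normr0 !addr0 => /(_ d0)[].
- by have := H 0 h; rewrite normr0 !addr0 add0r => /(_ d0 hd)[].
- by have := H h 0 hd; rewrite normr0 !addr0 => /(_ d0)[].
- by have := H 0 h; rewrite normr0 !addr0 add0r => /(_ d0 hd)[].
Qed.

(** The real part of the integral of [(U +i* V) dz] along the boundary of the
    rectangle [[a, b] x [c, d]]. *)
Definition rect_integral U V a b c d : R :=
  segI (fun x => U x c - U x d) a b - segI (fun y => V b y - V a y) c d.

Definition cr_on U V a b c d := forall x y, a <= x <= b -> c <= y <= d ->
  cr_differentiable U V x y.

Lemma seg_continuousB (f g : R -> R) a b : seg_continuous f a b ->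
  seg_continuous g a b -> seg_continuous (fun x => f x - g x) a b.
Proof. by move=> cf cg x xab; apply: cvgB; [exact: cf|exact: cg]. Qed.

Lemma cr_on_seg U V a b c d : cr_on U V a b c d ->
  (forall y, c <= y <= d -> seg_continuous (U^~ y) a b /\ seg_continuous (V^~ y) a b) /\
  (forall x, a <= x <= b -> seg_continuous (U x) c d /\ seg_continuous (V x) c d).
Proof.
move=> H; split=> [y yab|x xab]; split=> z zab.
- by have [] := cr_continuous (H z y zab yab).
- by have [] := cr_continuous (H z y zab yab).
- by have [] := cr_continuous (H x z xab zab).
- by have [] := cr_continuous (H x z xab zab).
Qed.

(** The sides interior to the rectangle are run through twice, in opposite
    directions. *)
Lemma rect_integral_quarter U V a m b c l d : a <= m <= b -> c <= l <= d ->
  cr_on U V a b c d ->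
  rect_integral U V a b c d =
  rect_integral U V a m c l + rect_integral U V m b c l +
  (rect_integral U V a m l d + rect_integral U V m b l d).
Proof.
move=> /andP[am mb] /andP[cl ld] H; have [Hy Hx] := cr_on_seg H.
have cc : c <= c <= d by lra.
have ll : c <= l <= d by lra.
have dd : c <= d <= d by lra.
have aa : a <= a <= b by lra.
have mm : a <= m <= b by lra.
have bb : a <= b <= b by lra.
have W1 f : seg_continuous f a b -> seg_continuous f a m.
  by move=> Hf; apply: (seg_continuousW _ _ Hf).
have W2 f : seg_continuous f a b -> seg_continuous f m b.
  by move=> Hf; apply: (seg_continuousW _ _ Hf).
have W3 f : seg_continuous f c d -> seg_continuous f c l.
  by move=> Hf; apply: (seg_continuousW _ _ Hf).
have W4 f : seg_continuous f c d -> seg_continuous f l d.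
  by move=> Hf; apply: (seg_continuousW _ _ Hf).
have [Uc _] := Hy _ cc; have [Ul _] := Hy _ ll; have [Ud _] := Hy _ dd.
have [_ Va] := Hx _ aa; have [_ Vm] := Hx _ mm; have [_ Vb] := Hx _ bb.
rewrite /rect_integral.
rewrite (segIB (W1 _ Uc) (W1 _ Ul)) (segIB (W2 _ Uc) (W2 _ Ul)).
rewrite (segIB (W1 _ Ul) (W1 _ Ud)) (segIB (W2 _ Ul) (W2 _ Ud)).
rewrite (segIB (W3 _ Vm) (W3 _ Va)) (segIB (W3 _ Vb) (W3 _ Vm)).
rewrite (segIB (W4 _ Vm) (W4 _ Va)) (segIB (W4 _ Vb) (W4 _ Vm)).
rewrite (segIB Uc Ud) (segIB Vb Va).
rewrite (segI_split am mb Uc) (segI_split am mb Ud).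
rewrite (segI_split cl ld Vb) (segI_split cl ld Va).
by ring.
Qed.

(** The affine part of [U +i* V] contributes nothing to the boundary integral,
    so that only the differentiability remainder is left. *)
Lemma rect_integral_small U V a b c d x y : a <= x <= b -> c <= y <= d ->
  cr_on U V a b c d -> forall e, 0 < e ->
  exists2 r, 0 < r & forall a' b' c' d', a <= a' -> b' <= b -> c <= c' -> d' <= d ->
    a' <= x <= b' -> c' <= y <= d' -> b' - a' < r -> d' - c' < r ->
    `|rect_integral U V a' b' c' d'| <= e * ((b' - a') + (d' - c')) ^+ 2.
Proof.
move=> xab ycd H e e0.
have [al [be]] := H x y xab ycd => /(_ (e / 2))[]; first by rewrite divr_gt0.
move=> r r0 D; exists r => // a' b' c' d' aa bb cc dd /andP[ax xb] /andP[cy yd] br dr.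
have {}H : cr_on U V a' b' c' d'.
  by move=> s t /andP[? ?] /andP[? ?]; apply: H; apply/andP; split; lra.
have [Hy Hx] := cr_on_seg H.
have cc' : c' <= c' <= d' by lra.
have dd' : c' <= d' <= d' by lra.
have aa' : a' <= a' <= b' by lra.
have bb' : a' <= b' <= b' by lra.
have [Uc _] := Hy _ cc'; have [Ud _] := Hy _ dd'.
have [_ Va] := Hx _ aa'; have [_ Vb] := Hx _ bb'.
have ccst k u v : seg_continuous (fun=> k) u v by move=> z _; exact: cst_continuous.
have -> : rect_integral U V a' b' c' d' =
   segI (fun s => (U s c' - U s d') - be * (d' - c')) a' b' -
   segI (fun t => (V b' t - V a' t) - be * (b' - a')) c' d'.
  have C1 := seg_continuousB Uc Ud; have C2 := seg_continuousB Vb Va.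
  rewrite (segIB C1)// (segIB C2)//.
  rewrite !segI_cst; [rewrite /rect_integral; ring|lra|lra].
set S := (b' - a') + (d' - c').
have bnd h k : `|h| <= b' - a' -> `|k| <= d' - c' -> e / 2 * (`|h| + `|k|) <= e / 2 * S.
  by move=> hh kk; rewrite ler_wpM2l ?divr_ge0 ?(ltW e0)// /S lerD.
have nh s : a' <= s <= b' -> `|s - x| <= b' - a'.
  by move=> /andP[? ?]; rewrite ler_norml; apply/andP; split; lra.
have nk t : c' <= t <= d' -> `|t - y| <= d' - c'.
  by move=> /andP[? ?]; rewrite ler_norml; apply/andP; split; lra.
apply: le_trans (ler_normB _ _) _.
have I1 : `|segI (fun s => (U s c' - U s d') - be * (d' - c')) a' b'| <= e * S * (b' - a').
  apply: segI_norm; first lra.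
    by apply: seg_continuousB => //; exact: seg_continuousB.
  move=> s sab; have s1 := nh s sab.
  have k1 := nk _ cc'; have k2 := nk _ dd'.
  have [D1 _] := D (s - x) (c' - y) (le_lt_trans s1 br) (le_lt_trans k1 dr).
  have [D2 _] := D (s - x) (d' - y) (le_lt_trans s1 br) (le_lt_trans k2 dr).
  move: D1 D2; rewrite !subrKC => /le_trans/(_ (bnd _ _ s1 k1)) D1.
  move=> /le_trans/(_ (bnd _ _ s1 k2)) D2.
  move: D1 D2; rewrite !ler_norml => /andP[? ?] /andP[? ?]; apply/andP; split; lra.
have I2 : `|segI (fun t => (V b' t - V a' t) - be * (b' - a')) c' d'| <= e * S * (d' - c').
  apply: segI_norm; first lra.
    by apply: seg_continuousB => //; exact: seg_continuousB.
  move=> t tab; have t1 := nk t tab.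
  have k1 := nh _ aa'; have k2 := nh _ bb'.
  have [_ D1] := D (a' - x) (t - y) (le_lt_trans k1 br) (le_lt_trans t1 dr).
  have [_ D2] := D (b' - x) (t - y) (le_lt_trans k2 br) (le_lt_trans t1 dr).
  move: D1 D2; rewrite !subrKC => /le_trans/(_ (bnd _ _ k1 t1)) D1.
  move=> /le_trans/(_ (bnd _ _ k2 t1)) D2.
  move: D1 D2; rewrite !ler_norml => /andP[? ?] /andP[? ?]; apply/andP; split; lra.
have -> : e * S ^+ 2 = e * S * (b' - a') + e * S * (d' - c') by rewrite /S; ring.
by rewrite lerD.
Qed.

End goursat.

Section goursat_thm.
Context {R : realType}.
Implicit Types (U V : R -> R -> R) (a b c d e h w x y : R) (k : nat).

(** One quarter carries at least a quarter of the boundary integral, which is what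
    the bisection iterates. *)
Lemma quarter_pick U V s t w h e : 0 <= w -> 0 <= h ->
  cr_on U V s (s + w + w) t (t + h + h) ->
  4 * e <= `|rect_integral U V s (s + w + w) t (t + h + h)| ->
  exists p : R * R, [/\ s <= p.1 <= s + w, p.1 + w <= s + w + w,
    t <= p.2 <= t + h, p.2 + h <= t + h + h &
    e <= `|rect_integral U V p.1 (p.1 + w) p.2 (p.2 + h)|].
Proof.
move=> w0 h0 H.
have I1 (z u : R) : 0 <= u -> z <= z + u <= z + u + u.
  by move=> u0; rewrite !lerDl u0.
have I2 (z u : R) : 0 <= u -> z <= z <= z + u by move=> u0; rewrite !lerDl u0 lexx.
have I3 (z u : R) : 0 <= u -> z <= z + u <= z + u.
  by move=> u0; rewrite !lerDl u0 lexx.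
rewrite (rect_integral_quarter (I1 _ _ w0) (I1 _ _ h0) H).
set J1 := rect_integral U V s (s + w) t (t + h).
set J2 := rect_integral U V (s + w) (s + w + w) t (t + h).
set J3 := rect_integral U V s (s + w) (t + h) (t + h + h).
set J4 := rect_integral U V (s + w) (s + w + w) (t + h) (t + h + h).
have tri : `|J1 + J2 + (J3 + J4)| <= `|J1| + `|J2| + (`|J3| + `|J4|).
  by apply: le_trans (ler_normD _ _) _; apply: lerD; exact: ler_normD.
move=> /le_trans/(_ tri) big.
have [J1b|J1s] := leP e `|J1|.
  by exists (s, t); split; rewrite /= ?I2//; have /andP[? ?] := I1 s w w0; have /andP[? ?] := I1 t h h0.
have [J2b|J2s] := leP e `|J2|.
  by exists (s + w, t); split; rewrite /= ?I2 ?I3//; have /andP[] := I1 t h h0.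
have [J3b|J3s] := leP e `|J3|.
  by exists (s, t + h); split; rewrite /= ?I2 ?I3//; have /andP[] := I1 s w w0.
have [J4b|J4s] := leP e `|J4|.
  by exists (s + w, t + h); split; rewrite /= ?I2 ?I3.
by exfalso; clear -big J1s J2s J3s J4s; lra.
Qed.

(** Bisection produces nested rectangles on which the boundary integral is at
    least a fixed multiple of the area; at their common point this contradicts
    [rect_integral_small]. *)
Theorem rect_integral_eq0 U V a b c d : a <= b -> c <= d ->
  cr_on U V a b c d -> rect_integral U V a b c d = 0.
Proof.
move=> ab cd H; apply/eqP/negPn/negP => J0.
set w := b - a; set h := d - c.
set J := fun (k : nat) (s t : R) => rect_integral U V s (s + w / 2 ^+ k) t (t + h / 2 ^+ k).
set inR := fun (k : nat) (s t : R) => [/\ a <= s, s + w / 2 ^+ k <= b, c <= t & t + h / 2 ^+ k <= d].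
set eta := `|rect_integral U V a b c d|.
have eta0 : 0 < eta by rewrite normr_gt0.
have w0 : 0 <= w by rewrite /w; lra.
have h0 : 0 <= h by rewrite /h; lra.
have p0 k : 0 < (2 : R) ^+ k by exact: exprn_gt0.
pose P (k : nat) (s : R * R) := inR k s.1 s.2 /\ eta / 4 ^+ k <= `|J k s.1 s.2|.
have step (ks : nat * (R * R)) : exists s' : R * R, P ks.1 ks.2 ->
    [/\ P ks.1.+1 s', ks.2.1 <= s'.1 <= ks.2.1 + w / 2 ^+ ks.1.+1
      & ks.2.2 <= s'.2 <= ks.2.2 + h / 2 ^+ ks.1.+1].
  case: ks => k [s t] /=; rewrite /P/=.
  case: (pselect (inR k s t /\ eta / 4 ^+ k <= `|J k s t|)); last by exists (0, 0).
  move=> [[s1 s2 t1 t2] big].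
  have wk : w / 2 ^+ k = w / 2 ^+ k.+1 + w / 2 ^+ k.+1.
    by rewrite exprS; field; rewrite gt_eqF.
  have hk : h / 2 ^+ k = h / 2 ^+ k.+1 + h / 2 ^+ k.+1.
    by rewrite exprS; field; rewrite gt_eqF.
  have wk0 : 0 <= w / 2 ^+ k.+1 by rewrite divr_ge0// ltW.
  have hk0 : 0 <= h / 2 ^+ k.+1 by rewrite divr_ge0// ltW.
  set w' := w / 2 ^+ k.+1 in wk wk0 *; set h' := h / 2 ^+ k.+1 in hk hk0 *.
  have Hst : cr_on U V s (s + w' + w') t (t + h' + h').
    move=> x y /andP[sx xs] /andP[ty yt]; apply: H.
      by rewrite (le_trans s1 sx) (le_trans xs)// -addrA -wk.
    by rewrite (le_trans t1 ty) (le_trans yt)// -addrA -hk.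
  have e4 : eta / 4 ^+ k = 4 * (eta / 4 ^+ k.+1).
    by rewrite exprS; field; rewrite gt_eqF ?exprn_gt0.
  rewrite wk addrA in s2; rewrite hk addrA in t2.
  rewrite e4 /J wk hk !(addrA _ w') !(addrA _ h') in big.
  have [[s' t'] /= [s1' s2' t1' t2' big']] := quarter_pick wk0 hk0 Hst big.
  have [/andP[s1l _] /andP[t1l _]] := (s1', t1').
  exists (s', t') => _; split=> //; split=> //; rewrite /inR /= -/w' -/h'.
  by split; [exact: le_trans s1l|exact: le_trans s2' s2|exact: le_trans t1l|exact: le_trans t2' t2].
have [nxt nxtP] := choice step.
pose S := fix S (k : nat) : R * R := if k is k'.+1 then nxt (k', S k') else (a, c).
have PS k : P k (S k).
  elim: k => [|k IH]; last by have [] := nxtP (k, S k) IH.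
  rewrite /P/= /inR/= /J expr0 !divr1 /w /h !subrKC; split=> //; split; lra.
have S1 k : (S k).1 <= (S k.+1).1 <= (S k).1 + w / 2 ^+ k.+1 by have [] := nxtP (k, S k) (PS k).
have S2 k : (S k).2 <= (S k.+1).2 <= (S k).2 + h / 2 ^+ k.+1 by have [] := nxtP (k, S k) (PS k).
have nested (f : nat -> R) (u l : R) : 0 <= u ->
    (forall k, f k <= f k.+1 <= f k + u / 2 ^+ k.+1) -> (forall k, f k <= l) ->
    exists z, forall k, f k <= z <= f k + u / 2 ^+ k.
  move=> u0 fS fl; pose A := range f.
  have ubA : has_ubound A by exists l => _ [k _ <-].
  have A0 : A !=set0 by exists (f 0%N), 0%N.
  have mono j k : (f k <= f (k + j)%N).
    elim: j => [|j IH]; first by rewrite addn0.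
    by rewrite addnS (le_trans IH)//; have /andP[] := fS (k + j)%N.
  have monou j k : (f (k + j)%N + u / 2 ^+ (k + j)) <= f k + u / 2 ^+ k.
    elim: j => [|j IH]; first by rewrite addn0.
    rewrite addnS; apply: le_trans IH; have /andP[_ ] := fS (k + j)%N.
    have -> : u / 2 ^+ (k + j) = u / 2 ^+ (k + j).+1 + u / 2 ^+ (k + j).+1.
      by rewrite exprS; field; rewrite gt_eqF.
    lra.
  exists (sup A) => k; apply/andP; split.
    by apply: ub_le_sup => //; exists k.
  apply: ge_sup => // _ [j _ <-].
  have [jk|/ltnW jk] := leqP j k.
    have := mono (k - j)%N j; rewrite subnKC// => /le_trans; apply.
    by rewrite lerDl divr_ge0// ltW.
  apply: le_trans (monou (j - k)%N k); rewrite subnKC// lerDl divr_ge0// ltW//.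
have [x xP] : exists x, forall k, (S k).1 <= x <= (S k).1 + w / 2 ^+ k.
  apply: (nested _ _ b) => // k; have [[_ ? _ _] _] := PS k.
  by have : 0 <= w / 2 ^+ k; [rewrite divr_ge0// ltW|lra].
have [y yP] : exists y, forall k, (S k).2 <= y <= (S k).2 + h / 2 ^+ k.
  apply: (nested _ _ d) => // k; have [[_ _ _ ?] _] := PS k.
  by have : 0 <= h / 2 ^+ k; [rewrite divr_ge0// ltW|lra].
have xab : a <= x <= b by have := xP 0%N; rewrite /= expr0 divr1 /w; lra.
have ycd : c <= y <= d by have := yP 0%N; rewrite /= expr0 divr1 /h; lra.
set T := (w + h) ^+ 2 + 1.
have T0 : 0 < T by rewrite ltr_wpDl// sqr_ge0.
have [r r0 Hr] := rect_integral_small xab ycd H (divr_gt0 eta0 T0).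
have [k kr] : exists k : nat, (w + h) / 2 ^+ k < r.
  have [k kP] : exists k : nat, (w + h) / r < k%:R.
    by exists (Num.truncn ((w + h) / r)).+1; exact: truncnS_gt.
  exists k; rewrite ltr_pdivrMr//.
  move: kP; rewrite ltr_pdivrMr// => /lt_le_trans; apply.
  by rewrite mulrC ler_wpM2l ?(ltW r0)// -natrX ler_nat ltnW// ltn_expl.
have [[s1 s2 t1 t2] big] := PS k.
have wk0 : 0 <= w / 2 ^+ k by rewrite divr_ge0// ltW.
have hk0 : 0 <= h / 2 ^+ k by rewrite divr_ge0// ltW.
have whr : w / 2 ^+ k + h / 2 ^+ k < r by rewrite -mulrDl.
have := Hr _ _ _ _ s1 s2 t1 t2 (xP k) (yP k).
rewrite !(addrC (S k).1) !(addrC (S k).2) !addrK => /(_ ltac:(lra) ltac:(lra)).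
rewrite !(addrC _ (S k).1) !(addrC _ (S k).2) => /(le_trans big).
rewrite -mulrDl expr_div_n -exprM mulnC exprM (_ : 2 ^+ 2 = 4 :> R); last by rewrite -natrX.
have p4 : 0 < (4 : R) ^+ k by exact: exprn_gt0.
rewrite mulrA ler_pM2r ?invr_gt0//.
rewrite mulrAC ler_pdivlMr// ler_pM2l// /T; lra.
Qed.

(** Periodicity makes the horizontal sides of the rectangle cancel, so that the
    vertical ones give equal integrals. *)
Lemma periodic_seg_mean U V a b p : a <= b -> 0 <= p ->
  cr_on U V a b 0 p -> (forall x, V x 0 = V x p) ->
  segI (U a) 0 p = segI (U b) 0 p.
Proof.
move=> ab p0 H per.
have H' : cr_on (fun x y => - V x y) U a b 0 p.
  move=> x y xab ycd; have [al [be D]] := H x y xab ycd.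
  exists (- be), al => e /D[r r0 {}D]; exists r => // s t sr tr.
  have [D1 D2] := D s t sr tr; split.
    by rewrite -normrN; move: D2; congr (`|_| <= _); ring.
  by move: D1; congr (`|_| <= _); ring.
have := rect_integral_eq0 ab p0 H'; rewrite /rect_integral.
have [_ Hx] := cr_on_seg H.
rewrite (_ : (fun x => - V x 0 - - V x p) = fun=> 0); last first.
  by apply/funext => x; rewrite per subrr.
rewrite segI_cst// mul0r sub0r segIB; first lra.
  by have [] := Hx b ltac:(lra).
by have [] := Hx a ltac:(lra).
Qed.

End goursat_thm.

(** * The modulus and complex differentiation *)

Section modulus.
Context {R : realType}.
Implicit Types (z w : R[i]) (x y : R).

(** The modulus as an element of [R]; the norm of [R[i]] takes its values in
    [R[i]]. *)
Definition cabs z : R := Normc.normc z.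

Lemma cabsE z : cabs z = Num.sqrt (Re z ^+ 2 + Im z ^+ 2).
Proof. by case: z. Qed.
Lemma cabs_ge0 z : 0 <= cabs z. Proof. by rewrite cabsE sqrtr_ge0. Qed.
Lemma sqr_cabs z : cabs z ^+ 2 = Re z ^+ 2 + Im z ^+ 2.
Proof. by rewrite cabsE sqr_sqrtr// addr_ge0 ?sqr_ge0. Qed.
Lemma cabs0 : cabs 0 = 0. Proof. exact: Normc.normc0. Qed.
Lemma cabs1 : cabs 1 = 1. Proof. exact: Normc.normc1. Qed.
Lemma cabsM z w : cabs (z * w) = cabs z * cabs w.
Proof. exact: Normc.normcM. Qed.
Lemma cabsD z w : cabs (z + w) <= cabs z + cabs w.
Proof. exact: le_normcD. Qed.
Lemma cabsN z : cabs (- z) = cabs z. Proof. exact: normcN. Qed.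
Lemma cabsV z : cabs z^-1 = (cabs z)^-1. Proof. exact: Normc.normcV. Qed.
Lemma cabsB z w : cabs (z - w) = cabs (w - z). Proof. by rewrite -cabsN opprB. Qed.
Lemma cabsX z n : cabs (z ^+ n) = cabs z ^+ n.
Proof. by elim: n => [|n IH]; rewrite ?cabs1// !exprS cabsM IH. Qed.
Lemma cabs_eq0 z : (cabs z == 0) = (z == 0).
Proof. by apply/eqP/eqP => [/Normc.eq0_normc//|->]; rewrite cabs0. Qed.
Lemma cabs_gt0 z : (0 < cabs z) = (z != 0).
Proof. by rewrite lt0r cabs_eq0 cabs_ge0 andbT. Qed.
Lemma cabs_real x : cabs x%:C = `|x|.
Proof. by rewrite cabsE/= expr0n/= addr0 sqrtr_sqr. Qed.
Lemma cabs_Re z : `|Re z| <= cabs z.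
Proof.
rewrite cabsE -sqrtr_sqr ler_sqrt ?lerDl ?sqr_ge0//.
by rewrite addr_ge0 ?sqr_ge0.
Qed.
Lemma cabs_Im z : `|Im z| <= cabs z.
Proof.
rewrite cabsE -sqrtr_sqr ler_sqrt ?lerDr ?sqr_ge0//.
by rewrite addr_ge0 ?sqr_ge0.
Qed.
Lemma cabs_le_ReIm z : cabs z <= `|Re z| + `|Im z|.
Proof.
rewrite cabsE -[leRHS]ger0_norm ?addr_ge0// -sqrtr_sqr ler_sqrt ?sqr_ge0//.
rewrite sqrrD !real_normK ?num_real//; have := normr_ge0 (Re z).
by have := normr_ge0 (Im z); nra.
Qed.
Lemma cabs_conj z : cabs z^* = cabs z.
Proof. by rewrite !cabsE; case: z => a b /=; rewrite sqrrN. Qed.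
Lemma mul_conj z : z * z^* = (cabs z ^+ 2)%:C.
Proof.
rewrite sqr_cabs; case: z => a b /=; simpc; apply/eqP; rewrite eq_complex/=.
by apply/andP; split; apply/eqP; ring.
Qed.
Lemma lerB_cabs z w : cabs z - cabs w <= cabs (z - w).
Proof. by rewrite lerBlDr (le_trans _ (cabsD _ _))// subrK. Qed.
Lemma ler_dist_cabs z w : `|cabs z - cabs w| <= cabs (z - w).
Proof.
rewrite ler_norml lerB_cabs andbT lerNl opprB.
by rewrite (cabsB z) lerB_cabs.
Qed.
Lemma lerB_cabsD z w : cabs z - cabs w <= cabs (z + w).
Proof. by have := lerB_cabs z (- w); rewrite opprK cabsN. Qed.
Lemma ReD z w : Re (z + w) = Re z + Re w. Proof. by case: z; case: w. Qed.
Lemma ImD z w : Im (z + w) = Im z + Im w. Proof. by case: z; case: w. Qed.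
Lemma ReN z : Re (- z) = - Re z. Proof. by case: z. Qed.
Lemma ImN z : Im (- z) = - Im z. Proof. by case: z. Qed.
Lemma ReM z w : Re (z * w) = Re z * Re w - Im z * Im w.
Proof. by case: z; case: w => *; simpc. Qed.
Lemma ImM z w : Im (z * w) = Re z * Im w + Im z * Re w.
Proof. by case: z; case: w => *; simpc. Qed.

End modulus.

Arguments cabs {R} z : simpl never.

Section complex_derivative.
Context {R : realType}.
Implicit Types (g k : R[i] -> R[i]) (z w d h : R[i]) (e r : R).

Definition cderiv g z d := forall e, 0 < e -> exists2 r : R, 0 < r &
  forall h, cabs h < r -> cabs (g (z + h) - g z - d * h) <= e * cabs h.

Definition cdiff g z := exists d, cderiv g z d.

Lemma cderiv_lip g z d : cderiv g z d -> exists2 r : R, 0 < r &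
  forall h, cabs h < r -> cabs (g (z + h) - g z) <= (cabs d + 1) * cabs h.
Proof.
move=> /(_ 1 ltr01)[r r0 H]; exists r => // h /H.
have := cabsD (g (z + h) - g z - d * h) (d * h); rewrite subrK cabsM; lra.
Qed.

Lemma cderiv_cst c z : cderiv (fun=> c) z 0.
Proof.
by move=> e e0; exists 1 => // h _; rewrite subrr mul0r subr0 cabs0 mulr_ge0 ?cabs_ge0// ltW.
Qed.

Lemma cderiv_id z : cderiv (fun w => w) z 1.
Proof.
move=> e e0; exists 1 => // h _.
by rewrite mul1r (addrC z) addrK subrr cabs0 mulr_ge0 ?cabs_ge0// ltW.
Qed.

Lemma cderivD g k z d w : cderiv g z d -> cderiv k z w ->
  cderiv (fun x => g x + k x) z (d + w).
Proof.
move=> Hg Hk e e0; have e20 : 0 < e / 2 by rewrite divr_gt0.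
have [r r0 {}Hg] := Hg _ e20; have [s s0 {}Hk] := Hk _ e20.
exists (Num.min r s); first by rewrite lt_min r0.
move=> h; rewrite lt_min => /andP[/Hg A /Hk B].
rewrite (_ : _ - _ = (g (z + h) - g z - d * h) + (k (z + h) - k z - w * h)); last by ring.
by apply: le_trans (cabsD _ _) _; lra.
Qed.

Lemma cderivM g k z d w : cderiv g z d -> cderiv k z w ->
  cderiv (fun x => g x * k x) z (d * k z + g z * w).
Proof.
move=> Hg Hk e e0.
have [t t0 Lk] := cderiv_lip Hk.
set A := cabs (k z) + (cabs w + 1) + 1.
have A0 : 0 < A by rewrite ltr_wpDl// addr_ge0 ?cabs_ge0// addr_ge0 ?cabs_ge0.
set B := cabs (g z) + 1.
have B0 : 0 < B by rewrite ltr_wpDl// cabs_ge0.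
set C := cabs d * (cabs w + 1) + 1.
have C0 : 0 < C by rewrite ltr_wpDl// mulr_ge0 ?cabs_ge0// addr_ge0 ?cabs_ge0.
have e3 : 0 < e / 3 by rewrite divr_gt0.
have [r r0 {}Hg] := Hg _ (divr_gt0 e3 A0); have [s s0 {}Hk] := Hk _ (divr_gt0 e3 B0).
exists (Num.min (Num.min r s) (Num.min t (Num.min 1 (e / 3 / C)))).
  by rewrite !lt_min r0 s0 t0 ltr01 divr_gt0.
move=> h; rewrite !lt_min => /andP[/andP[/Hg{}Hg /Hk{}Hk] /andP[/Lk{}Lk /andP[h1]]].
rewrite ltr_pdivlMr// => hC.
rewrite (_ : _ - _ = (g (z + h) - g z - d * h) * k (z + h) +
   (g z * (k (z + h) - k z - w * h) + d * h * (k (z + h) - k z))); last by ring.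
have h0 := cabs_ge0 h.
have P1 : cabs ((g (z + h) - g z - d * h) * k (z + h)) <= e / 3 * cabs h.
  rewrite cabsM.
  have kA : cabs (k (z + h)) <= A.
    have := cabsD (k (z + h) - k z) (k z); rewrite subrK /A.
    have : (cabs w + 1) * cabs h <= cabs w + 1.
      by rewrite ler_piMr ?(ltW h1)// addr_ge0 ?cabs_ge0.
    lra.
  have := ler_pM (cabs_ge0 _) (cabs_ge0 _) Hg kA; move=> /le_trans; apply.
  by rewrite mulrAC divfK// gt_eqF.
have P2 : cabs (g z * (k (z + h) - k z - w * h)) <= e / 3 * cabs h.
  rewrite cabsM; have gB : cabs (g z) <= B by rewrite /B lerDl.
  have := ler_pM (cabs_ge0 _) (cabs_ge0 _) gB Hk; move=> /le_trans; apply.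
  by rewrite mulrA (mulrC B) divfK// gt_eqF.
have P3 : cabs (d * h * (k (z + h) - k z)) <= e / 3 * cabs h.
  rewrite !cabsM; apply: (@le_trans _ _ (C * cabs h * cabs h)); last first.
    by rewrite ler_wpM2r// mulrC ltW.
  rewrite -mulrA (mulrC C) -!mulrA [leLHS]mulrCA ler_wpM2l//.
  apply: (@le_trans _ _ (cabs d * ((cabs w + 1) * cabs h))).
    by rewrite ler_wpM2l ?cabs_ge0.
  by rewrite mulrA ler_wpM2r// /C lerDl.
apply: le_trans (cabsD _ _) _; apply: le_trans (lerD (lexx _) (cabsD _ _)) _.
lra.
Qed.

Lemma cderiv_comp g k z d w : cderiv k z w -> cderiv g (k z) d ->
  cderiv (fun x => g (k x)) z (d * w).
Proof.
move=> Hk Hg e e0.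
have [t t0 Lk] := cderiv_lip Hk.
set A := cabs w + 1; have A0 : 0 < A by rewrite ltr_wpDl// cabs_ge0.
set B := cabs d + 1; have B0 : 0 < B by rewrite ltr_wpDl// cabs_ge0.
have e2 : 0 < e / 2 by rewrite divr_gt0.
have [r r0 {}Hg] := Hg _ (divr_gt0 e2 A0); have [s s0 {}Hk] := Hk _ (divr_gt0 e2 B0).
exists (Num.min s (Num.min t (r / A))); first by rewrite !lt_min s0 t0 divr_gt0.
move=> h; rewrite !lt_min => /andP[/Hk{}Hk /andP[/Lk{}Lk]].
rewrite ltr_pdivlMr// => hA.
have kr : cabs (k (z + h) - k z) < r by apply: le_lt_trans Lk _; rewrite mulrC.
have := Hg _ kr; rewrite subrKC => {}Hg.
rewrite (_ : _ - _ = (g (k (z + h)) - g (k z) - d * (k (z + h) - k z)) +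
   d * (k (z + h) - k z - w * h)); last by ring.
apply: le_trans (cabsD _ _) _; rewrite cabsM.
have P1 : e / 2 / A * cabs (k (z + h) - k z) <= e / 2 * cabs h.
  have -> : e / 2 * cabs h = e / 2 / A * (A * cabs h) by field; rewrite gt_eqF.
  by rewrite ler_wpM2l// ltW// divr_gt0.
have P2 : cabs d * cabs (k (z + h) - k z - w * h) <= e / 2 * cabs h.
  apply: (@le_trans _ _ (B * (e / 2 / B * cabs h))).
    by rewrite ler_pM ?cabs_ge0// /B lerDl.
  by rewrite mulrA (mulrC B) divfK// gt_eqF.
lra.
Qed.

Lemma cderivV z : z != 0 -> cderiv (fun w => w^-1) z (- z^-1 ^+ 2).
Proof.
move=> z0 e e0; have az0 : 0 < cabs z by rewrite cabs_gt0.
set A := cabs z.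
exists (Num.min (A / 2) (e * A ^+ 3 / 2)).
  by rewrite lt_min !divr_gt0// mulr_gt0// exprn_gt0.
move=> h; rewrite lt_min => /andP[hA he].
have zhA : A / 2 <= cabs (z + h) by have := lerB_cabsD z h; rewrite -/A; lra.
have zh0 : z + h != 0 by rewrite -cabs_gt0; apply: lt_le_trans zhA; rewrite divr_gt0.
rewrite (_ : _ - _ = h * h / (z ^+ 2 * (z + h))); last by field; rewrite zh0 z0.
rewrite !cabsM cabsV cabsM cabsX -/A -mulrA [leRHS]mulrC ler_wpM2l ?cabs_ge0//.
rewrite ler_pdivrMr; last by rewrite mulr_gt0 ?exprn_gt0// (lt_le_trans _ zhA)// divr_gt0.
apply: le_trans (ltW he) _.
have -> : e * A ^+ 3 / 2 = e * (A ^+ 2 * (A / 2)) by ring.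
by rewrite ler_wpM2l ?(ltW e0)// ler_wpM2l// exprn_ge0// cabs_ge0.
Qed.

(** With [w = k (z + h) - k z], the expansion of [g] at [k z] reads
    [h = d * w + o (w)]; as [d] is invertible and [w] tends to [0], it can be solved
    for [w]. *)
Lemma cderiv_inverse g k z d : d != 0 -> cderiv g (k z) d ->
  (exists2 r : R, 0 < r & forall h, cabs h < r -> g (k (z + h)) = z + h) ->
  (forall e, 0 < e -> exists2 r : R, 0 < r & forall h, cabs h < r -> cabs (k (z + h) - k z) < e) ->
  cderiv k z d^-1.
Proof.
move=> d0 Hg [s s0 gk] ck e e0.
have D0 : 0 < cabs d by rewrite cabs_gt0.
set D := cabs d in D0.
have gkz : g (k z) = z by have := gk 0; rewrite addr0 cabs0 => ->.
pose e' := Num.min (D / 2) (e * (D / 2) * D).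
have e'0 : 0 < e' by rewrite lt_min divr_gt0//= !mulr_gt0.
have [r r0 {}Hg] := Hg _ e'0; have [t t0 {}ck] := ck _ r0.
exists (Num.min s t); first by rewrite lt_min s0.
move=> h; rewrite lt_min => /andP[/gk gkh /ck kh].
have zhz : z + h - z = h by ring.
have := Hg _ kh; rewrite subrKC gkh gkz zhz => B.
set u := k (z + h) - k z in B kh *.
have u0 := cabs_ge0 u.
have uh : D / 2 * cabs u <= cabs h.
  have := lerB_cabs (d * u) (d * u - h); rewrite subKr cabsM -/D (cabsB _ h) => B'.
  have : e' * cabs u <= D / 2 * cabs u by rewrite ler_wpM2r// ge_min lexx.
  lra.
have -> : u - d^-1 * h = d^-1 * - (h - d * u) by field.
rewrite cabsM cabsN cabsV -/D ler_pdivrMl//.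
apply: le_trans B _; apply: (@le_trans _ _ (e * (D / 2) * D * cabs u)).
  by rewrite ler_wpM2r// ge_min lexx orbT.
have -> : e * (D / 2) * D * cabs u = D * e * (D / 2 * cabs u) by ring.
by rewrite -mulrA ler_wpM2l ?(ltW D0)// ler_wpM2l// ltW.
Qed.

Lemma cdiff_cst c z : cdiff (fun=> c) z. Proof. by exists 0; exact: cderiv_cst. Qed.
Lemma cdiff_id z : cdiff (fun w => w) z. Proof. by exists 1; exact: cderiv_id. Qed.
Lemma cdiffD g k z : cdiff g z -> cdiff k z -> cdiff (fun x => g x + k x) z.
Proof. by move=> [d D] [w W]; exists (d + w); exact: cderivD. Qed.
Lemma cdiffM g k z : cdiff g z -> cdiff k z -> cdiff (fun x => g x * k x) z.
Proof. by move=> [d D] [w W]; eexists; exact: cderivM D W. Qed.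
Lemma cdiff_comp g k z : cdiff k z -> cdiff g (k z) -> cdiff (fun x => g (k x)) z.
Proof. by move=> [d D] [w W]; eexists; exact: cderiv_comp D W. Qed.
Lemma cdiffV g z : cdiff g z -> g z != 0 -> cdiff (fun x => (g x)^-1) z.
Proof.
by move=> D g0; apply: (cdiff_comp D); eexists; exact: cderivV.
Qed.

End complex_derivative.

(** * The complex exponential and logarithm *)

Section complex_exponential.
Context {R : realType}.
Implicit Types (z w h : R[i]) (e r x y : R).

Lemma is_derive_eps (f : R -> R) x d : is_derive x 1 f d ->
  forall e, 0 < e -> exists2 r : R, 0 < r &
    forall h : R, `|h| < r -> `|f (x + h) - f x - d * h| <= e * `|h|.
Proof.
move=> [df dfE] e e0.
have := df; rewrite /derivable => /cvg_ex[/= l lP].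
have dl : d = l by rewrite -dfE /derive; apply/cvg_lim.
move: lP; rewrite -dl => /cvgrPdist_lt/(_ e e0)/=.
rewrite -(@nbhs_nearE R) => /nbhs_ballP[r /= r0 H].
exists r => // h hr; have [->|h0] := eqVneq h 0.
  by rewrite addr0 subrr mulr0 subr0 normr0 mulr0.
have := H h; rewrite /ball/= sub0r normrN => /(_ hr h0).
rewrite /= /GRing.scale/= mulr1 => B.
have {B} := ltW B; rewrite -(ler_pM2r (_ : 0 < `|h|)) ?normr_gt0// -normrM.
congr (_ <= _); rewrite -normrN; congr `|_|.
by rewrite (addrC x); field.
Qed.

Definition cexp z : R[i] := (expR (Re z))%:C * (cos (Im z) +i* sin (Im z)).

Lemma cexpD z w : cexp (z + w) = cexp z * cexp w.
Proof.
rewrite /cexp ReD ImD expRD cosD sinD; simpc.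
by apply/eqP; rewrite eq_complex/=; apply/andP; split; apply/eqP; ring.
Qed.

Lemma cexp0 : cexp 0 = 1.
Proof. by rewrite /cexp/= expR0 cos0 sin0 mul1r. Qed.

Lemma cabs_cexp z : cabs (cexp z) = expR (Re z).
Proof.
rewrite /cexp cabsM cabs_real ger0_norm ?expR_ge0//.
by rewrite cabsE/= cos2Dsin2 sqrtr1 mulr1.
Qed.

Lemma cexp_neq0 z : cexp z != 0.
Proof. by rewrite -cabs_gt0 cabs_cexp expR_gt0. Qed.

Lemma cexp_2pi_periodic x : cexp (x +i* (2 * pi)) = cexp (x +i* 0).
Proof. by rewrite /cexp/= cos0 sin0 mulrDl mul1r -mulr2n cos2pi sin2pi. Qed.

Lemma cderiv_cexp0 : cderiv cexp 0 1.
Proof.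
move=> e e0; pose e' := Num.min (e / 16) 1.
have e'0 : 0 < e' by rewrite lt_min ltr01 divr_gt0.
have e'e : e' <= e / 16 by rewrite ge_min lexx.
have e'1 : e' <= 1 by rewrite ge_min lexx orbT.
clearbody e'.
have [r1 r10 H1] := is_derive_eps (is_derive_expR (0 : R)) e'0.
have [r2 r20 H2] := is_derive_eps (is_derive_cos (0 : R)) e'0.
have [r3 r30 H3] := is_derive_eps (is_derive_sin (0 : R)) e'0.
exists (Num.min (Num.min r1 r2) (Num.min r3 e')); first by rewrite !lt_min r10 r20 r30.
move=> h; rewrite !lt_min => /andP[/andP[h1 h2] /andP[h3 h4]].
have xh := cabs_Re h; have yh := cabs_Im h.
have := H1 (Re h) (le_lt_trans xh h1); have := H2 (Im h) (le_lt_trans yh h2).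
have := H3 (Im h) (le_lt_trans yh h3).
rewrite !add0r expR0 cos0 sin0 oppr0 mul0r !mul1r !subr0 => S C E.
set x := Re h in xh E *; set y := Im h in yh C S *; set t := cabs h in xh yh h4 *.
have t0 : 0 <= t by exact: cabs_ge0.
have nx0 := normr_ge0 x; have ny0 := normr_ge0 y.
have Et : `|expR x - 1| <= 2 * t.
  have := ler_normD (expR x - 1 - x) x; rewrite subrK => /le_trans; apply.
  nra.
rewrite cexp0; rewrite addr0 in S; apply: le_trans (cabs_le_ReIm _) _.
rewrite /cexp !ReD !ImD !ReN !ImN ReM ImM /= -/x -/y oppr0 !mul0r subr0 !addr0.
have B1 : `|expR x * cos y - 1 - x| <= e / 2 * t.
  have -> : expR x * cos y - 1 - x = (expR x - 1 - x) + (cos y - 1) + (expR x - 1) * (cos y - 1) by ring.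
  have := ler_normD ((expR x - 1 - x) + (cos y - 1)) ((expR x - 1) * (cos y - 1)).
  move=> /le_trans; apply; have := ler_normD (expR x - 1 - x) (cos y - 1).
  rewrite normrM; have : `|expR x - 1| * `|cos y - 1| <= 2 * t * (e' * `|y|).
    by rewrite ler_pM.
  have : t * (e' * `|y|) <= t * e' by rewrite ler_wpM2l// ler_piMr ?(ltW e'0)//; lra.
  have : e' * `|x| <= e' * t by rewrite ler_wpM2l// ltW.
  have : e' * `|y| <= e' * t by rewrite ler_wpM2l// ltW.
  have : e' * t <= e / 16 * t by rewrite ler_wpM2r.
  have : 0 <= e * t by rewrite mulr_ge0// ltW.
  clear -E C; lra.
have B2 : `|expR x * sin y - y| <= e / 2 * t.
  have -> : expR x * sin y - y = (sin y - y) + (expR x - 1) * y + (expR x - 1) * (sin y - y) by ring.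
  have := ler_normD ((sin y - y) + (expR x - 1) * y) ((expR x - 1) * (sin y - y)).
  move=> /le_trans; apply; have := ler_normD (sin y - y) ((expR x - 1) * y).
  rewrite !normrM; have : `|expR x - 1| * `|sin y - y| <= 2 * t * (e' * `|y|).
    by rewrite ler_pM.
  have : `|expR x - 1| * `|y| <= 2 * t * t by rewrite ler_pM.
  have : t * (e' * `|y|) <= t * e' by rewrite ler_wpM2l// ler_piMr ?(ltW e'0)//; lra.
  have : t * t <= e' * t by rewrite ler_wpM2r// ltW.
  have : e' * `|y| <= e' * t by rewrite ler_wpM2l// ltW.
  have : e' * t <= e / 16 * t by rewrite ler_wpM2r.
  have : 0 <= e * t by rewrite mulr_ge0// ltW.
  clear -S; lra.
clear -B1 B2; lra.
Qed.

Lemma cderiv_cexp z : cderiv cexp z (cexp z).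
Proof.
move=> e e0; have ez : 0 < cabs (cexp z) by rewrite cabs_gt0 cexp_neq0.
have [r r0 H] := cderiv_cexp0 (divr_gt0 e0 ez); exists r => // h /H.
rewrite add0r cexp0 mul1r cexpD => B.
have -> : cexp z * cexp h - cexp z - cexp z * h = cexp z * (cexp h - 1 - h) by ring.
by rewrite cabsM -ler_pdivlMl// mulrA (mulrC _ e).
Qed.

(** The argument is an arc tangent, so that this is the principal logarithm on the
    right half plane only. *)
Definition clog z : R[i] := ln (cabs z) +i* atan (Im z / Re z).

Lemma cexp_clog z : 0 < Re z -> cexp (clog z) = z.
Proof.
case: z => x y /= x0; rewrite /cexp /clog/=.
have n0 : 0 < cabs (x +i* y) by apply: lt_le_trans (cabs_Re _); rewrite /= gtr0_norm.
rewrite lnK//; set t := atan (y / x).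
have ct : cos t = x / cabs (x +i* y).
  rewrite /t cos_atan cabsE/= expr_div_n.
  have -> : 1 + y ^+ 2 / x ^+ 2 = (x ^+ 2 + y ^+ 2) / x ^+ 2.
    by field; rewrite gt_eqF.
  rewrite sqrtrM ?addr_ge0 ?sqr_ge0// sqrtrV ?sqr_ge0// sqrtr_sqr gtr0_norm//.
  by rewrite invfM invrK mulrC.
have st : sin t = y / cabs (x +i* y).
  have := atanK (y / x); rewrite -/t /tan => E.
  have ct0 : cos t != 0 by rewrite ct mulf_neq0 ?invr_neq0 ?gt_eqF.
  rewrite -[LHS](divfK ct0) E ct; field.
  by rewrite !gt_eqF.
rewrite ct st; simpc; apply/eqP; rewrite eq_complex/=.
by apply/andP; split; apply/eqP; field; rewrite gt_eqF.
Qed.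

Lemma continuous_eps (f : R -> R) x : {for x, continuous f} ->
  forall e, 0 < e -> exists2 r : R, 0 < r & forall y, `|y - x| < r -> `|f y - f x| < e.
Proof.
move=> /cvgrPdist_lt cf e /cf; rewrite -nbhs_nearE => /nbhs_ballP[r /= r0 H].
by exists r => // y yr; rewrite distrC; apply: H; rewrite /ball/= distrC.
Qed.

(** Continuity is what [cderiv_inverse] asks for in order to differentiate the
    logarithm. *)
Lemma clog_continuous z : 0 < Re z -> forall e, 0 < e ->
  exists2 r : R, 0 < r & forall h, cabs h < r -> cabs (clog (z + h) - clog z) < e.
Proof.
move=> x0 e e0; have n0 : 0 < cabs z.
  by apply: lt_le_trans (cabs_Re _); rewrite gtr0_norm.
have e2 : 0 < e / 2 by rewrite divr_gt0.
have [r1 r10 H1] := continuous_eps (continuous_ln n0) e2.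
have [r2 r20 H2] := continuous_eps (@continuous_atan _ (Im z / Re z)) e2.
set x := Re z in x0 H2 *; set y := Im z in H2 *.
set A := (`|y| + x) / (x ^+ 2 / 2).
have x2 : 0 < x ^+ 2 / 2 by rewrite divr_gt0// exprn_gt0.
have A0 : 0 < A by rewrite divr_gt0// ltr_wpDl.
have AE : A * (x ^+ 2 / 2) = `|y| + x by rewrite /A divfK ?gt_eqF.
clearbody A.
exists (Num.min r1 (Num.min (x / 2) (r2 / A))); first by rewrite !lt_min r10 (divr_gt0 r20 A0) divr_gt0.
move=> h; rewrite !lt_min => /andP[h1 /andP[hx]]; rewrite ltr_pdivlMr// => h2.
have Rh := cabs_Re h; have Ih := cabs_Im h.
apply: le_lt_trans (cabs_le_ReIm _) _.
rewrite ReD ImD ReN ImN/= !ReD !ImD -/x -/y.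
have E1 : `|cabs (z + h) - cabs z| < r1.
  apply: le_lt_trans h1; rewrite ler_norml lerBlDr (addrC (cabs h)) cabsD andbT.
  by have := lerB_cabsD z h; lra.
have B1 := H1 _ E1.
have xh : x / 2 <= x + Re h.
  by have := ler_norm (- Re h); rewrite normrN; lra.
have xh0 : 0 < x + Re h by apply: lt_le_trans xh; rewrite divr_gt0.
have E2 : `|(y + Im h) / (x + Re h) - y / x| < r2.
  apply: le_lt_trans h2.
  have -> : (y + Im h) / (x + Re h) - y / x = (x * Im h - y * Re h) / (x * (x + Re h)).
    by field; rewrite !gt_eqF.
  rewrite normrM normfV [X in _ / X]gtr0_norm; last exact: mulr_gt0.
  rewrite ler_pdivrMr ?mulr_gt0//.
  apply: (@le_trans _ _ (cabs h * A * (x ^+ 2 / 2))); last first.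
    rewrite ler_wpM2l ?mulr_ge0 ?cabs_ge0 ?(ltW A0)//.
    by rewrite expr2 -mulrA ler_wpM2l// ltW.
  rewrite -mulrA AE.
  apply: le_trans (ler_normB _ _) _; rewrite !normrM (gtr0_norm x0).
  have : x * `|Im h| <= x * cabs h by rewrite ler_wpM2l// ltW.
  have : `|y| * `|Re h| <= `|y| * cabs h by rewrite ler_wpM2l.
  lra.
have B2 := H2 _ E2.
lra.
Qed.

Lemma cdiff_clog z : 0 < Re z -> cdiff clog z.
Proof.
move=> x0; exists (cexp (clog z))^-1; apply: (@cderiv_inverse _ cexp).
- exact: cexp_neq0.
- exact: cderiv_cexp.
- exists (Re z) => // h hz; apply: cexp_clog; rewrite ReD.
  by have := cabs_Re h; have := ler_norm (- Re h); rewrite normrN; lra.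
- exact: clog_continuous.
Qed.

End complex_exponential.

Arguments cexp {R} z : simpl never.
Arguments clog {R} z : simpl never.

(** * Neighbourhoods and compact sets in C and C^n *)

Lemma continuous_at_dist {R : realType} (T : topologicalType) (f : T -> R) (x : T) :
  (forall e, 0 < e -> nbhs x [set y | `|f y - f x| < e]) -> {for x, continuous f}.
Proof.
move=> H; apply/cvgrPdist_lt => e /H; apply: filterS => y /=.
by rewrite distrC.
Qed.

Section topology.
Context {R : realType}.
Implicit Types (z w : R[i]) (r e : R).

Lemma normr_cabs z : `|z| = (cabs z)%:C.
Proof. by case: z. Qed.

Lemma nbhs_complexP z (A : set R[i]) :
  nbhs z A <-> exists2 r : R, 0 < r & forall w, cabs (w - z) < r -> A w.
Proof.
split.
  move=> /nbhs_ballP[[e1 e2] /=]; rewrite ltcE/= => /andP[/eqP -> e0] H.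
  exists e1 => // w wr; apply: H; rewrite -ball_normE /= normr_cabs ltcR.
  by rewrite cabsB.
move=> [r r0 H]; apply/nbhs_ballP; exists r%:C; first by rewrite /= ltcR.
move=> w; rewrite -ball_normE /= normr_cabs ltcR => wr; apply: H.
by rewrite cabsB.
Qed.

Lemma compact_disc a r : compact [set z : R[i] | cabs (z - a) <= r].
Proof.
pose q (p : R * R) : R[i] := a + (p.1 +i* p.2).
have cq : continuous q.
  move=> p A /nbhs_complexP[s s0 H].
  exists (ball p.1 (s / 2), ball p.2 (s / 2)).
    by split; apply: nbhsx_ballx; rewrite divr_gt0.
  move=> [x y] /= [px py]; apply: H; rewrite /q opprD addrACA subrr add0r; simpc.
  apply: le_lt_trans (cabs_le_ReIm _) _; rewrite /=.
  by move: px py; rewrite -!ball_normE/= distrC (distrC p.2); lra.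
have cb : compact (q @` (`[- `|r|, `|r|] `*` `[- `|r|, `|r|])).
  apply: continuous_compact; first exact: continuous_subspaceT.
  by apply: compact_setX; exact: segment_compact.
apply: (subclosed_compact _ cb).
  move=> z zc /=; apply/ler_addgt0Pr => e e0.
  have /(zc _)[w [/= wr wz]] : nbhs z [set w | cabs (w - z) < e].
    by apply/nbhs_complexP; exists e.
  have -> : z - a = (w - a) - (w - z) by ring.
  by apply: le_trans (cabsD _ _) _; rewrite cabsN lerD// ltW.
move=> z /= zr; exists (Re (z - a), Im (z - a)); last first.
  by rewrite /q/=; case: (z) => z1 z2; case: (a) => a1 a2; simpc; rewrite !subrKC.
split; rewrite /= in_itv/= -ler_norml.
  by apply: le_trans (cabs_Re _) _; apply: le_trans zr _; rewrite ler_norm.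
by apply: le_trans (cabs_Im _) _; apply: le_trans zr _; rewrite ler_norm.
Qed.

End topology.

Section euclidean.
Context {R : realType} {n : nat}.
Implicit Types (x y z : 'rV[R[i]]_n) (r e : R).

Lemma sum_cabs_ge0 x : 0 <= \sum_(j < n) cabs (x 0 j) ^+ 2.
Proof. by apply: sumr_ge0 => j _; exact: sqr_ge0. Qed.

Lemma enorm_ge0 x : 0 <= enorm x. Proof. exact: sqrtr_ge0. Qed.

Lemma sqr_enorm x : enorm x ^+ 2 = \sum_(j < n) cabs (x 0 j) ^+ 2.
Proof. by rewrite sqr_sqrtr// sum_cabs_ge0. Qed.

Lemma sum_le_enorm (f : 'I_n -> R) x y :
  (forall j, f j <= cabs (x 0 j) * cabs (y 0 j)) -> \sum_j f j <= enorm x * enorm y.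
Proof.
move=> fxy; apply: (@le_trans _ _ (\sum_j cabs (x 0 j) * cabs (y 0 j))).
  exact: ler_sum.
have z0 (u : 'rV[R[i]]_n) : enorm u = 0 -> forall j, cabs (u 0 j) = 0.
  move=> /eqP; rewrite /enorm sqrtr_eq0 => u0 j; apply/eqP.
  rewrite -sqrf_eq0 eq_le sqr_ge0 andbT; apply: le_trans u0.
  by rewrite (bigD1 j)//= lerDl sumr_ge0// => i _; exact: sqr_ge0.
have [x0|xn0] := eqVneq (enorm x) 0.
  by rewrite x0 mul0r big1// => j _; rewrite z0// mul0r.
have [y0|yn0] := eqVneq (enorm y) 0.
  by rewrite y0 mulr0 big1// => j _; rewrite (z0 y)// mulr0.
have x0 : 0 < enorm x by rewrite lt0r xn0 enorm_ge0.
have y0 : 0 < enorm y by rewrite lt0r yn0 enorm_ge0.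
have : 0 <= \sum_j (enorm y * cabs (x 0 j) - enorm x * cabs (y 0 j)) ^+ 2.
  by apply: sumr_ge0 => j _; exact: sqr_ge0.
under eq_bigr do rewrite sqrrB !exprMn.
rewrite big_split/= sumrB -!mulr_sumr -!sqr_enorm.
rewrite (eq_bigr (fun j => (enorm x * enorm y *+ 2) * (cabs (x 0 j) * cabs (y 0 j)))); last first.
  by move=> j _; rewrite -mulr_natr -[in RHS]mulr_natr; ring.
rewrite -mulr_sumr; set S := \sum_j _ => H.
have xy : 0 < enorm x * enorm y by exact: mulr_gt0.
rewrite -(ler_pM2l xy); move: H; rewrite -mulr_natr; nra.
Qed.

Lemma enormD x y : enorm (x + y) <= enorm x + enorm y.
Proof.
rewrite -ler_sqr ?nnegrE ?addr_ge0 ?enorm_ge0// sqrrD !sqr_enorm.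
apply: (@le_trans _ _ (\sum_j (cabs (x 0 j) ^+ 2 + cabs (x 0 j) * cabs (y 0 j) *+ 2 + cabs (y 0 j) ^+ 2))).
  apply: ler_sum => j _; rewrite -sqrrD mxE ler_sqr ?nnegrE ?addr_ge0 ?cabs_ge0//.
  exact: cabsD.
rewrite big_split big_split/= lerD2r lerD2l sumrMnl lerMn2r/=.
by apply: sum_le_enorm.
Qed.

Lemma enorm0 : enorm (0 : 'rV[R[i]]_n) = 0.
Proof.
rewrite /enorm big1 ?sqrtr0// => j _.
by rewrite mxE -/(cabs _) cabs0 expr0n.
Qed.

Lemma enormZ (c : R[i]) x : enorm (c *: x) = cabs c * enorm x.
Proof.
rewrite /enorm (eq_bigr (fun j => cabs c ^+ 2 * cabs (x 0 j) ^+ 2)); last first.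
  by move=> j _; rewrite mxE -/(cabs _) cabsM exprMn.
by rewrite -mulr_sumr sqrtrM ?sqr_ge0// sqrtr_sqr ger0_norm ?cabs_ge0.
Qed.

Lemma enormN x : enorm (- x) = enorm x.
Proof. by rewrite -scaleN1r enormZ cabsN cabs1 mul1r. Qed.

Lemma enormB x y : enorm (x - y) = enorm (y - x).
Proof. by rewrite -enormN opprB. Qed.

Lemma lerB_enorm x y : enorm x - enorm y <= enorm (x - y).
Proof. by rewrite lerBlDr (le_trans _ (enormD _ _))// subrK. Qed.

Lemma cabs_le_enorm x j : cabs (x 0 j) <= enorm x.
Proof.
rewrite -[leLHS]ger0_norm ?cabs_ge0// -sqrtr_sqr /enorm ler_sqrt ?sum_cabs_ge0//.
by rewrite (bigD1 j)//= lerDl sumr_ge0// => i _; exact: sqr_ge0.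
Qed.

(** The topology of ['rV[R[i]]_n] is that of the maximum norm; the cheap factor [n]
    suffices to compare it with the Euclidean norm. *)
Lemma enorm_le x e : (forall j, cabs (x 0 j) <= e) -> enorm x <= n%:R * e.
Proof.
move=> H; have [n0|n0] := posnP n.
  rewrite /enorm big1 ?sqrtr0 ?n0 ?mul0r// => j.
  by exfalso; move: j; rewrite n0 => -[].
have e0 : 0 <= e := le_trans (cabs_ge0 _) (H (Ordinal n0)).
rewrite -ler_sqr ?nnegrE ?mulr_ge0 ?enorm_ge0// sqr_enorm.
apply: (@le_trans _ _ (\sum_(j < n) e ^+ 2)).
  by apply: ler_sum => j _; rewrite ler_sqr ?nnegrE ?cabs_ge0.
rewrite sumr_const card_ord -(mulr_natl (e ^+ 2)) exprMn.
apply: ler_wpM2r; first exact: sqr_ge0.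
by rewrite expr2 ler_peMr ?ler1n.
Qed.

Lemma nbhs_enormP x (A : set 'rV[R[i]]_n) :
  nbhs x A <-> exists2 r : R, 0 < r & forall y, enorm (y - x) < r -> A y.
Proof.
split.
  move=> /nbhs_ballP[[e1 e2] /=]; rewrite ltcE/= => /andP[/eqP -> e0] H.
  exists e1 => // y yr; apply: H; split=> [|i j]; first by rewrite ltcE/= eqxx.
  rewrite -ball_normE /= normr_cabs ltcR ord1 cabsB; apply: le_lt_trans yr.
  by have := cabs_le_enorm (y - x) j; rewrite !mxE.
move=> [r r0 H]; apply/nbhs_ballP.
have rn : 0 < r / n.+1%:R by rewrite divr_gt0.
exists (r / n.+1%:R)%:C; first by rewrite /= ltcR.
move=> y [_ yr]; apply: H.
apply: (@le_lt_trans _ _ (n%:R * (r / n.+1%:R))).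
  apply: enorm_le => j; rewrite !mxE; have := yr 0 j.
  by rewrite -ball_normE /= normr_cabs ltcR cabsB => /ltW.
by rewrite mulrCA gtr_pMr// ltr_pdivrMr// mul1r ltr_nat.
Qed.

Lemma compact_enorm_ball r : compact [set x : 'rV[R[i]]_n | enorm x <= r].
Proof.
have cb : compact [set v : 'rV[R[i]]_n | forall i, [set z : R[i] | cabs (z - 0) <= r] (v ord0 i)].
  by apply: (@rV_compact _ _ (fun=> [set z : R[i] | cabs (z - 0) <= r])) => _; exact: compact_disc.
apply: (subclosed_compact _ cb).
  move=> z zc /=; apply/ler_addgt0Pr => e e0.
  have /(zc _)[w [/= wr wz]] : nbhs z [set w | enorm (w - z) < e].
    by apply/nbhs_enormP; exists e.
  have -> : z = w - (w - z) by rewrite subKr.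
  by apply: le_trans (enormD _ _) _; rewrite enormN lerD// ltW.
by move=> z /= zr j; rewrite /= subr0 (le_trans (cabs_le_enorm _ _)).
Qed.

End euclidean.

(** * The maximum principle and its consequences *)

Section maximum_principle.
Context {R : realType}.
Implicit Types (g : R[i] -> R[i]) (z w h a : R[i]) (e r x y M : R).

Lemma cr_of_cdiff g x y : cdiff g (x +i* y) ->
  cr_differentiable (fun s t => Re (g (s +i* t))) (fun s t => Im (g (s +i* t))) x y.
Proof.
move=> [[al be] D]; exists al, be => e e0; have [r r0 {}D] := D e e0.
exists (r / 2); first by rewrite divr_gt0.
move=> h k hr kr; have hk := cabs_le_ReIm (h +i* k).
have [] : cabs (h +i* k) < r /\ cabs (h +i* k) <= `|h| + `|k|.
  by rewrite /= in hk; split=> //; apply: le_lt_trans hk _; lra.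
move=> /D{}D {}hk.
have E : (x + h) +i* (y + k) = (x +i* y) + (h +i* k) by simpc.
have er : e * cabs (h +i* k) <= e * (`|h| + `|k|).
  by rewrite ler_wpM2l// ltW.
have {D} := le_trans D er.
set w := g _ - g _ - _ => D.
rewrite E; split.
  have -> : Re (g (x +i* y + h +i* k)) - Re (g (x +i* y)) - (al * h - be * k) = Re w.
    by rewrite /w !ReD !ReN ReM.
  exact: le_trans (cabs_Re _) D.
have -> : Im (g (x +i* y + h +i* k)) - Im (g (x +i* y)) - (be * h + al * k) = Im w.
  by rewrite /w !ImD !ImN ImM/=; ring.
exact: le_trans (cabs_Im _) D.
Qed.

Lemma cdiff_continuous g z : cdiff g z -> forall e, 0 < e ->
  exists2 r : R, 0 < r & forall h, cabs h < r -> cabs (g (z + h) - g z) < e.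
Proof.
move=> [d /cderiv_lip[r r0 H]] e e0.
have d0 : 0 < cabs d + 1 by rewrite ltr_wpDl// cabs_ge0.
exists (Num.min r (e / (cabs d + 1))); first by rewrite lt_min r0 divr_gt0.
move=> h; rewrite lt_min => /andP[/H B]; rewrite ltr_pdivlMr// => he.
by apply: le_lt_trans B _; rewrite mulrC.
Qed.

(** The mean of [Re g] over the circle is its value at the center: seen in the
    coordinate [x +i* y] with [z = r * cexp (x +i* y)], circles become vertical
    segments of length one period, and the center is the limit [x -> -oo]. *)
Lemma Re_max_center g r M : 0 < r -> (forall z, cabs z <= r -> cdiff g z) ->
  (forall z, cabs z = r -> Re (g z) <= M) -> Re (g 0) <= M.
Proof.
move=> r0 dg gM; apply/ler_addgt0Pr => e e0.
pose G w := g (r%:C * cexp w).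
have absr x y : cabs (r%:C * cexp (x +i* y)) = r * expR x.
  by rewrite cabsM cabs_real gtr0_norm// cabs_cexp.
have dG x y : x <= 0 -> cdiff G (x +i* y).
  move=> x0; apply: (@cdiff_comp _ g (fun w => r%:C * cexp w)).
    by apply: cdiffM; [exact: cdiff_cst|eexists; exact: cderiv_cexp].
  by apply: dg; rewrite absr ler_piMr ?(ltW r0)// -expR0 ler_expR.
have g0 : cdiff g 0 by apply: dg; rewrite cabs0 ltW.
have [s s0 Hs] := cdiff_continuous g0 e0.
pose L : R := Num.min 0 (ln (s / r / 2)).
have L0 : L <= 0 by rewrite ge_min lexx.
have Ls : r * expR L < s.
  have : expR L <= s / r / 2.
    rewrite -[leRHS]lnK ?ler_expR ?ge_min ?lexx ?orbT//.
    by rewrite posrE !divr_gt0.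
  rewrite -(ler_pM2l r0) => /le_lt_trans; apply.
  have -> : r * (s / r / 2) = s / 2 by field; rewrite gt_eqF.
  by clear -s0; lra.
pose U x y := Re (G (x +i* y)); pose V x y := Im (G (x +i* y)).
have pi2 : 0 < 2 * pi :> R by rewrite mulr_gt0// pi_gt0.
have crUV : cr_on U V L 0 0 (2 * pi).
  by move=> x y /andP[_ x0] _; apply: cr_of_cdiff; exact: dG.
have per x : V x 0 = V x (2 * pi) by rewrite /V /G cexp_2pi_periodic.
have E := periodic_seg_mean L0 (ltW pi2) crUV per.
have [_ Hx] := cr_on_seg crUV.
have LL : L <= L <= 0 by rewrite lexx.
have OO : L <= (0 : R) <= 0 by rewrite L0 lexx.
have [cL _] := Hx _ LL; have [c0 _] := Hx _ OO.
have up : segI (U 0) 0 (2 * pi) <= M * (2 * pi).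
  rewrite -[X in _ <= _ * X]subr0; apply: segI_le (ltW pi2) c0 _ => y _.
  by apply: gM; rewrite absr expR0 mulr1.
have low : (Re (g 0) - e) * (2 * pi - 0) <= segI (U L) 0 (2 * pi).
  apply: segI_ge (ltW pi2) cL _ => y _.
  have := Hs (r%:C * cexp (L +i* y)); rewrite absr => /(_ Ls).
  rewrite add0r => /ltW B.
  have := le_trans (cabs_Re _) B; rewrite ReD ReN ler_norml => /andP[+ _].
  by rewrite lerBrDl.
have LU := le_trans low (eq_ind_r (fun t => t <= M * (2 * pi)) up E).
by rewrite subr0 (ler_pM2r pi2) lerBlDr in LU.
Qed.

(** Multiplying [g] by a constant of modulus one turns [g 0] into its modulus. *)
Lemma cabs_max_center g r M : 0 < r -> (forall z, cabs z <= r -> cdiff g z) ->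
  (forall z, cabs z = r -> cabs (g z) <= M) -> cabs (g 0) <= M.
Proof.
move=> r0 dg gM.
have [->|g0] := eqVneq (g 0) 0.
  by rewrite cabs0 (le_trans (cabs_ge0 (g r%:C)))// gM// cabs_real gtr0_norm.
have G0 : 0 < cabs (g 0) by rewrite cabs_gt0.
pose u := (g 0)^* / (cabs (g 0))%:C.
have au : cabs u = 1.
  by rewrite /u cabsM cabs_conj cabsV cabs_real ger0_norm ?cabs_ge0// divff// gt_eqF.
have := @Re_max_center (fun z => u * g z) r M r0.
have -> : u * g 0 = (cabs (g 0))%:C.
  rewrite /u mulrAC (mulrC _ (g 0)) mul_conj expr2 rmorphM/= mulfK//.
  by apply/eqP => -[/eqP]; rewrite gt_eqF.
apply.
  by move=> z /dg dz; apply: cdiffM => //; exact: cdiff_cst.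
by move=> z /gM; apply: le_trans; apply: le_trans (ler_norm _) _;
   rewrite -[leRHS]mul1r -au -cabsM cabs_Re.
Qed.

(** Points other than the center are reached by a Moebius automorphism of the
    disc. *)
Lemma cabs_max_principle g r M : 0 < r -> (forall z, cabs z <= r -> cdiff g z) ->
  (forall z, cabs z = r -> cabs (g z) <= M) ->
  forall a, cabs a <= r -> cabs (g a) <= M.
Proof.
move=> r0 dg gM a; rewrite le_eqVlt => /predU1P[/gM//|ar].
have den z : cabs z <= r -> (r ^+ 2)%:C + a^* * z != 0.
  move=> zr; rewrite -cabs_gt0; apply: lt_le_trans (lerB_cabsD _ _).
  rewrite cabsM cabs_conj cabs_real ger0_norm ?sqr_ge0// subr_gt0.
  apply: (@le_lt_trans _ _ (cabs a * r)); first by rewrite ler_wpM2l ?cabs_ge0.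
  by rewrite expr2 ltr_pM2r.
pose phi z := (r ^+ 2)%:C * (z + a) / ((r ^+ 2)%:C + a^* * z).
have idn z : cabs ((r ^+ 2)%:C + a^* * z) ^+ 2 - r ^+ 2 * cabs (z + a) ^+ 2 =
    (r ^+ 2 - cabs z ^+ 2) * (r ^+ 2 - cabs a ^+ 2).
  case: z => z1 z2; case: a {ar den phi} => a1 a2; rewrite !sqr_cabs/=; simpc => /=.
  by ring.
have phir z : cabs z = r -> cabs (phi z) = r.
  move=> zr; have D0 : 0 < cabs ((r ^+ 2)%:C + a^* * z).
    by rewrite cabs_gt0 den// zr.
  rewrite /phi !cabsM cabsV cabs_real ger0_norm ?sqr_ge0//.
  have := idn z; rewrite zr subrr mul0r => /eqP; rewrite subr_eq0.
  rewrite -exprMn => /eqP/pexpIrn EQ.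
  have {}EQ : cabs ((r ^+ 2)%:C + a^* * z) = r * cabs (z + a).
    by apply: EQ => //; rewrite ?nnegrE ?cabs_ge0// mulr_ge0 ?cabs_ge0 ?(ltW r0).
  rewrite EQ in D0 *; rewrite pmulr_rgt0// in D0.
  by field; rewrite !gt_eqF.
have phile z : cabs z <= r -> cabs (phi z) <= r.
  move=> zr; have D0 : 0 < cabs ((r ^+ 2)%:C + a^* * z) by rewrite cabs_gt0 den.
  rewrite /phi !cabsM cabsV cabs_real ger0_norm ?sqr_ge0//.
  rewrite ler_pdivrMr// expr2 -mulrA ler_pM2l//.
  rewrite -ler_sqr ?nnegrE ?cabs_ge0 ?mulr_ge0 ?cabs_ge0 ?(ltW r0)// exprMn.
  rewrite -subr_ge0 idn mulr_ge0// subr_ge0 ler_sqr ?nnegrE ?cabs_ge0 ?(ltW r0)//.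
  exact: ltW.
have phi0 : phi 0 = a.
  rewrite /phi mulr0 addr0 add0r mulrC mulKf//.
  by apply/eqP => -[/eqP]; rewrite sqrf_eq0 gt_eqF.
rewrite -phi0; apply: (@cabs_max_center (fun z => g (phi z)) r) => // z zr.
  apply: (@cdiff_comp _ g phi); last by apply: dg; exact: phile.
  apply: cdiffM; last apply: cdiffV => //; last exact: den.
    apply: cdiffM; first exact: cdiff_cst.
    by apply: cdiffD; [exact: cdiff_id|exact: cdiff_cst].
  apply: cdiffD; first exact: cdiff_cst.
  by apply: cdiffM; [exact: cdiff_cst|exact: cdiff_id].
by apply: gM; exact: phir.
Qed.

Lemma cabs_min_principle g r m : 0 < r -> 0 < m ->
  (forall z, cabs z <= r -> cdiff g z) -> (forall z, cabs z <= r -> g z != 0) ->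
  (forall z, cabs z = r -> m <= cabs (g z)) ->
  forall a, cabs a <= r -> m <= cabs (g a).
Proof.
move=> r0 m0 dg g0 gm a ar.
have := @cabs_max_principle (fun z => (g z)^-1) r m^-1 r0.
move=> /(_ _ _ a ar); rewrite cabsV lef_pV2 ?posrE ?cabs_gt0 ?g0//; apply.
  by move=> z zr; apply: cdiffV; [exact: dg|exact: g0].
by move=> z zr; rewrite cabsV lef_pV2 ?posrE ?cabs_gt0 ?g0 ?zr//; exact: gm.
Qed.

Lemma cdiff_bounded_disc g r : (forall z, cdiff g z) ->
  exists M, forall z, cabs z <= r -> cabs (g z) <= M.
Proof.
move=> dg; have [r0|r0] := ltP r 0.
  by exists 0 => z zr; have := le_lt_trans zr r0; rewrite ltNge cabs_ge0.
have cg : {within [set z | cabs (z - 0) <= r], continuous (fun z => cabs (g z))}.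
  apply: continuous_in_subspaceT => z _; apply: continuous_at_dist => e e0.
  have [s s0 H] := cdiff_continuous (dg z) e0.
  apply/nbhs_complexP; exists s => // w /H; rewrite subrKC; apply: le_lt_trans.
  exact: ler_dist_cabs.
have [|c _ cmax] := compact_EVT_max _ (@compact_disc R 0 r) cg.
  by exists (0 : R[i]) => /=; rewrite subr0 cabs0.
by exists (cabs (g c)) => z zr; apply: cmax; rewrite inE/= subr0.
Qed.

(** A function that vanishes near [0] equals [z ^+ k * g_k z] with [g_k]
    differentiable, for every [k]; the maximum principle for [g_k] gives
    [cabs (g z) <= M * (cabs z / r) ^+ k], which tends to [0] for [cabs z < r]. *)
Lemma identity_principle g s : 0 < s -> (forall z, cdiff g z) ->
  (forall z, cabs z < s -> g z = 0) -> forall z, g z = 0.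
Proof.
move=> s0 dg gs a.
have [as_|sa] := ltP (cabs a) s; first exact: gs.
have a0 : 0 < cabs a := lt_le_trans s0 sa.
(* with this radius the bounds at [a] decay like [2 ^- k] *)
set r := 2 * cabs a; have r0 : 0 < r by rewrite mulr_gt0.
have [M gM] := cdiff_bounded_disc r dg.
have ng k z : cdiff (fun z => g z * z^-1 ^+ k) z.
  have [zs|sz] := ltP (cabs z) s.
    exists 0 => e e0; exists (s - cabs z); first by rewrite subr_gt0.
    move=> h hs; rewrite gs//; last by rewrite (le_lt_trans (cabsD _ _))// addrC -ltrBrDr.
    by rewrite gs// !mul0r subrr subr0 cabs0 mulr_ge0 ?cabs_ge0// ltW.
  apply: cdiffM => //.
  have z0 : z != 0 by rewrite -cabs_gt0 (lt_le_trans s0).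
  elim: k => [|k IH]; first by rewrite (_ : (fun _ => _) = fun=> 1) //; exact: cdiff_cst.
  rewrite (_ : (fun _ => _) = fun w => w^-1 * w^-1 ^+ k); last first.
    by apply/funext => w; rewrite exprS.
  by apply: cdiffM => //; apply: cdiffV => //; exact: cdiff_id.
have bd k : cabs (g a) <= M / 2 ^+ k.
  have /= := @cabs_max_principle (fun z => g z * z^-1 ^+ k) r (M / r ^+ k) r0.
  move=> /(_ (fun z _ => ng k z) _ a); rewrite cabsM cabsX cabsV.
  have -> : M / r ^+ k = M / 2 ^+ k * (cabs a)^-1 ^+ k.
    by rewrite /r exprMn exprVn invfM mulrA.
  rewrite ler_pM2r ?exprn_gt0 ?invr_gt0//; apply.
    move=> z zr; rewrite cabsM cabsX cabsV zr.
    have -> : M / 2 ^+ k * (cabs a)^-1 ^+ k = M * r^-1 ^+ k.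
      by rewrite /r -mulrA !exprVn exprMn invfM.
    by rewrite ler_pM2r ?exprn_gt0 ?invr_gt0// gM// zr.
  by rewrite /r; clear -a0; lra.
have M0 : 0 <= M by rewrite (le_trans (cabs_ge0 (g r%:C)))// gM// cabs_real gtr0_norm.
apply/eqP; rewrite -cabs_eq0 eq_le cabs_ge0 andbT leNgt; apply/negP => ga.
have [k kM] : exists k : nat, M / cabs (g a) < k%:R.
  by exists (Num.truncn (M / cabs (g a))).+1; exact: truncnS_gt.
have := bd k; rewrite ler_pdivlMr ?exprn_gt0// leNgt => /negP; apply.
move: kM; rewrite ltr_pdivrMr// => /lt_le_trans; apply.
by rewrite mulrC ler_wpM2l ?(ltW ga)// -natrX ler_nat ltnW// ltn_expl.
Qed.

(** Zeros of a continuous family of holomorphic functions on a disc cannot appear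
    without crossing the boundary circle.  As long as [Psi s] has no zero, its
    modulus is at least the minimum [c] of the moduli on the boundary circles,
    and a small change of [s] does not destroy this. *)
Lemma continuity_principle (Psi : R -> R[i] -> R[i]) r : 0 < r ->
  (forall s z, 0 <= s <= 1 -> cabs z <= r -> cdiff (Psi s) z) ->
  (forall s z, 0 <= s <= 1 -> cabs z <= r -> forall e, 0 < e ->
    exists2 d : R, 0 < d & forall s' z', `|s' - s| < d -> cabs (z' - z) < d ->
      cabs (Psi s' z' - Psi s z) < e) ->
  (forall z, cabs z <= r -> Psi 0 z != 0) ->
  (forall s z, 0 <= s <= 1 -> cabs z = r -> Psi s z != 0) ->
  forall z, cabs z <= r -> Psi 1 z != 0.
Proof.
move=> r0 dPsi cPsi Psi0 Psir.
pose D := [set z : R[i] | cabs (z - 0) <= r].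
pose C := [set z : R[i] | cabs (z - 0) = r].
have DE z : D z = (cabs z <= r) by rewrite /D/= subr0.
have CE z : C z = (cabs z = r) by rewrite /C/= subr0.
have cI : compact (`[0, 1] : set R) by exact: segment_compact.
have cD : compact (`[(0 : R), 1] `*` D) by apply: compact_setX => //; exact: compact_disc.
have cC : compact (`[(0 : R), 1] `*` C).
  apply: compact_setX => //; apply: (subclosed_compact _ (@compact_disc R 0 r)).
    rewrite (_ : C = (fun z => cabs (z - 0)) @^-1` [set r])//.
    apply: preimage_closed; last exact: closed_eq.
    move=> z _; apply: continuous_at_dist => e e0; apply/nbhs_complexP; exists e => // w.
    by apply: le_lt_trans; rewrite !subr0 ler_dist_cabs.
  by move=> z; rewrite /C /= => ->.
have [c c0 cP] : exists2 c, 0 < c & forall s z, 0 <= s <= 1 -> cabs z = r -> c <= cabs (Psi s z).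
  have cont : {within `[(0 : R), 1] `*` C, continuous (fun p => cabs (Psi p.1 p.2))}.
    apply: continuous_in_subspaceT => -[s z]; rewrite inE => -[/=]; rewrite in_itv/= => s01.
    rewrite CE => zr; apply: continuous_at_dist => e e0.
    have [d d0 H] := cPsi s z s01 ltac:(by rewrite zr) e e0.
    exists (ball s d, [set w | cabs (w - z) < d]) => /=.
      by split; [exact: nbhsx_ballx|apply/nbhs_complexP; exists d].
    move=> [s' z'] /= [ss zz]; rewrite /ball/= distrC in ss.
    by apply: le_lt_trans (H _ _ ss zz); exact: ler_dist_cabs.
  have [|[s z]] := compact_EVT_min _ cC cont.
    by exists (0, r%:C); split; rewrite /= ?in_itv/= ?lexx ?ler01// CE cabs_real gtr0_norm.
  rewrite inE => -[/=]; rewrite in_itv/= CE => s01 zr H.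
  exists (cabs (Psi s z)); first by rewrite cabs_gt0 Psir.
  move=> s' z' s'01 z'r; apply: (H (s', z')); rewrite inE; split; rewrite /= ?in_itv//.
  by rewrite CE.
have [d d0 dP] : exists2 d : R, 0 < d & forall s s' z, 0 <= s <= 1 -> cabs z <= r ->
    `|s' - s| < d -> cabs (Psi s' z - Psi s z) < c.
  pose P (d : R) (p : R * R[i]) := forall s', `|s' - p.1| < d ->
    cabs (Psi s' p.2 - Psi p.1 p.2) < c.
  have /compact_near_coveringP := cD => /(_ R (0^'+) P _)[].
    move=> [s z] [/=]; rewrite in_itv/= DE => s01 zr.
    have c2 : 0 < c / 2 by rewrite divr_gt0.
    have [d d0 H] := cPsi s z s01 zr _ c2.
    have d2 : 0 < d / 2 by rewrite divr_gt0.
    exists ((ball s (d / 2) `*` [set w | cabs (w - z) < d]), [set t | t < d / 2]) => /=.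
      split; last exact: nbhs_right_lt.
      exists (ball s (d / 2), [set w | cabs (w - z) < d]) => //=.
      by split; [exact: nbhsx_ballx|apply/nbhs_complexP; exists d].
    move=> [[s1 z1] t] /= [[s1s z1z] td] s' s's1; rewrite /ball/= distrC in s1s.
    have dd : d = d / 2 + d / 2 by rewrite -splitr.
    have s1d : `|s1 - s| < d by rewrite dd (lt_trans s1s)// ltrDl.
    have A1 := H s1 z1 s1d z1z.
    have s's : `|s' - s| < d.
      have -> : s' - s = (s' - s1) + (s1 - s) by ring.
      by apply: le_lt_trans (ler_normD _ _) _; rewrite dd ltrD// (lt_trans s's1).
    have A2 := H s' z1 s's z1z.
    have -> : Psi s' z1 - Psi s1 z1 = (Psi s' z1 - Psi s z) - (Psi s1 z1 - Psi s z) by ring.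
    by apply: le_lt_trans (cabsD _ _) _; rewrite cabsN [ltRHS]splitr ltrD.
  move=> e /= e0 He; exists (e / 2); first by rewrite divr_gt0.
  move=> s s' z s01 zr ss.
  apply: (He (e / 2) _ _ (s, z)) => //=; rewrite ?sub0r ?normrN ?divr_gt0//.
    by rewrite gtr0_norm ?divr_gt0// ltr_pdivrMr// ltr_pMr// ltr1n.
  by split; rewrite /= ?in_itv// DE.
have step s s' : 0 <= s <= 1 -> 0 <= s' <= 1 -> `|s' - s| < d ->
    (forall z, cabs z <= r -> c <= cabs (Psi s z)) ->
    (forall z, cabs z <= r -> c <= cabs (Psi s' z)).
  move=> s01 s'01 ss H z zr; apply: (@cabs_min_principle (Psi s') r c) => //.
  - by move=> w wr; exact: dPsi.
  - move=> w wr; rewrite -cabs_gt0.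
    have := dP s s' w s01 wr ss; have := H w wr.
    by have := lerB_cabs (Psi s w) (Psi s' w); rewrite (cabsB (Psi s w)); lra.
  - by move=> w wr; exact: cP.
have [N Nd] : exists N : nat, 1 / d < N%:R.
  by exists (Num.truncn (1 / d)).+1; exact: truncnS_gt.
have N0 : 0 < (N%:R : R) by apply: lt_trans Nd; rewrite divr_gt0.
have all k : (k <= N)%N -> forall z, cabs z <= r -> c <= cabs (Psi (k%:R / N%:R) z).
  elim: k => [_|k IH kN].
    rewrite mul0r => z zr; apply: (@cabs_min_principle (Psi 0) r c) => //.
    - by move=> w wr; apply: dPsi => //; rewrite lexx ler01.
    - by move=> w wr; apply: cP => //; rewrite lexx ler01.
  have k01 j : (j <= N)%N -> 0 <= (j%:R / N%:R : R) <= 1.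
    by move=> jN; rewrite divr_ge0//= ler_pdivrMr// mul1r ler_nat.
  apply: (step (k%:R / N%:R)); [exact/k01/ltnW|exact: k01| |exact/IH/ltnW].
  rewrite -mulrBl -natrB// subSnn gtr0_norm ?divr_gt0//.
  by rewrite ltr_pdivrMr// -ltr_pdivrMl// mulrC.
move=> z zr; have := all N (leqnn N) z zr; rewrite divff ?(gt_eqF N0)// => cPz.
by rewrite -cabs_gt0 (lt_le_trans c0).
Qed.

End maximum_principle.

(** * Holomorphic functions along complex lines and analytic discs *)

Section several_variables.
Context {R : realType} {n : nat}.
Implicit Types (x p q u v : 'rV[R[i]]_n) (f : 'rV[R[i]]_n -> R[i]) (z : R[i]) (r e s : R).

Lemma mx_norm_le_enorm x : `|x| <= (enorm x)%:C.
Proof.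
have [->|x0] := eqVneq `|x| 0; first by rewrite ler0c enorm_ge0.
by have [[i j] E] := mx_norm_neq0 x0; rewrite [`|x|]E normr_cabs lecR ord1 cabs_le_enorm.
Qed.

Lemma linear_row_expand (L : {linear 'rV[R[i]]_n -> R[i]}) x :
  L x = \sum_j x 0 j * L (delta_mx 0 j).
Proof.
rewrite [in LHS](row_sum_delta x) linear_sum; apply: eq_bigr => j _.
by rewrite linearZ.
Qed.

Lemma cabs_sum (I : finType) (F : I -> R[i]) : cabs (\sum_i F i) <= \sum_i cabs (F i).
Proof.
elim/big_ind2 : _ => [|a b c d ab cd|//]; first by rewrite cabs0.
by apply: le_trans (cabsD _ _) _; exact: lerD.
Qed.

Lemma linear_row_bound (L : {linear 'rV[R[i]]_n -> R[i]}) :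
  exists2 C : R, 0 <= C & forall x, cabs (L x) <= C * enorm x.
Proof.
exists (\sum_j cabs (L (delta_mx 0 j))); first by apply: sumr_ge0 => j _; exact: cabs_ge0.
move=> x; rewrite linear_row_expand; apply: le_trans (cabs_sum _) _.
rewrite mulr_suml; apply: ler_sum => j _; rewrite cabsM mulrC.
by rewrite ler_wpM2l ?cabs_ge0// cabs_le_enorm.
Qed.

(** The derivative in terms of the Euclidean norm instead of the maximum norm. *)
Lemma differentiable_eps f x : differentiable f x ->
  exists L : {linear 'rV[R[i]]_n -> R[i]}, forall e, 0 < e -> exists2 r : R, 0 < r &
    forall h, enorm h < r -> cabs (f (x + h) - f x - L h) <= e * enorm h.
Proof.
move=> df; exists ('d f x) => e e0.
have /diff_locally /eqaddoP/(_ e%:C) := df.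
rewrite ltcR => /(_ e0) /nbhs_enormP[r r0 H]; exists r => // h hr.
have := H h; rewrite subr0 => /(_ hr) /=; rewrite !fctE/= !normr_cabs (addrC h) opprD addrA.
move=> B; rewrite -lecR; apply: le_trans B _.
rewrite (_ : (e * enorm h)%:C = e%:C * (enorm h)%:C); last exact: rmorphM.
apply: ler_wpM2l; first by rewrite ler0c ltW.
exact: mx_norm_le_enorm.
Qed.

Lemma holomorphic_lip f x : differentiable f x -> exists2 d : R, 0 < d &
  exists2 C : R, 0 <= C & forall h, enorm h < d -> cabs (f (x + h) - f x) <= C * enorm h.
Proof.
move=> /differentiable_eps[L H]; have [d d0 {}H] := H 1 ltr01.
have [C C0 LC] := linear_row_bound L.
exists d => //; exists (1 + C); first by rewrite addr_ge0.
move=> h /H B; rewrite -[f (x + h) - f x](subrK (L h)).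
by apply: le_trans (cabsD _ _) _; rewrite mulrDl lerD.
Qed.

Lemma holomorphic_continuous f x : differentiable f x -> forall e, 0 < e ->
  exists2 d : R, 0 < d & forall y, enorm (y - x) < d -> cabs (f y - f x) < e.
Proof.
move=> /holomorphic_lip[d d0 [C C0 H]] e e0.
have C1 : 0 < C + 1 by rewrite ltr_wpDl.
exists (Num.min d (e / (C + 1))); first by rewrite lt_min d0 divr_gt0.
move=> y; rewrite lt_min => /andP[/H]; rewrite subrKC => B.
rewrite ltr_pdivlMr// mulrC => /(le_lt_trans _); apply; apply: le_trans B _.
by rewrite ler_wpM2r ?enorm_ge0// lerDl.
Qed.

(** The chain rule for the analytic discs of [zero_near_disc]. *)
Lemma cdiff_curve f x u v (E : R[i] -> R[i]) z : cdiff E z ->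
  differentiable f (x + z *: u + E z *: v) ->
  cdiff (fun w => f (x + w *: u + E w *: v)) z.
Proof.
move=> [E' dE] /differentiable_eps[L df].
have [C C0 LC] := linear_row_bound L.
exists (L (u + E' *: v)) => e e0.
have [t t0 lipE] := cderiv_lip dE.
set y := x + z *: u + E z *: v.
set A := enorm u + (cabs E' + 1) * enorm v + 1.
have A0 : 0 < A.
  by rewrite ltr_wpDl// addr_ge0 ?enorm_ge0// mulr_ge0 ?enorm_ge0// addr_ge0 ?cabs_ge0.
set B := C * enorm v + 1; have B0 : 0 < B by rewrite ltr_wpDl// mulr_ge0 ?enorm_ge0.
have e2 : 0 < e / 2 by rewrite divr_gt0.
have [r r0 {}df] := df _ (divr_gt0 e2 A0).
have [s s0 {}dE] := dE _ (divr_gt0 e2 B0).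
have rA : 0 < r / A by rewrite divr_gt0.
exists (Num.min t (Num.min s (r / A))); first by rewrite !lt_min t0 s0.
move=> h; rewrite !lt_min => /andP[/lipE{}lipE /andP[/dE{}dE]].
rewrite ltr_pdivlMr// => hA.
pose k := h *: u + (E (z + h) - E z) *: v.
have yk : x + (z + h) *: u + E (z + h) *: v = y + k.
  rewrite /y /k scalerDl scalerBl addrACA -!addrA; congr (_ + (_ + _)).
  by rewrite addrCA [in RHS]addrCA subrKC.
have kA : enorm k <= cabs h * A.
  apply: le_trans (enormD _ _) _; rewrite !enormZ /A.
  have := ler_wpM2r (enorm_ge0 v) lipE; have := cabs_ge0 h; have := enorm_ge0 v.
  move: (cabs h) (enorm u) (enorm v) (cabs E') (cabs _) => a b c d g c0 a0 H; nra.
have {}df := df k (le_lt_trans kA hA).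
rewrite yk -/y.
have -> : f (y + k) - f y - L (u + E' *: v) * h =
    (f (y + k) - f y - L k) + L ((E (z + h) - E z - E' * h) *: v).
  have -> : L k = h * L u + (E (z + h) - E z) * L v by rewrite linearD !linearZ.
  by rewrite linearD !linearZ /= /GRing.scale/=; ring.
apply: le_trans (cabsD _ _) _.
have P1 : e / 2 / A * enorm k <= e / 2 * cabs h.
  have -> : e / 2 * cabs h = e / 2 / A * (cabs h * A) by field; rewrite gt_eqF.
  by rewrite ler_wpM2l// ltW// divr_gt0.
have P2 : cabs (L ((E (z + h) - E z - E' * h) *: v)) <= e / 2 * cabs h.
  apply: le_trans (LC _) _; rewrite enormZ mulrCA.
  apply: (@le_trans _ _ (e / 2 / B * cabs h * B)); last first.
    by rewrite mulrAC divfK// gt_eqF.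
  by rewrite ler_pM ?cabs_ge0 ?mulr_ge0 ?enorm_ge0// /B lerDl.
by rewrite [leRHS](_ : _ = e / 2 * cabs h + e / 2 * cabs h); [apply: lerD => //; exact: le_trans df P1|field].
Qed.

Lemma cdiff_line f x u z : differentiable f (x + z *: u) -> cdiff (fun w => f (x + w *: u)) z.
Proof.
move=> df; have := @cdiff_curve f x u 0 (fun=> 0) z (cdiff_cst 0 z).
rewrite scaler0 addr0 => /(_ df)[d D]; exists d => e /D[r r0 H]; exists r => // h /H.
by rewrite !addr0.
Qed.

(** Analytic discs and the distance to the zero set: if [f] has no zero on the
    disc [x + zeta *: u], [cabs zeta <= r], the distance from the point with
    parameter [zeta] to the zero set cannot exceed [enorm (x - p) * cabs (E zeta)]
    at every point of the boundary circle, [p] being a zero.  Otherwise the family of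
    discs [x + zeta *: u + s * E zeta *: (p - x)], [0 <= s <= 1], would acquire a
    zero, the point [p] at its center, without ever having one on its boundary. *)
Lemma zero_near_disc f x p u r (E : R[i] -> R[i]) : holomorphic f -> 0 < r ->
  f p = 0 -> E 0 = 1 -> (forall z, cabs z <= r -> cdiff E z) ->
  (forall z, cabs z <= r -> f (x + z *: u) != 0) ->
  exists z q, [/\ cabs z = r, f q = 0 & enorm (x + z *: u - q) <= enorm (x - p) * cabs (E z)].
Proof.
move=> hf r0 fp E0 dE fx; apply: contrapT => no.
pose Psi s z := f (x + z *: u + (s%:C * E z) *: (p - x)).
have : Psi 1 0 != 0; last first.
  by rewrite /Psi scale0r addr0 E0 mulr1 scale1r subrKC fp eqxx.
apply: (@continuity_principle _ Psi r r0) => //; last by rewrite cabs0 ltW.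
- move=> s z _ zr; apply: (@cdiff_curve f x u (p - x) (fun w => s%:C * E w)) => //.
  by apply: cdiffM; [exact: cdiff_cst|exact: dE].
- move=> s z /andP[s0 s1] zr e e0.
  have [d d0 H] := holomorphic_continuous (hf (x + z *: u + (s%:C * E z) *: (p - x))) e0.
  set A := enorm u + (1 + (1 + cabs (E z))) * enorm (p - x) + 1.
  have A0 : 0 < A.
    by rewrite ltr_wpDl// addr_ge0 ?enorm_ge0// mulr_ge0 ?enorm_ge0// !addr_ge0 ?cabs_ge0.
  have t0 : 0 < Num.min 1 (d / A / 2) by rewrite lt_min ltr01 !divr_gt0.
  have [t1 t10 Et] := cdiff_continuous (dE z zr) t0.
  exists (Num.min t1 (d / A / 2)); first by rewrite lt_min t10 !divr_gt0.
  move=> s' z'; rewrite !lt_min => /andP[_ sA] /andP[zt zA].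
  apply: H.
  have {Et} := Et (z' - z) zt; rewrite subrKC lt_min => /andP[E1 EA].
  have -> : x + z' *: u + (s'%:C * E z') *: (p - x) - (x + z *: u + (s%:C * E z) *: (p - x)) =
     (z' - z) *: u + (s%:C * (E z' - E z) + (s' - s)%:C * E z') *: (p - x).
    by apply/rowP => j; rewrite !mxE rmorphB/=; ring.
  apply: le_lt_trans (enormD _ _) _; rewrite !enormZ.
  have Q : cabs (s%:C * (E z' - E z) + (s' - s)%:C * E z') <= cabs (E z' - E z) + `|s' - s| * (1 + cabs (E z)).
    apply: le_trans (cabsD _ _) _; rewrite !cabsM !cabs_real; apply: lerD.
      by rewrite ger0_norm// ler_piMl ?cabs_ge0.
    rewrite ler_wpM2l//; have := cabsD (E z' - E z) (E z); rewrite subrK => /le_trans; apply.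
    by rewrite lerD2r ltW.
  set tau := d / A / 2 in zA EA sA.
  have tauA : tau * A < d.
    by rewrite /tau mulrAC divfK ?gt_eqF// ltr_pdivrMr// ltr_pMr// ltr1n.
  have tau0 : 0 < tau by rewrite /tau !divr_gt0.
  apply: le_lt_trans tauA; rewrite /A.
  have := ler_wpM2r (enorm_ge0 (p - x)) Q; have := ltW zA; have := ltW EA; have := ltW sA.
  have := enorm_ge0 u; have := enorm_ge0 (p - x); have := cabs_ge0 (E z).
  move: (cabs (s%:C * _ + _)) (enorm u) (enorm (p - x)) (cabs (E z)) (cabs (z' - z)) (cabs (E z' - E z)) `|s' - s|.
  move=> q U V ez a b c ez0 V0 U0 ct bt at_ qV.
  have : a * U <= tau * U by rewrite ler_wpM2r.
  have : (b + c * (1 + ez)) * V <= (tau + tau * (1 + ez)) * V.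
    by rewrite ler_wpM2r// lerD// ler_wpM2r// addr_ge0.
  clear -qV tau0; lra.
- move=> z zr; rewrite /Psi mul0r scale0r addr0; exact: fx.
- move=> s z /andP[s0 s1] zr; apply/negP => /eqP Pz; apply: no.
  exists z, (x + z *: u + (s%:C * E z) *: (p - x)); split=> //.
  rewrite opprD addrA subrr sub0r enormN enormZ cabsM cabs_real ger0_norm//.
  by rewrite (enormB p) mulrC ler_wpM2l ?enorm_ge0// ler_piMl ?cabs_ge0.
Qed.

End several_variables.

(** * Second-order bounds near the zero set *)

Section touching.
Context {R : realType} {n : nat}.
Implicit Types (x p q : 'rV[R[i]]_n) (z a b c m w : R[i]) (r e s t : R).

Lemma half_between s : 0 < s -> exists2 t, 0 < t & t < s.
Proof. by move=> s0; exists (s / 2); rewrite ?divr_gt0// ltr_pdivrMr// ltr_pMr// ltr1n. Qed.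

Lemma clog1 : clog 1 = 0 :> R[i].
Proof. by rewrite /clog cabs1 ln1/= mul0r atan0. Qed.

Lemma cderiv_clog1 : cderiv (@clog R) 1 1.
Proof.
have e1 : @cexp R (clog 1) = 1 by rewrite clog1 cexp0.
have := @cderiv_inverse R (@cexp R) (@clog R) 1 1 (oner_neq0 _).
rewrite invr1; apply; first by rewrite -[X in cderiv _ _ X]e1; exact: cderiv_cexp.
  exists 1 => // h h1; apply: cexp_clog; rewrite ReD/=.
  by have := cabs_Re h; have := ler_norm (- Re h); rewrite normrN; lra.
by apply: clog_continuous; rewrite /= ltr01.
Qed.

Lemma enorm_sqr_line x z (j : 'I_n) :
  enorm (x + z *: delta_mx 0 j) ^+ 2 =
  enorm x ^+ 2 + 2 * Re ((x 0 j)^* * z) + cabs z ^+ 2.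
Proof.
rewrite !sqr_enorm (bigD1 j)//= [in RHS](bigD1 j)//=.
rewrite (eq_bigr (fun i => cabs (x 0 i) ^+ 2)); last first.
  by move=> i ij; rewrite !mxE eqxx (negbTE ij) mulr0 addr0.
rewrite !mxE !eqxx mulr1 !sqr_cabs.
by case: (x 0 j) => u v; case: z => s t /=; simpc => /=; ring.
Qed.

Lemma ReZ s z : Re (s%:C * z) = s * Re z.
Proof. by rewrite ReM/= mul0r subr0. Qed.

Lemma sqr_Re z : Re z ^+ 2 = (cabs z ^+ 2 + Re (z ^+ 2)) / 2.
Proof. by rewrite sqr_cabs expr2 ReM; field. Qed.

(** On the complex line through [x] in direction [j], [Theta (dist ^+ 2)] lies
    below a quadratic function minus [ep * ln (cabs f)], with equality at [x].
    The gradient of this bound is forced by the distance to the single zero [p].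
    Apply [zero_near_disc] with [E z = cexp (b * z + c * z ^+ 2) * g z ^ al], where
    [g = f / f x]: some zero [q] is at distance at most
    [enorm (x - p) * cabs (E z)] from the point with parameter [z].  Written in the
    variable [s = ln (cabs E)], in which [Theta (tau * expR (2 * s))] has derivative
    [P1 = 2 * tau * T1] at [0], the exponents [b], [c] and [al] are such that the terms
    in [be], in [ga] and in the logarithm of [f] cancel.  What remains is the mean
    over the circle of the second-order term of [Theta], which is the left hand
    side of the conclusion. *)
Lemma line_touch (f : 'rV[R[i]]_n -> R[i]) x p (j : 'I_n) (Theta : R -> R)
    (T1 P2 ka ep : R) (be ga : R[i]) :
  holomorphic f -> f p = 0 -> f x != 0 -> 0 <= ep -> T1 < 0 ->
  (forall s t, 0 <= s -> s <= t -> Theta t <= Theta s) ->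
  let tau := enorm (x - p) ^+ 2 in
  (forall e, 0 < e -> exists2 r : R, 0 < r & forall s, `|s| < r ->
    `|Theta (tau + s) - Theta tau - T1 * s| <= e * `|s|) ->
  (forall e, 0 < e -> exists2 r : R, 0 < r & forall s, `|s| < r ->
    `|Theta (tau * expR (2 * s)) - Theta tau - 2 * tau * T1 * s - P2 / 2 * s ^+ 2| <= e * s ^+ 2) ->
  (forall e, 0 < e -> exists2 r : R, 0 < r & forall z, cabs z < r -> forall q, f q = 0 ->
    Theta (enorm (x + z *: delta_mx 0 j - q) ^+ 2) <=
    Theta tau + Re (be * z) + Re (ga * z ^+ 2) + ka * cabs z ^+ 2 + e * cabs z ^+ 2
      - ep * (ln (cabs (f (x + z *: delta_mx 0 j))) - ln (cabs (f x)))) ->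
  P2 * cabs ((x - p) 0 j) ^+ 2 / (4 * tau ^+ 2) <= ka.
Proof.
move=> hf fp fx ep0 T10 Tdec tau HT HP H.
set u : 'rV[R[i]]_n := delta_mx 0 j in H *.
have xp0 : 0 < enorm (x - p).
  rewrite lt0r enorm_ge0 andbT; apply: contraNneq fx => xp.
  suff -> : x = p by rewrite fp.
  apply/eqP; rewrite -subr_eq0; apply/eqP/rowP => i; rewrite [RHS]mxE.
  by apply/eqP; rewrite -cabs_eq0 eq_le cabs_ge0 andbT -xp cabs_le_enorm.
have tau0 : 0 < tau by rewrite exprn_gt0.
pose g z := f (x + z *: u) / f x.
have fx0 : 0 < cabs (f x) by rewrite cabs_gt0.
have dg z : cdiff g z.
  apply: (@cdiffM _ (fun z => f (x + z *: u))); last exact: cdiff_cst.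
  by apply: cdiff_line; exact: hf.
have g0 : g 0 = 1 by rewrite /g scale0r addr0 divff.
have [a da] := dg 0.
have dl : cderiv (fun z => clog (g z)) 0 a.
  have := @cderiv_comp _ (@clog R) g 0 1 a da; rewrite g0 mul1r; apply.
  exact: cderiv_clog1.
pose L z := Re (clog (g z)).
have LE z : f (x + z *: u) != 0 ->
    ln (cabs (f (x + z *: u))) - ln (cabs (f x)) = L z.
  by move=> fz; rewrite /L/= /g cabsM cabsV ln_div// posrE cabs_gt0.
have La e : 0 < e -> exists2 r : R, 0 < r & forall z, cabs z < r -> `|L z - Re (a * z)| <= e * cabs z.
  move=> e0; have [r r0 Hr] := dl e e0; exists r => // z /Hr.
  rewrite add0r g0 clog1 subr0 => /(le_trans (cabs_Re _)).
  by rewrite ReD ReN.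
(* near [x] the function [f] has no zero and [g] stays in the right half plane *)
have [r1 r10 gr1] : exists2 r : R, 0 < r & forall z, cabs z < r -> 0 < Re (g z).
  have [r r0 Hr] := cdiff_continuous (dg 0) (ltr01 : (0 : R) < 1).
  exists r => // z /Hr; rewrite add0r g0 => B.
  have := le_lt_trans (cabs_Re _) B; rewrite ReD ReN/= => {}B.
  by have := ler_norm (- (Re (g z) - 1)); rewrite normrN; lra.
have fnz z : cabs z < r1 -> f (x + z *: u) != 0.
  by move=> /gr1; apply: contraTneq => fz; rewrite /g fz mul0r/= ltxx.
set d := (x - p) 0 j.
(* the gradient of the bound is that of [Theta (enorm (x - p) ^+ 2)] *)
have grad : be - ep%:C * a = (2 * T1)%:C * d^*.
  apply/eqP; rewrite -subr_eq0; apply/negPn/negP => w0.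
  set w := be - ep%:C * a - (2 * T1)%:C * d^* in w0.
  have W0 : 0 < cabs w by rewrite cabs_gt0.
  set W := cabs w in W0.
  have D1 : 0 < 2 * cabs d + 1 by rewrite ltr_wpDl// mulr_ge0// cabs_ge0.
  have ep1 : 0 < ep + 1 by rewrite ltr_wpDl.
  set B := `|T1| + cabs ga + `|ka| + 1.
  have B0 : 0 < B by rewrite ltr_wpDl// !addr_ge0 ?cabs_ge0.
  have W8 : 0 < W / 8 by rewrite divr_gt0.
  have [r2 r20 HT'] := HT _ (divr_gt0 W8 D1).
  have [r3 r30 La'] := La _ (divr_gt0 W8 ep1).
  have [r4 r40 H'] := H 1 ltr01.
  have r2D := divr_gt0 r20 D1; have WB := divr_gt0 W8 B0.
  have : 0 < Num.min (Num.min (Num.min r1 r3) (Num.min r4 1)) (Num.min (r2 / (2 * cabs d + 1)) (W / 8 / B)).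
    by rewrite !lt_min r10 r30 r40 ltr01 r2D.
  move=> /half_between[t t0].
  rewrite !lt_min => /andP[/andP[/andP[tr1 tr3] /andP[tr4 t1]] /andP[]].
  rewrite !ltr_pdivlMr// => tr2 tB.
  pose z := - (w^* * (t / W)%:C).
  have zt : cabs z = t.
    rewrite cabsN cabsM cabs_conj cabs_real ger0_norm; last by rewrite divr_ge0// ltW.
    by rewrite -/W mulrC divfK// gt_eqF.
  have wz : Re (w * z) = - (W * t).
    rewrite /z mulrN ReN mulrA mul_conj -/W -rmorphM/=; congr (- _).
    by field; rewrite gt_eqF.
  have := H' z; rewrite zt => /(_ tr4 p fp); rewrite LE; last by apply: fnz; rewrite zt.
  have -> : x + z *: u - p = (x - p) + z *: u by rewrite addrAC.
  rewrite /u enorm_sqr_line -/d zt -addrA.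
  have sle : `|2 * Re (d^* * z) + t ^+ 2| <= (2 * cabs d + 1) * t.
    apply: le_trans (ler_normD _ _) _; rewrite normrM (ger0_norm (sqr_ge0 t)) ger0_norm//.
    have := cabs_Re (d^* * z); rewrite cabsM cabs_conj zt => dz.
    have : t ^+ 2 <= t by rewrite expr2 ler_piMl ?(ltW t0) ?(ltW t1).
    by clear -dz; lra.
  have := HT' (2 * Re (d^* * z) + t ^+ 2).
  have -> : `|2 * Re (d^* * z) + t ^+ 2| < r2.
    by apply: le_lt_trans sle _; rewrite mulrC.
  move=> /(_ isT); rewrite ler_norml => /andP[low _].
  have := La' z; rewrite zt => /(_ tr3); rewrite ler_norml => /andP[Llow _].
  have gz : Re (ga * z ^+ 2) <= cabs ga * t ^+ 2.
    by apply: le_trans (ler_norm _) _; apply: le_trans (cabs_Re _) _; rewrite cabsM cabsX zt.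
  have kz : ka * t ^+ 2 <= `|ka| * t ^+ 2 by rewrite ler_wpM2r ?sqr_ge0// ler_norm.
  have Tz : - (`|T1| * t ^+ 2) <= T1 * t ^+ 2.
    by rewrite -mulNr ler_wpM2r ?sqr_ge0// lerNl -normrN ler_norm.
  have wE : Re (w * z) = Re (be * z) - ep * Re (a * z) - 2 * T1 * Re (d^* * z).
    by rewrite /w !mulrBl !ReD !ReN -!mulrA !ReM/= !mul0r !subr0; ring.
  have E1 : W / 8 / (2 * cabs d + 1) * `|2 * Re (d^* * z) + t ^+ 2| <= W / 8 * t.
    have -> : W / 8 * t = W / 8 / (2 * cabs d + 1) * ((2 * cabs d + 1) * t).
      by field; rewrite gt_eqF.
    by rewrite ler_wpM2l// ltW// divr_gt0.
  have E2 : ep * (W / 8 / (ep + 1) * t) <= W / 8 * t.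
    rewrite mulrA ler_wpM2r ?(ltW t0)// mulrA ler_pdivrMr// mulrC ler_wpM2l ?(ltW W8)//.
    by rewrite lerDl.
  have E3 : B * t ^+ 2 <= W / 8 * t.
    by rewrite expr2 mulrA ler_wpM2r ?(ltW t0)// ler_pdivlMr// (mulrC B) ltW.
  have E4 : ep * (Re (a * z) - W / 8 / (ep + 1) * t) <= ep * L z.
    by rewrite ler_wpM2l//; clear -Llow; lra.
  move: wE; rewrite wz => wE up.
  have Wt : 0 < W * t by rewrite mulr_gt0.
  move: E3; rewrite /B => E3.
  clear -wE up low gz kz Tz E1 E2 E3 E4 Wt; lra.
set P1 := 2 * tau * T1.
have P10 : P1 < 0 by rewrite /P1 nmulr_llt0// mulr_gt0.
have P1n : P1 != 0 by rewrite lt_eqF.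
(* [m * z] is the first-order part of the logarithm of the comparison disc [E] *)
set m := d^* / tau%:C.
have m2 : cabs m ^+ 2 = cabs d ^+ 2 / tau ^+ 2.
  by rewrite /m cabsM cabs_conj cabsV cabs_real gtr0_norm// expr_div_n.
have -> : P2 * cabs d ^+ 2 / (4 * tau ^+ 2) = P2 / 4 * cabs m ^+ 2.
  by rewrite m2; field; rewrite gt_eqF.
apply/ler_addgt0Pr => gap gap0.
pose b := be / P1%:C; pose al := - ep / P1.
pose c := (ga - (P2 / 4)%:C * m ^+ 2) / P1%:C.
have tauC : tau%:C != 0 by apply/eqP => -[/eqP]; rewrite gt_eqF.
have P1C : P1%:C != 0 by apply/eqP => -[/eqP]; rewrite (negbTE P1n).
have bm : b + al%:C * a = m.
  have -> : al%:C = - (ep%:C / P1%:C) :> R[i].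
    by rewrite /al mulNr rmorphN/= rmorphM/= fmorphV.
  rewrite /b mulNr mulrAC -mulrBl grad /m.
  have -> : (2 * T1)%:C = P1%:C / tau%:C.
    by rewrite -fmorphV -rmorphM/=; congr _%:C; rewrite /P1; field; rewrite gt_eqF.
  by field; rewrite P1C tauC.
pose E z := cexp (b * z + c * z ^+ 2 + al%:C * clog (g z)).
pose sg z := Re (b * z + c * z ^+ 2) + al * L z.
have absE z : cabs (E z) = expR (sg z).
  by rewrite cabs_cexp /sg ReD ReZ.
have E0 : E 0 = 1 by rewrite /E g0 clog1 expr0n !mulr0 !addr0 cexp0.
have dE r : r < r1 -> forall z, cabs z <= r -> cdiff E z.
  move=> rr1 z zr; apply: (@cdiff_comp _ (@cexp R) (fun z => b * z + c * z ^+ 2 + al%:C * clog (g z))).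
    apply: cdiffD; last first.
      apply: cdiffM; first exact: cdiff_cst.
      apply: (@cdiff_comp _ (@clog R) g) => //; apply: cdiff_clog; apply: gr1.
      exact: le_lt_trans zr rr1.
    apply: cdiffD; first by apply: cdiffM; [exact: cdiff_cst|exact: cdiff_id].
    apply: cdiffM; first exact: cdiff_cst.
    rewrite (_ : (fun z => z ^+ 2) = fun z => z * z); last first.
      by apply/funext => w; rewrite expr2.
    by apply: cdiffM; exact: cdiff_id.
  by eexists; exact: cderiv_cexp.
pose M := cabs m.
have M0 : 0 <= M by exact: cabs_ge0.
have [r0 r00 Hsg] : exists2 r : R, 0 < r & forall z, cabs z < r ->
    `|sg z - Re (m * z)| <= Num.min 1 (gap / 4 / (`|P2| * (M + 1) + 1)) * cabs z.
  set e := Num.min _ _.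
  have e0 : 0 < e.
    rewrite lt_min ltr01 divr_gt0 ?divr_gt0// ltr_wpDl// mulr_ge0// addr_ge0//.
  have al1 : 0 < `|al| + 1 by rewrite ltr_wpDl.
  have c1 : 0 < cabs c + 1 by rewrite ltr_wpDl// cabs_ge0.
  clearbody e; have e2 : 0 < e / 2 by rewrite divr_gt0.
  have [r r0 La'] := La _ (divr_gt0 e2 al1).
  have ec := divr_gt0 e2 c1.
  exists (Num.min r (e / 2 / (cabs c + 1))); first by rewrite lt_min r0.
  move=> z; rewrite lt_min => /andP[/La'{}La']; rewrite ltr_pdivlMr// => zc.
  have -> : sg z - Re (m * z) = al * (L z - Re (a * z)) + Re (c * z ^+ 2).
    have -> : Re (m * z) = Re (b * z) + al * Re (a * z).
      by rewrite -bm mulrDl ReD -(mulrA al%:C) ReZ.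
    by rewrite /sg ReD; ring.
  apply: le_trans (ler_normD _ _) _; rewrite normrM.
  have A1 : `|al| * `|L z - Re (a * z)| <= e / 2 * cabs z.
    apply: (@le_trans _ _ ((`|al| + 1) * (e / 2 / (`|al| + 1) * cabs z))).
      by rewrite ler_pM// lerDl.
    by rewrite mulrA (mulrC (_ + 1)) divfK// gt_eqF.
  have A2 : `|Re (c * z ^+ 2)| <= e / 2 * cabs z.
    apply: le_trans (cabs_Re _) _; rewrite cabsM cabsX expr2 mulrA.
    rewrite ler_wpM2r ?cabs_ge0//; apply: le_trans (ltW zc).
    by rewrite mulrC ler_wpM2l ?cabs_ge0// lerDl.
  by clear -A1 A2; lra.
set e1 := Num.min _ _ in Hsg.
have e11 : e1 <= 1 by rewrite ge_min lexx.
have Q0 : 0 < `|P2| * (M + 1) + 1 by rewrite ltr_wpDl// mulr_ge0// addr_ge0.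
have e10 : 0 < e1 by rewrite lt_min ltr01 divr_gt0 ?divr_gt0.
have e1g : e1 * (`|P2| * (M + 1) + 1) <= gap / 4.
  by rewrite -ler_pdivlMr// ge_min lexx orbT.
clearbody e1.
have M1 : 0 < (M + 1) ^+ 2 by rewrite exprn_gt0// ltr_wpDl.
have g4 : 0 < gap / 4 by rewrite divr_gt0.
have [r2 r20 HP'] := HP _ (divr_gt0 g4 M1).
have [r3 r30 H'] := H _ g4.
have r2M : 0 < r2 / (M + 1) by rewrite divr_gt0// ltr_wpDl.
have : 0 < Num.min (Num.min r0 r1) (Num.min r3 (r2 / (M + 1))).
  by rewrite !lt_min r00 r10 r30.
move=> /half_between[r rp].
rewrite !lt_min => /andP[/andP[rr0 rr1] /andP[rr3]].
rewrite ltr_pdivlMr ?ltr_wpDl// => rr2.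
have [z [q [zr fq dq]]] := @zero_near_disc R n f x p u r E hf rp fp E0 (dE r rr1)
  (fun z zr => fnz z (le_lt_trans zr rr1)).
have {}Hsg := Hsg z; rewrite zr in Hsg; have {}Hsg := Hsg rr0.
have sM : `|sg z| <= (M + 1) * r.
  have mz := cabs_Re (m * z); rewrite cabsM zr -/M in mz.
  have := ler_normD (sg z - Re (m * z)) (Re (m * z)); rewrite subrK.
  have : e1 * r <= r by rewrite ler_piMl ?(ltW rp).
  by clear -mz Hsg; lra.
have {}HP' := HP' (sg z); have {HP'}/HP' : `|sg z| < r2 by rewrite (le_lt_trans sM)// mulrC.
rewrite -/P1 => HP'.
have {}H' := H' z; rewrite zr in H'; have {}H' := H' rr3 q fq.
rewrite LE in H'; last by apply: fnz; rewrite zr.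
have T : Theta (tau * expR (2 * sg z)) <= Theta (enorm (x + z *: u - q) ^+ 2).
  apply: Tdec; first exact: sqr_ge0.
  have -> : expR (2 * sg z) = expR (sg z) ^+ 2.
    by rewrite expr2 -expRD; congr expR; ring.
  rewrite absE in dq; rewrite /tau -exprMn.
  by rewrite ler_sqr ?nnegrE ?enorm_ge0// mulr_ge0 ?enorm_ge0// expR_ge0.
have s2 : sg z ^+ 2 <= (M + 1) ^+ 2 * r ^+ 2.
  by rewrite -exprMn -real_normK ?num_real// ler_sqr ?nnegrE// mulr_ge0 ?addr_ge0// ltW.
have A1 : gap / 4 / (M + 1) ^+ 2 * sg z ^+ 2 <= gap / 4 * r ^+ 2.
  have -> : gap / 4 * r ^+ 2 = gap / 4 / (M + 1) ^+ 2 * ((M + 1) ^+ 2 * r ^+ 2).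
    by field; rewrite gt_eqF// ltr_wpDl.
  by rewrite ler_wpM2l// ltW// divr_gt0.
have A2 : P1 * sg z = Re (be * z) + Re (ga * z ^+ 2) - P2 / 4 * Re (m ^+ 2 * z ^+ 2) - ep * L z.
  have beE : be = P1%:C * b by rewrite /b mulrC divfK.
  have gaE : ga = P1%:C * c + (P2 / 4)%:C * m ^+ 2 by rewrite /c (mulrC P1%:C) divfK// subrK.
  have alE : P1 * al = - ep by rewrite /al mulrC divfK.
  have -> : P1 * sg z = P1 * Re (b * z) + P1 * Re (c * z ^+ 2) + (P1 * al) * L z.
    by rewrite /sg ReD; ring.
  rewrite alE beE gaE -(mulrA P1%:C b) ReZ (mulrDl (P1%:C * c)) ReD.
  rewrite -(mulrA P1%:C c) ReZ -(mulrA (P2 / 4)%:C) ReZ.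
  by ring.
have rho2 : Re (m * z) ^+ 2 = (M ^+ 2 * r ^+ 2 + Re (m ^+ 2 * z ^+ 2)) / 2.
  by rewrite sqr_Re cabsM zr !exprMn.
have A3 : `|sg z ^+ 2 - Re (m * z) ^+ 2| <= e1 * (2 * (M + 1)) * r ^+ 2.
  rewrite subr_sqr normrM expr2.
  have -> : e1 * (2 * (M + 1)) * (r * r) = (e1 * r) * (2 * (M + 1) * r) by ring.
  apply: ler_pM => //; apply: le_trans (ler_normD _ _) _.
  have := cabs_Re (m * z); rewrite cabsM zr -/M.
  by clear -sM rp; lra.
have A4 : `|P2 / 2 * (sg z ^+ 2 - Re (m * z) ^+ 2)| <= gap / 4 * r ^+ 2.
  rewrite normrM; apply: (@le_trans _ _ (`|P2| / 2 * (e1 * (2 * (M + 1)) * r ^+ 2))).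
    by rewrite ler_pM// normrM normfV (@ger0_norm _ 2).
  have -> : `|P2| / 2 * (e1 * (2 * (M + 1)) * r ^+ 2) = e1 * (`|P2| * (M + 1)) * r ^+ 2 by field.
  rewrite ler_wpM2r ?sqr_ge0//; apply: le_trans e1g.
  by rewrite ler_wpM2l ?(ltW e10)// lerDl.
have r2p : 0 < r ^+ 2 by rewrite exprn_gt0.
rewrite -/M -(ler_pM2r r2p); move: HP'; rewrite ler_norml => /andP[HP' _].
move: A4; rewrite rho2 ler_norml => /andP[A4 _].
move: A2 A1 T H' HP' A4 => A2 A1 T H' HP' A4.
set X := Re (m ^+ 2 * z ^+ 2) in A2 A4; set r2' := r ^+ 2 in A1 A4 H' r2p *.
have gr : 0 <= gap * r2' by rewrite mulr_ge0 ?ltW.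
clear -A2 A1 T H' HP' A4 gr; lra.
Qed.

End touching.

(** * Gaussian integrals *)

Section gaussian_integral.
Context {R : realType}.
Notation mu := (@lebesgue_measure R).
Implicit Types (a b g s x : R).

(** Completing the square. *)
Lemma integral_gauss_quad a b g : 0 < g ->
  (\int[mu]_s (expR (- ((a - 2 * b * s + g * s ^+ 2) / 2)))%:E =
   (Num.sqrt (2 * pi / g) * expR (- ((a - b ^+ 2 / g) / 2)))%:E)%E.
Proof.
move=> g0; set sg := Num.sqrt g^-1.
have sg0 : 0 < sg by rewrite sqrtr_gt0 invr_gt0.
have sg2 : sg ^+ 2 = g^-1 by rewrite sqr_sqrtr// invr_ge0 ltW.
have pk0 : 0 < normal_peak sg by apply: normal_peak_gt0; rewrite gt_eqF.
have pkE : (normal_peak sg)^-1 = Num.sqrt (2 * pi / g).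
  by rewrite /normal_peak invrK sg2; congr Num.sqrt; rewrite -mulr_natl; ring.
have E s : expR (- ((a - 2 * b * s + g * s ^+ 2) / 2)) =
    Num.sqrt (2 * pi / g) * expR (- ((a - b ^+ 2 / g) / 2)) * normal_pdf (b / g) sg s.
  rewrite normal_pdfE ?gt_eqF// /normal_fun sg2 -pkE.
  rewrite mulrACA mulVf ?gt_eqF// mul1r -expRD; congr expR.
  by rewrite -mulr_natr; field; rewrite gt_eqF.
under eq_integral => s _ do rewrite E EFinM.
rewrite ge0_integralZl//; first by rewrite integral_normal_pdf mule1.
- by apply/measurable_EFinP; exact: measurable_normal_pdf.
- by move=> s _; rewrite lee_fin normal_pdf_ge0.
Qed.

(** Fubini for the product measure on tuples, one coordinate at a time. *)
Lemma integral_tuple_cons n (F : n.+1.-tuple (measurableTypeR R) -> \bar R) :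
  measurable_fun setT F -> (forall t, 0 <= F t)%E ->
  (\int[tuple_measure mu n.+1]_t F t =
   \int[mu]_x \int[tuple_measure mu n]_t F [tuple of x :: t])%E.
Proof.
move=> mF F0.
pose tcons (p : measurableTypeR R * n.-tuple (measurableTypeR R)) : n.+1.-tuple (measurableTypeR R) :=
  [tuple of p.1 :: p.2].
have mt : measurable_fun setT tcons by exact: measurable_cons.
transitivity (\int[mu \x tuple_measure mu n]_p F (tcons p))%E.
  have := @ge0_integral_pushforward _ _ _ _ _ tcons mt (mu \x tuple_measure mu n)%E setT F.
  by rewrite preimage_setT; apply.
rewrite fubini_tonelli1//; last exact: measurableT_comp.
Qed.

Lemma measurable_tuple_affine n (u : 'I_n -> R) c :
  measurable_fun setT (fun t : n.-tuple (measurableTypeR R) => c - \sum_j tnth t j * u j).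
Proof.
apply: measurable_funB => //; apply: measurable_sum => j.
by apply: measurable_funM => //; exact: measurable_tnth.
Qed.

Definition gauss1 s : R := (Num.sqrt (2 * pi))^-1 * expR (- (s ^+ 2 / 2)).

Lemma gauss1_gt0 s : 0 < gauss1 s.
Proof. by rewrite mulr_gt0 ?expR_gt0// invr_gt0 sqrtr_gt0 mulr_gt0// pi_gt0. Qed.

Lemma measurable_gauss1 : measurable_fun setT gauss1.
Proof.
apply: measurable_funM => //; apply: measurableT_comp => //.
by apply: measurableT_comp => //; apply: measurable_funM.
Qed.

Definition gaussn n (t : n.-tuple (measurableTypeR R)) : R := \prod_j gauss1 (tnth t j).

Lemma gaussn_ge0 n t : 0 <= @gaussn n t.
Proof. by apply: prodr_ge0 => j _; exact/ltW/gauss1_gt0. Qed.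

Lemma measurable_gaussn n : measurable_fun setT (@gaussn n).
Proof.
apply: measurable_prod => j _.
apply: (@measurableT_comp _ _ _ _ _ _ gauss1); first exact: measurable_gauss1.
exact: measurable_tnth.
Qed.

Lemma gaussn_cons n x (t : n.-tuple (measurableTypeR R)) :
  gaussn [tuple of x :: t] = gauss1 x * gaussn t.
Proof.
rewrite /gaussn big_ord_recl tnth0; congr (_ * _).
by apply: eq_bigr => j _; rewrite tnthS.
Qed.

(** The centered Gaussian function on the plane with covariance matrix
    [[p, q; q, r]], up to the factor [2 * pi]. *)
Definition plane_gauss p q r x y : R :=
  (Num.sqrt (p * r - q ^+ 2))^-1 *
  expR (- ((r * x ^+ 2 - 2 * q * x * y + p * y ^+ 2) / (p * r - q ^+ 2) / 2)).

Lemma plane_gauss_ge0 p q r x y : 0 <= plane_gauss p q r x y.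
Proof. by rewrite mulr_ge0 ?expR_ge0// invr_ge0 sqrtr_ge0. Qed.

Definition posdef2 (p q r : R) := (0 < p) && (0 < p * r - q ^+ 2).

Lemma posdef2D (p q r u v : R) : posdef2 p q r -> posdef2 (p + u ^+ 2) (q + u * v) (r + v ^+ 2).
Proof.
move=> /andP[p0 D0]; apply/andP; split; first by rewrite ltr_wpDr ?sqr_ge0.
have := sqr_ge0 (p * v - q * u).
have -> : (p + u ^+ 2) * (r + v ^+ 2) - (q + u * v) ^+ 2 =
  (p * r - q ^+ 2) + p^-1 * ((p * v - q * u) ^+ 2 + (p * r - q ^+ 2) * u ^+ 2).
  by field; rewrite gt_eqF.
move=> H; rewrite ltr_wpDr// mulr_ge0 ?invr_ge0 ?(ltW p0)// addr_ge0//.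
by rewrite mulr_ge0 ?sqr_ge0// ltW.
Qed.

(** Convolution with a Gaussian along the direction [(u, v)] adds
    [[u ^+ 2, u * v; u * v, v ^+ 2]] to the covariance. *)
Lemma integral_plane_gauss p q r u v x y : posdef2 p q r ->
  (\int[mu]_s (gauss1 s * plane_gauss p q r (x - s * u) (y - s * v))%:E =
  (plane_gauss (p + u ^+ 2) (q + u * v) (r + v ^+ 2) x y)%:E)%E.
Proof.
move=> pd; have /andP[p0' D0'] := posdef2D u v pd; have /andP[p0 D0] := pd.
set D := p * r - q ^+ 2 in D0.
set D' := (p + u ^+ 2) * (r + v ^+ 2) - (q + u * v) ^+ 2 in D0'.
have D'E : D' = D + (r * u ^+ 2 - 2 * q * u * v + p * v ^+ 2) by rewrite /D' /D; ring.
set a := (r * x ^+ 2 - 2 * q * x * y + p * y ^+ 2) / D.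
set b := (r * x * u - q * (x * v + y * u) + p * y * v) / D.
set g := D' / D.
have g0 : 0 < g by rewrite divr_gt0.
set k := (Num.sqrt (2 * pi))^-1 * (Num.sqrt D)^-1.
have k0 : 0 <= k by rewrite mulr_ge0// invr_ge0 sqrtr_ge0.
have E s : gauss1 s * plane_gauss p q r (x - s * u) (y - s * v) =
    k * expR (- ((a - 2 * b * s + g * s ^+ 2) / 2)).
  rewrite /gauss1 /plane_gauss mulrACA -expRD; congr (_ * expR _).
  by rewrite /a /b /g D'E -/D; field; rewrite gt_eqF.
under eq_integral => s _ do rewrite E EFinM.
rewrite ge0_integralZl//; last first.
  apply/measurable_EFinP; apply: measurableT_comp => //; apply: measurableT_comp => //.
  apply: measurable_funM => //; apply: measurable_funD; last exact: measurable_funM.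
  by apply: measurable_funB => //; exact: measurable_funM.
rewrite integral_gauss_quad// -EFinM; congr (_%:E).
rewrite /plane_gauss -/D' mulrA; congr (_ * expR _).
  rewrite /k (_ : 2 * pi / g = 2 * pi * D / D'); last first.
    by rewrite /g; field; rewrite !gt_eqF.
  have pp : 0 < 2 * pi :> R by rewrite mulr_gt0// pi_gt0.
  have ppD : 0 <= 2 * pi * D by rewrite mulr_ge0 ?(ltW pp) ?(ltW D0).
  rewrite (sqrtrM _ ppD) (sqrtrM _ (ltW pp)) (sqrtrV (ltW D0')).
  by field; rewrite !gt_eqF ?sqrtr_gt0.
rewrite /a /b /g D'E; congr (- (_ / 2)).
have : D + (r * u ^+ 2 - 2 * q * u * v + p * v ^+ 2) != 0 by rewrite -D'E gt_eqF.
rewrite /D => ?; field.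
by apply/andP; split=> //; rewrite gt_eqF.
Qed.

Lemma measurable_plane_gauss d (T : measurableType d) p q r (f g : T -> R) :
  measurable_fun setT f -> measurable_fun setT g ->
  measurable_fun setT (fun t => plane_gauss p q r (f t) (g t)).
Proof.
move=> mf mg; rewrite /plane_gauss.
apply: measurable_funM => //; apply: measurableT_comp => //.
apply: measurableT_comp => //; apply: measurable_funM => //; apply: measurable_funM => //.
apply: measurable_funD; first apply: measurable_funB.
- by apply: measurable_funM => //; exact: measurable_funX.
- by apply: measurable_funM => //; exact: measurable_funM.
- by apply: measurable_funM => //; exact: measurable_funX.
Qed.

(** Iterating [integral_plane_gauss]: the coordinates of a standard Gaussian vector
    contribute independent rank-one terms to the covariance. *)
Lemma integral_tuple_plane_gauss n (u v : 'I_n -> R) p q r x y : posdef2 p q r ->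
  (\int[tuple_measure mu n]_t
     (gaussn t * plane_gauss p q r (x - \sum_j tnth t j * u j) (y - \sum_j tnth t j * v j))%:E =
  (plane_gauss (p + \sum_j u j ^+ 2) (q + \sum_j u j * v j) (r + \sum_j v j ^+ 2) x y)%:E)%E
  /\ posdef2 (p + \sum_j u j ^+ 2) (q + \sum_j u j * v j) (r + \sum_j v j ^+ 2).
Proof.
elim: n u v x y => [|n IH] u v x y pd.
  rewrite !big_ord0 !addr0; split=> //.
  rewrite integral_dirac//; last first.
    apply/measurable_EFinP; apply: measurable_funM; first exact: measurable_gaussn.
    by apply: measurable_plane_gauss; exact: measurable_tuple_affine.
  rewrite diracT mul1e /gaussn !big_ord0 !subr0 mul1r//.
pose u' j := u (lift ord0 j); pose v' j := v (lift ord0 j).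
have [_ pd'] := IH u' v' x y pd.
rewrite integral_tuple_cons; last 2 first.
- apply/measurable_EFinP; apply: measurable_funM; first exact: measurable_gaussn.
  by apply: measurable_plane_gauss; exact: measurable_tuple_affine.
- by move=> t; rewrite lee_fin mulr_ge0 ?gaussn_ge0 ?plane_gauss_ge0.
rewrite !big_ord_recl !(addrC (u ord0 ^+ 2)) !(addrC (v ord0 ^+ 2)) !(addrC (u ord0 * v ord0)) !addrA.
split; last exact: posdef2D.
rewrite -integral_plane_gauss//; apply: eq_integral => s _.
transitivity ((gauss1 s)%:E * \int[tuple_measure mu n]_t
   (gaussn t * plane_gauss p q r (x - s * u ord0 - \sum_j tnth t j * u' j)
      (y - s * v ord0 - \sum_j tnth t j * v' j))%:E)%E; last first.
  by have [-> _] := IH u' v' (x - s * u ord0) (y - s * v ord0) pd.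
rewrite -ge0_integralZl//; last 3 first.
- apply/measurable_EFinP; apply: measurable_funM; first exact: measurable_gaussn.
  by apply: measurable_plane_gauss; exact: measurable_tuple_affine.
- by move=> t _; rewrite lee_fin mulr_ge0 ?gaussn_ge0 ?plane_gauss_ge0.
- by rewrite lee_fin ltW// gauss1_gt0.
apply: eq_integral => t _; rewrite gaussn_cons -EFinM.
have Es (w : 'I_n.+1 -> R) c : c - \sum_j tnth [tuple of s :: t] j * w j =
    c - s * w ord0 - \sum_j tnth t j * w (lift ord0 j).
  rewrite big_ord_recl tnth0 opprD addrA; congr (_ - _).
  by apply: eq_bigr => j _; rewrite tnthS.
by rewrite !Es -mulrA.
Qed.

End gaussian_integral.

(** * The Gaussian measure of C^n *)

Section gaussian_space.
Context {R : realType} {n : nat}.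
Local Notation coords := (n.-tuple (measurableTypeR R) * n.-tuple (measurableTypeR R))%type.
Implicit Types (x z q : 'rV[R[i]]_n) (p : coords) (la t c : R).

Lemma sqr_enorm_ReIm z : enorm z ^+ 2 = \sum_j (Re (z 0 j) ^+ 2 + Im (z 0 j) ^+ 2).
Proof. by rewrite sqr_enorm; apply: eq_bigr => j _; rewrite sqr_cabs. Qed.

Lemma Re_cvec p j : Re (cvec p 0 j) = tnth p.1 j. Proof. by rewrite mxE. Qed.
Lemma Im_cvec p j : Im (cvec p 0 j) = tnth p.2 j. Proof. by rewrite mxE. Qed.

Lemma measurable_tnth1 j : measurable_fun setT (fun p : coords => tnth p.1 j).
Proof.
apply: (@measurableT_comp _ _ _ _ _ _ (fun s : n.-tuple (measurableTypeR R) => tnth s j)).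
  exact: measurable_tnth.
exact: measurable_fst.
Qed.

Lemma measurable_tnth2 j : measurable_fun setT (fun p : coords => tnth p.2 j).
Proof.
apply: (@measurableT_comp _ _ _ _ _ _ (fun s : n.-tuple (measurableTypeR R) => tnth s j)).
  exact: measurable_tnth.
exact: measurable_snd.
Qed.

Lemma measurable_sqr_enorm x :
  measurable_fun setT (fun p : coords => enorm (x - cvec p) ^+ 2).
Proof.
rewrite (_ : (fun _ => _) = fun p : coords =>
  \sum_j ((Re (x 0 j) - tnth p.1 j) ^+ 2 + (Im (x 0 j) - tnth p.2 j) ^+ 2)); last first.
  apply/funext => p; rewrite sqr_enorm_ReIm; apply: eq_bigr => j _.
  by rewrite !mxE ReD ImD ReN ImN.
apply: measurable_sum => j; apply: measurable_funD; apply: measurable_funX.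
  by apply: measurable_funB => //; exact: measurable_tnth1.
by apply: measurable_funB => //; exact: measurable_tnth2.
Qed.

Lemma measurable_enorm x : measurable_fun setT (fun p : coords => enorm (x - cvec p)).
Proof.
rewrite (_ : (fun _ => _) = fun p : coords => Num.sqrt (enorm (x - cvec p) ^+ 2)); last first.
  by apply/funext => p; rewrite sqrtr_sqr ger0_norm ?enorm_ge0.
apply: (@measurableT_comp _ _ _ _ _ _ (@Num.sqrt R)); last exact: measurable_sqr_enorm.
by apply: continuous_measurable_fun; exact: sqrt_continuous.
Qed.

Lemma gauss_density_cvec p : gauss_density (cvec p) = gaussn p.1 * gaussn p.2.
Proof.
rewrite /gauss_density sqr_enorm_ReIm /gaussn -big_split/= /gauss1.
rewrite [RHS](eq_bigr (fun j => (2 * pi)^-1 * expR (- ((tnth p.1 j ^+ 2 + tnth p.2 j ^+ 2) / 2)))); last first.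
  move=> j _; rewrite mulrACA -expRD; congr (_ * expR _); last by field.
  by rewrite -invfM -expr2 sqr_sqrtr// mulr_ge0 ?pi_ge0.
rewrite [RHS]big_split/= prodr_const card_ord exprVn; congr (_ * _).
rewrite -expR_sum; congr expR.
rewrite mulr_suml -sumrN; apply: eq_bigr => j _.
by rewrite Re_cvec Im_cvec.
Qed.

Lemma measurable_gauss_density : measurable_fun setT (fun p : coords => gauss_density (cvec p)).
Proof.
rewrite (_ : (fun _ => _) = fun p : coords => gaussn p.1 * gaussn p.2); last first.
  by apply/funext => p; rewrite gauss_density_cvec.
apply: measurable_funM.
  by apply: (@measurableT_comp _ _ _ _ _ _ (@gaussn R n)); [exact: measurable_gaussn|exact: measurable_fst].
by apply: (@measurableT_comp _ _ _ _ _ _ (@gaussn R n)); [exact: measurable_gaussn|exact: measurable_snd].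
Qed.

Lemma gauss_density_ge0 z : 0 <= gauss_density z.
Proof. by rewrite /gauss_density mulr_ge0 ?expR_ge0// invr_ge0 exprn_ge0// mulr_ge0// pi_ge0. Qed.

Definition hdot z q : R[i] := \sum_j z 0 j * (q 0 j)^*.

Lemma plane_gauss_scalar la (x y : R) : 0 < la ->
  plane_gauss (la *+ 2)^-1 0 (la *+ 2)^-1 x y = la *+ 2 * expR (- (la * (x ^+ 2 + y ^+ 2))).
Proof.
move=> la0; have l2 : 0 < la *+ 2 by rewrite mulrn_wgt0.
rewrite /plane_gauss expr0n/= subr0 -expr2 sqrtr_sqr gtr0_norm ?invr_gt0// invrK.
by congr (_ * expR _); rewrite -(mulr_natr la); field; rewrite gt_eqF.
Qed.

(** A unit vector [q] pushes the Gaussian measure of [C^n] to that of [C]: the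
    real and imaginary parts of the coordinates are integrated one after the
    other with [integral_tuple_plane_gauss], and their covariances add up to the
    identity matrix. *)
Lemma integral_hdot_gauss la q (c : R[i]) : 0 < la -> enorm q = 1 ->
  (\int[@lebesgue_cvec R n]_p
     (expR (- (la * cabs (c - hdot (cvec p) q) ^+ 2)) * gauss_density (cvec p))%:E =
  ((1 + 2 * la)^-1 * expR (- (la / (1 + 2 * la) * cabs c ^+ 2)))%:E)%E.
Proof.
move=> la0 q1; have l2 : 0 < la *+ 2 by rewrite mulrn_wgt0.
pose p0 := (la *+ 2)^-1.
have p00 : 0 < p0 by rewrite invr_gt0.
have pd0 : posdef2 p0 0 p0 by rewrite /posdef2 p00 expr0n/= subr0 mulr_gt0.
pose u j := Re (q 0 j); pose v j := Im (q 0 j).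
have uv1 : \sum_j u j ^+ 2 + \sum_j v j ^+ 2 = 1.
  by rewrite -big_split/= -sqr_enorm_ReIm q1 expr1n.
pose w1 p := Re c - \sum_j tnth p.1 j * u j - \sum_j tnth p.2 j * v j.
pose w2 p := Im c - \sum_j tnth p.1 j * - v j - \sum_j tnth p.2 j * u j.
have cw p : cabs (c - hdot (cvec p) q) ^+ 2 = w1 p ^+ 2 + w2 p ^+ 2.
  rewrite sqr_cabs ReD ImD ReN ImN.
  have ReS (F : 'I_n -> R[i]) : Re (\sum_j F j) = \sum_j Re (F j).
    by elim/big_rec2 : _ => //= i a b _ <-; rewrite ReD.
  have ImS (F : 'I_n -> R[i]) : Im (\sum_j F j) = \sum_j Im (F j).
    by elim/big_rec2 : _ => //= i a b _ <-; rewrite ImD.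
  rewrite /hdot ReS ImS /w1 /w2 -!addrA -!opprD -!big_split/=.
  congr ((_ - _) ^+ 2 + (_ - _) ^+ 2); apply: eq_bigr => j _.
    rewrite ReM Re_cvec Im_cvec /u /v; case: (q 0 j) => a b /=; ring.
  rewrite ImM Re_cvec Im_cvec /u /v; case: (q 0 j) => a b /=; ring.
transitivity (\int[tuple_measure lebesgue_measure n]_a \int[tuple_measure lebesgue_measure n]_b
  ((p0 * gaussn a) * (gaussn b * plane_gauss p0 0 p0 (w1 (a, b)) (w2 (a, b))))%:E)%E.
  rewrite /lebesgue_cvec fubini_tonelli1; last 2 first.
  - apply/measurable_EFinP; apply: measurable_funM; last exact: measurable_gauss_density.
    apply: measurableT_comp => //; apply: measurableT_comp => //; apply: measurable_funM => //.
    rewrite (_ : (fun _ => _) = fun p => w1 p ^+ 2 + w2 p ^+ 2); last exact/funext.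
    apply: measurable_funD; apply: measurable_funX; apply: measurable_funB.
    - apply: measurable_funB => //; apply: measurable_sum => j.
      by apply: measurable_funM => //; exact: measurable_tnth1.
    - apply: measurable_sum => j.
      by apply: measurable_funM => //; exact: measurable_tnth2.
    - apply: measurable_funB => //; apply: measurable_sum => j.
      by apply: measurable_funM => //; exact: measurable_tnth1.
    - apply: measurable_sum => j.
      by apply: measurable_funM => //; exact: measurable_tnth2.
  - by move=> p; rewrite lee_fin mulr_ge0 ?expR_ge0 ?gauss_density_ge0.
  apply: eq_integral => a _; apply: eq_integral => b _; congr _%:E.
  rewrite gauss_density_cvec cw plane_gauss_scalar// /p0/=.
  by field; rewrite gt_eqF.
pose P1 := p0 + \sum_j v j ^+ 2; pose Q1 := 0 + \sum_j v j * u j; pose R1 := p0 + \sum_j u j ^+ 2.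
have pd1 : posdef2 P1 Q1 R1.
  by have [_ ] := @integral_tuple_plane_gauss R n v u p0 0 p0 0 0 pd0.
transitivity (\int[tuple_measure lebesgue_measure n]_a
  (p0 * (gaussn a * plane_gauss P1 Q1 R1 (Re c - \sum_j tnth a j * u j) (Im c - \sum_j tnth a j * - v j)))%:E)%E.
  apply: eq_integral => a _.
  have [E _] := @integral_tuple_plane_gauss R n v u p0 0 p0 (Re c - \sum_j tnth a j * u j)
     (Im c - \sum_j tnth a j * - v j) pd0.
  under eq_integral => b _ do rewrite EFinM.
  rewrite ge0_integralZl//; last 3 first.
  - apply/measurable_EFinP; apply: measurable_funM; first exact: measurable_gaussn.
    by apply: measurable_plane_gauss; rewrite /w1 /w2 /=; exact: measurable_tuple_affine.
  - by move=> b _; rewrite lee_fin mulr_ge0 ?gaussn_ge0 ?plane_gauss_ge0.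
  - by rewrite lee_fin mulr_ge0 ?gaussn_ge0 ?(ltW p00).
  by rewrite [p0 * (_ * _)]mulrA [RHS]EFinM; congr (_ * _)%E; exact: E.
have [E _] := @integral_tuple_plane_gauss R n u (fun j => - v j) P1 Q1 R1 (Re c) (Im c) pd1.
under eq_integral => a _ do rewrite EFinM.
rewrite ge0_integralZl//; last 3 first.
- apply/measurable_EFinP; apply: measurable_funM; first exact: measurable_gaussn.
  by apply: measurable_plane_gauss; exact: measurable_tuple_affine.
- by move=> a _; rewrite lee_fin mulr_ge0 ?gaussn_ge0 ?plane_gauss_ge0.
- by rewrite lee_fin ltW.
rewrite E -EFinM; congr _%:E.
have -> : P1 + \sum_j u j ^+ 2 = p0 + 1 by rewrite /P1 -addrA (addrC (\sum_j v j ^+ 2)) uv1.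
have -> : Q1 + \sum_j u j * - v j = 0.
  rewrite /Q1 add0r -big_split/= big1// => j _; ring.
have -> : R1 + \sum_j (- v j) ^+ 2 = p0 + 1.
  by rewrite /R1 -addrA; congr (_ + _); rewrite -[RHS]uv1; congr (_ + _); apply: eq_bigr => j _; rewrite sqrrN.
pose la' := (p0 + 1)^-1 / 2.
have la'0 : 0 < la' by rewrite divr_gt0// invr_gt0 addr_gt0.
have -> : p0 + 1 = (la' *+ 2)^-1.
  by rewrite -(mulr_natr la') /la' divfK// invrK.
rewrite plane_gauss_scalar// -sqr_cabs mulrA.
have l1 : 0 < 1 + 2 * la by rewrite addr_gt0// mulr_gt0.
have p01 : p0 + 1 = (1 + 2 * la) / (2 * la).
  by rewrite /p0 -(mulr_natl la); field; rewrite gt_eqF.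
have la'E : la' = la / (1 + 2 * la).
  by rewrite /la' p01; field; rewrite !gt_eqF.
rewrite la'E; congr (_ * _).
by rewrite /p0 -(mulr_natl la) -(mulr_natl (la / _)); field; rewrite !gt_eqF.
Qed.

(** The set where [g < a] is the union of the balls of radius [a - g q] around the
    points [q] with rational coordinates. *)
Lemma measurable_lipschitz (g : 'rV[R[i]]_n -> R) :
  (forall x y, g x - g y <= enorm (x - y)) ->
  measurable_fun setT (fun p : coords => g (cvec p)).
Proof.
move=> gL mD; apply: (measurability _ (RGenInftyO.measurableE R)) => //.
move=> _ [_ [a ->] <-]; rewrite setTI.
pose pt (q : {ffun 'I_n -> rat} * {ffun 'I_n -> rat}) : 'rV[R[i]]_n :=
  \row_j (ratr (q.1 j) +i* ratr (q.2 j)).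
rewrite (_ : _ @^-1` _ = \bigcup_q [set p : coords | enorm (pt q - cvec p) < a - g (pt q)]).
  apply: countable_bigcupT_measurable; first exact: countableP.
  move=> q; rewrite -[X in measurable X]setTI.
  exact: (measurable_fun_ltr (measurable_enorm (pt q))).
apply/seteqP; split=> p /=; rewrite in_itv/=.
  move=> ga; pose e := (a - g (cvec p)) / 4 / n.+1%:R.
  have e0 : 0 < e by rewrite !divr_gt0// subr_gt0.
  have ap (s : R) : exists r : rat, `|ratr r - s| < e.
    have : s - e < s + e by lra.
    move=> /rat_in_itvoo[r]; rewrite in_itv/= => /andP[r1 r2]; exists r.
    by rewrite ltr_norml; lra.
  have [q1 q1P] := fin_all_exists (fun j => ap (tnth p.1 j)).
  have [q2 q2P] := fin_all_exists (fun j => ap (tnth p.2 j)).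
  exists ([ffun j => q1 j], [ffun j => q2 j]) => //=.
  set q := pt _.
  have qp : enorm (q - cvec p) < (a - g (cvec p)) / 2.
    apply: (@le_lt_trans _ _ (n%:R * (e + e))).
      apply: enorm_le => j; apply: le_trans (cabs_le_ReIm _) _.
      rewrite !mxE/= !ffunE; apply/ltW; exact: ltrD.
    have -> : (a - g (cvec p)) / 2 = n.+1%:R * (e + e).
      have : n.+1%:R != 0 :> R by rewrite pnatr_eq0.
      by rewrite /e; move: (n.+1%:R : R) => N N0; field.
    by rewrite ltr_pM2r ?ltr_nat// addr_gt0.
  have := gL q (cvec p); lra.
move=> [q _ /=] H; have := gL (cvec p) (pt q); rewrite enormB; lra.
Qed.

End gaussian_space.

(** * Heat evolution of radial sums of Gaussian functions *)

Section gaussian_sums.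
Context {R : realType} {I : finType}.
Notation mu := (@lebesgue_measure R).
Implicit Types (D l : I -> R) (s t x y tau : R).

(** In each real dimension, the heat flow multiplies the Gaussian function
    [expR (- l * y ^+ 2)] by the square root of this factor, and its exponent by
    the factor itself. *)
Definition heat_factor (l t : R) : R := (1 + 2 * l * t)^-1.

Lemma heat_factor_gt0 (l t : R) : 0 < l -> 0 <= t -> 0 < heat_factor l t.
Proof. by move=> l0 t0; rewrite invr_gt0 ltr_wpDr// !mulr_ge0// ltW. Qed.

Lemma integral_gauss_heat (l t x : R) : 0 < l -> 0 < t ->
  (\int[mu]_y (expR (- (l * y ^+ 2)) * expR (- ((x - y) ^+ 2 / t / 2)))%:E =
  (Num.sqrt (2 * pi * t) *
    (Num.sqrt (heat_factor l t) * expR (- (l * heat_factor l t * x ^+ 2))))%:E)%E.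
Proof.
move=> l0 t0; have g0 : 0 < 2 * l + t^-1 by rewrite addr_gt0 ?invr_gt0 ?mulr_gt0.
have h0 : 0 < 1 + 2 * l * t by rewrite addr_gt0// !mulr_gt0.
have E y : expR (- (l * y ^+ 2)) * expR (- ((x - y) ^+ 2 / t / 2)) =
    expR (- ((x ^+ 2 / t - 2 * (x / t) * y + (2 * l + t^-1) * y ^+ 2) / 2)).
  by rewrite -expRD; congr expR; field; rewrite gt_eqF.
under eq_integral => y _ do rewrite E.
rewrite integral_gauss_quad//; congr (_%:E); rewrite mulrA; congr (_ * expR _).
  rewrite -sqrtrM; last by rewrite !mulr_ge0 ?pi_ge0// ltW.
  by congr Num.sqrt; rewrite /heat_factor; field; rewrite !gt_eqF// addrC.
by rewrite /heat_factor; field; rewrite !gt_eqF.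
Qed.

(** The sum is, up to a positive constant, the integral of the nonnegative
    hypothesis against a Gaussian weight centered at [x]. *)
Lemma gauss_sum_heat D l t x : (forall j, 0 < l j) -> 0 <= t ->
  (forall y, 0 <= \sum_j D j * expR (- (l j * y ^+ 2))) ->
  0 <= \sum_j D j * (Num.sqrt (heat_factor (l j) t) * expR (- (l j * heat_factor (l j) t * x ^+ 2))).
Proof.
move=> l0; rewrite le_eqVlt => /predU1P[<-|t0] H.
  apply: le_trans (H x) _; rewrite le_eqVlt; apply/orP; left; apply/eqP/eq_bigr => j _.
  by rewrite /heat_factor mulr0 addr0 invr1 sqrtr1 mul1r mulr1.
pose k y := expR (- ((x - y) ^+ 2 / t / 2)).
pose Dp j := Num.max (D j) 0; pose Dn j := Num.max (- D j) 0.
have Dpn j : D j = Dp j - Dn j.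
  by rewrite /Dp /Dn; case: (leP (D j) 0) => d0; case: leP => d1; lra.
have Dp0 j : 0 <= Dp j by rewrite le_max lexx orbT.
have Dn0 j : 0 <= Dn j by rewrite le_max lexx orbT.
have c0 : 0 < Num.sqrt (2 * pi * t) by rewrite sqrtr_gt0 !mulr_gt0// pi_gt0.
have mk j : measurable_fun setT (fun y : measurableTypeR R => expR (- (l j * y ^+ 2)) * k y).
  apply: measurable_funM.
    by apply: measurableT_comp => //; apply: measurableT_comp => //; exact: measurable_funM.
  apply: measurableT_comp => //; apply: measurableT_comp => //; apply: measurable_funM => //.
  apply: measurable_funM => //; apply: measurable_funX; exact: measurable_funB.
have intE (E : I -> R) : (forall j, 0 <= E j) ->
    (\int[mu]_y (\sum_j E j * (expR (- (l j * y ^+ 2)) * k y))%:E =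
    (Num.sqrt (2 * pi * t) * \sum_j E j * (Num.sqrt (heat_factor (l j) t) *
       expR (- (l j * heat_factor (l j) t * x ^+ 2))))%:E)%E.
  move=> E0; under eq_integral => y _ do rewrite -sumEFin.
  rewrite ge0_integral_sum//; last 2 first.
  - by move=> j; apply/measurable_EFinP; exact: measurable_funM.
  - by move=> j y _; rewrite lee_fin !mulr_ge0 ?expR_ge0.
  rewrite mulr_sumr -sumEFin; apply: eq_bigr => j _.
  under eq_integral => y _ do rewrite EFinM.
  rewrite ge0_integralZl//; last 3 first.
  - exact/measurable_EFinP.
  - by move=> y _; rewrite lee_fin mulr_ge0 ?expR_ge0.
  - by rewrite lee_fin.
  by rewrite integral_gauss_heat// -EFinM mulrCA.
have : (\int[mu]_y (\sum_j Dn j * (expR (- (l j * y ^+ 2)) * k y))%:E <=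
        \int[mu]_y (\sum_j Dp j * (expR (- (l j * y ^+ 2)) * k y))%:E)%E.
  have ms (E : I -> R) : measurable_fun setT (fun y : measurableTypeR R => (\sum_j E j * (expR (- (l j * y ^+ 2)) * k y))%:E).
    by apply/measurable_EFinP; apply: measurable_sum => j; exact: measurable_funM.
  apply: ge0_le_integral => //.
    by move=> y _; rewrite lee_fin sumr_ge0// => j _; rewrite !mulr_ge0 ?expR_ge0.
  move=> y _; rewrite lee_fin -subr_ge0 -sumrB.
  rewrite (eq_bigr (fun j => D j * expR (- (l j * y ^+ 2)) * k y)); last first.
    by move=> j _; rewrite Dpn; ring.
  by rewrite -mulr_suml mulr_ge0 ?expR_ge0.
rewrite !intE// lee_fin ler_pM2l// -subr_ge0 -sumrB.
by congr (0 <= _); apply: eq_bigr => j _; rewrite Dpn; ring.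
Qed.

(** Four applications of [gauss_sum_heat], one for each real dimension: the heat
    flow in dimension four preserves positivity. *)
Lemma gauss_sum_heat4 D l t tau : (forall j, 0 < l j) -> 0 <= t -> 0 <= tau ->
  (forall s, 0 <= s -> 0 <= \sum_j D j * expR (- (l j * s))) ->
  0 <= \sum_j D j * heat_factor (l j) t ^+ 2 * expR (- (l j * heat_factor (l j) t * tau)).
Proof.
move=> l0 t0 tau0 H0.
pose pos (E : I -> R) := forall s, 0 <= s -> 0 <= \sum_j E j * expR (- (l j * s)).
have step (E : I -> R) x : pos E ->
    pos (fun j => E j * (Num.sqrt (heat_factor (l j) t) * expR (- (l j * heat_factor (l j) t * x ^+ 2)))).
  move=> HE s s0.
  have := @gauss_sum_heat (fun j => E j * expR (- (l j * s))) l t x l0 t0.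
  have E1 y : \sum_j E j * expR (- (l j * s)) * expR (- (l j * y ^+ 2)) =
     \sum_j E j * expR (- (l j * (s + y ^+ 2))).
    by apply: eq_bigr => j _; rewrite -mulrA -expRD; congr (_ * expR _); ring.
  have E2 : forall y, 0 <= \sum_j E j * expR (- (l j * s)) * expR (- (l j * y ^+ 2)).
    by move=> y; rewrite E1; apply: HE; rewrite addr_ge0 ?sqr_ge0.
  move=> /(_ E2); congr (0 <= _); apply: eq_bigr => j _; ring.
have := step _ 0 (step _ 0 (step _ 0 (step _ (Num.sqrt tau) H0))) 0 (lexx 0).
congr (0 <= _); apply: eq_bigr => j _.
rewrite expr0n/= !mulr0 oppr0 expR0 sqr_sqrtr// !mulr1.
have h0 := heat_factor_gt0 (l0 j) t0.
have hh : heat_factor (l j) t = Num.sqrt (heat_factor (l j) t) ^+ 2 by rewrite sqr_sqrtr// ltW.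
have -> : heat_factor (l j) t ^+ 2 = Num.sqrt (heat_factor (l j) t) ^+ 4.
  by rewrite [X in X ^+ 2]hh -exprM.
ring.
Qed.

End gaussian_sums.

Section taylor.
Context {R : realType}.
Implicit Types (F G : R -> R) (x s e r : R).

Lemma is_derive_bigsum (M : nat) (h : 'I_M -> R -> R) (dh : 'I_M -> R) x :
  (forall j, is_derive x 1 (h j) (dh j)) ->
  is_derive x 1 (fun y => \sum_j h j y) (\sum_j dh j).
Proof.
by move=> /is_derive_sum; congr is_derive; apply/funext => y; rewrite fct_sumE.
Qed.

Lemma mvt_bound G G' r : (forall s, is_derive s 1 G (G' s)) -> G 0 = 0 ->
  forall e, (forall s, `|s| < r -> `|G' s| <= e * `|s|) ->
  forall s, `|s| < r -> `|G s| <= e * s ^+ 2.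
Proof.
move=> dG G0 e HG s sr.
have cG a b : {within `[a, b], continuous G}.
  by apply: derivable_within_continuous => x _; have [] := dG x.
have e0 : 0 <= e * `|s| by apply: le_trans (HG s sr).
have bnd c : `|c| < `|s| -> `|G' c| <= e * `|s|.
  move=> cs; apply: le_trans (HG c (lt_trans cs sr)) _.
  have s0 : 0 < `|s| by exact: le_lt_trans cs.
  have {}e0 : 0 <= e by move: e0; rewrite pmulr_lge0.
  by rewrite ler_wpM2l// ltW.
rewrite -real_normK ?num_real// expr2 mulrA.
have [s0|s0|->] := ltgtP s 0; last by rewrite G0 !normr0 mulr0.
  have [c] := MVT s0 (fun x _ => dG x) (cG _ _); rewrite in_itv/= G0 sub0r => /andP[c1 c2] E.
  rewrite -normrN E normrM sub0r normrN ler_wpM2r//; apply: bnd.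
  by rewrite !ltr0_norm// ltrN2.
have [c] := MVT s0 (fun x _ => dG x) (cG _ _); rewrite in_itv/= G0 subr0 => /andP[c1 c2] ->.
by rewrite subr0 normrM ler_wpM2r//; apply: bnd; rewrite !gtr0_norm.
Qed.

Lemma taylor2 F F1 (F2 : R) : (forall s, is_derive s 1 F (F1 s)) -> is_derive (0 : R) 1 F1 F2 ->
  forall e, 0 < e -> exists2 r : R, 0 < r & forall s, `|s| < r ->
    `|F s - F 0 - F1 0 * s - F2 / 2 * s ^+ 2| <= e * s ^+ 2.
Proof.
move=> dF dF1 e e0; have [r r0 H] := is_derive_eps dF1 e0.
exists r => // s sr.
apply: (@mvt_bound (fun s => F s - F 0 - F1 0 * s - F2 / 2 * s ^+ 2)
                   (fun s => F1 s - F1 0 - F2 * s) r) => //.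
- move=> x; apply: is_derive_eq; rewrite /GRing.scale/=; by field.
- by rewrite expr0n/= !mulr0 !subr0 subrr.
- by move=> x xr; have := H x xr; rewrite add0r.
Qed.

End taylor.

Section theta.
Context {R : realType} {M : nat} (c la : 'I_M -> R).
Hypothesis la_gt0 : forall j, 0 < la j.
Implicit Types (s t tau e : R).

Local Notation th j t := (heat_factor (la j) t).

(** [theta t] is the heat extension at time [t], in the complex plane, of
    [theta 0 = \sum_j c j * expR (- la j * tau)], as a function of the square
    [tau] of the modulus; [theta1] and [theta2] are its derivatives in [tau]. *)
Definition theta t tau := \sum_j c j * th j t * expR (- (la j * th j t * tau)).
Definition theta1 t tau := \sum_j - (c j * la j * th j t ^+ 2 * expR (- (la j * th j t * tau))).
Definition theta2 t tau := \sum_j c j * la j ^+ 2 * th j t ^+ 3 * expR (- (la j * th j t * tau)).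

Lemma is_derive_theta t tau : is_derive tau 1 (theta t) (theta1 t tau).
Proof.
apply: is_derive_bigsum => j; apply: is_derive_eq.
by rewrite /GRing.scale/=; ring.
Qed.

Lemma is_derive_theta1 t tau : is_derive tau 1 (theta1 t) (theta2 t tau).
Proof.
apply: is_derive_bigsum => j; apply: is_derive_eq.
by rewrite /GRing.scale/=; ring.
Qed.

Lemma is_derive_heat_factor l t : 0 < l -> 0 <= t ->
  is_derive t 1 (heat_factor l) (- 2 * l * heat_factor l t ^+ 2).
Proof.
move=> l0 t0; have h0 : 0 < 1 + 2 * l * t by rewrite ltr_wpDr// !mulr_ge0// ltW.
have D : is_derive t 1 (fun y => 1 + 2 * l * y) (2 * l).
  by apply: is_derive_eq; rewrite /GRing.scale/=; ring.
apply: (is_derive_eq (@is_deriveV R (fun y => 1 + 2 * l * y) t (2 * l) 1 (lt0r_neq0 h0) D)).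
by rewrite /heat_factor /GRing.scale/= exprVn; ring.
Qed.

(** The right hand side is half the Laplacian of a radial function on the plane,
    in terms of the squared modulus [tau]. *)
Lemma is_derive_theta_time t tau : 0 <= t ->
  is_derive t 1 (fun s => theta s tau) (2 * (tau * theta2 t tau + theta1 t tau)).
Proof.
move=> t0.
have dj j : is_derive t 1 (fun s => c j * th j s * expR (- (la j * th j s * tau)))
  (2 * (tau * (c j * la j ^+ 2 * th j t ^+ 3 * expR (- (la j * th j t * tau))) -
        c j * la j * th j t ^+ 2 * expR (- (la j * th j t * tau)))).
  have D := is_derive_heat_factor (la_gt0 j) t0.
  apply: is_derive_eq; rewrite /GRing.scale/=; ring.
apply: is_derive_eq (is_derive_bigsum dj) _.
by rewrite /theta2 /theta1 mulr_sumr -big_split/= mulr_sumr.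
Qed.

Lemma theta_taylor1 t tau e : 0 < e -> exists2 r : R, 0 < r & forall s, `|s| < r ->
  `|theta t (tau + s) - theta t tau - theta1 t tau * s| <= e * `|s|.
Proof. exact: is_derive_eps (is_derive_theta t tau) e. Qed.

(** The second derivative at [s = 0] is twice [tau] times the time derivative of
    [theta]; this is how the heat equation enters [line_touch]. *)
Lemma theta_taylor2 t tau e : 0 < e -> exists2 r : R, 0 < r & forall s, `|s| < r ->
  `|theta t (tau * expR (2 * s)) - theta t tau - 2 * tau * theta1 t tau * s -
    4 * tau * (tau * theta2 t tau + theta1 t tau) / 2 * s ^+ 2| <= e * s ^+ 2.
Proof.
move=> e0.
have D0 s : is_derive s 1 (fun s => tau * expR (2 * s)) (2 * tau * expR (2 * s)).
  by apply: is_derive_eq; rewrite /GRing.scale/=; ring.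
have D1 s : is_derive s 1 (fun s => theta t (tau * expR (2 * s)))
    (2 * tau * expR (2 * s) * theta1 t (tau * expR (2 * s))).
  apply: (is_derive_eq (@is_derive1_comp R (theta t) (fun s => tau * expR (2 * s)) s _ _
    (is_derive_theta t (tau * expR (2 * s))) (D0 s))).
  by rewrite mulrC.
have D2 : is_derive (0 : R) 1 (fun s => 2 * tau * expR (2 * s) * theta1 t (tau * expR (2 * s)))
    (4 * tau * (tau * theta2 t tau + theta1 t tau)).
  have D3 : is_derive (0 : R) 1 (fun s => theta1 t (tau * expR (2 * s))) _ :=
    @is_derive1_comp R (theta1 t) (fun s => tau * expR (2 * s)) 0 _ _
      (is_derive_theta1 t (tau * expR (2 * 0))) (D0 0).
  apply: is_derive_eq; rewrite /GRing.scale/= mulr0 expR0 !mulr1; ring.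
have [r r0 H] := taylor2 D1 D2 e0; exists r => // s /H.
by rewrite mulr0 expR0 !mulr1.
Qed.

Lemma theta_bound t tau : 0 <= t -> 0 <= tau -> `|theta t tau| <= \sum_j `|c j|.
Proof.
move=> t0 tau0; apply: le_trans (ler_norm_sum _ _ _) _; apply: ler_sum => j _.
have h0 := heat_factor_gt0 (la_gt0 j) t0.
rewrite !normrM -mulrA ler_piMr// mulr_ile1//.
  rewrite gtr0_norm// invf_le1; first by rewrite lerDl !mulr_ge0// ltW.
  by rewrite ltr_wpDr// !mulr_ge0// ltW.
rewrite ger0_norm ?expR_ge0// -expR0 ler_expR oppr_le0.
by rewrite mulr_ge0// mulr_ge0 ?(ltW h0) ?(ltW (la_gt0 j)).
Qed.

Lemma theta_time_lip T t tau : 0 <= t -> 0 <= tau <= T ->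
  `|theta t tau - theta 0 tau| <= 2 * (T * \sum_j `|c j| * la j ^+ 2 + \sum_j `|c j| * la j) * t.
Proof.
move=> t0 /andP[tau0 tauT].
move: t0; rewrite le_eqVlt => /predU1P[<-|t0]; first by rewrite subrr normr0 mulr0.
have cont : {within `[0, t], continuous (fun s => theta s tau)}.
  apply: derivable_within_continuous => s; rewrite in_itv/= => /andP[s0 _].
  by have [] := is_derive_theta_time tau s0.
have [|s] := MVT t0 _ cont (df := fun s => 2 * (tau * theta2 s tau + theta1 s tau)).
  by move=> s; rewrite in_itv/= => /andP[/ltW s0 _]; exact: is_derive_theta_time.
rewrite in_itv/= => /andP[/ltW s0 _] ->; rewrite subr0 normrM (gtr0_norm t0).
rewrite ler_pM2r// normrM ger0_norm// ler_pM2l//.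
apply: le_trans (ler_normD _ _) _; rewrite normrM (ger0_norm tau0).
have h1 j : 0 < th j s <= 1.
  rewrite heat_factor_gt0//= invf_le1; first by rewrite lerDl !mulr_ge0// ltW.
  by rewrite ltr_wpDr// !mulr_ge0// ltW.
have e1 j : 0 < expR (- (la j * th j s * tau)) <= 1.
  have /andP[h0 _] := h1 j; rewrite expR_gt0/= -expR0 ler_expR oppr_le0.
  by rewrite mulr_ge0// mulr_ge0 ?(ltW h0) ?(ltW (la_gt0 j)).
apply: lerD.
  apply: ler_pM => //; apply: le_trans (ler_norm_sum _ _ _) _; apply: ler_sum => j _.
  have /andP[h0 h11] := h1 j; have /andP[x0 x1] := e1 j.
  rewrite 3!normrM (ger0_norm (sqr_ge0 _)) (gtr0_norm x0) (gtr0_norm (exprn_gt0 _ h0)).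
  rewrite -[leLHS]mulrA; apply: ler_piMr; first by rewrite mulr_ge0 ?sqr_ge0.
  apply: mulr_ile1; rewrite ?(ltW x0)//.
    by rewrite exprn_ge0// ltW.
  by rewrite exprn_ile1// ltW.
apply: le_trans (ler_norm_sum _ _ _) _; apply: ler_sum => j _.
have /andP[h0 h11] := h1 j; have /andP[x0 x1] := e1 j.
rewrite normrN 3!normrM (gtr0_norm (la_gt0 j)) (gtr0_norm x0) (ger0_norm (exprn_ge0 _ (ltW h0))).
rewrite -[leLHS]mulrA; apply: ler_piMr; first by rewrite mulr_ge0 ?(ltW (la_gt0 j)).
apply: mulr_ile1; rewrite ?(ltW x0)//.
  by rewrite exprn_ge0// ltW.
by rewrite exprn_ile1// ltW.
Qed.

(** Strict monotonicity is preserved by the heat flow: [- theta1 t] is the heat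
    extension of [- theta1 0] in two more real dimensions. *)
Lemma theta1_lt0 eta l : 0 < eta -> 0 < l ->
  (forall tau, 0 <= tau -> theta1 0 tau <= - (eta * expR (- (l * tau)))) ->
  forall t tau, 0 <= t -> 0 <= tau -> theta1 t tau < 0.
Proof.
move=> eta0 l0 H t tau t0 tau0.
(* the bound on [theta1 0] is one more exponential, with index [None] *)
pose D (o : option 'I_M) := if o is Some j then c j * la j else - eta.
pose L (o : option 'I_M) := if o is Some j then la j else l.
have big_opt (F : option 'I_M -> R) : \sum_o F o = F None + \sum_j F (Some j).
  rewrite (bigD1 None)//=; congr (_ + _).
  rewrite (reindex_omap Some id)/=; last by case.
  by apply: eq_bigl => j; rewrite eqxx.
have := @gauss_sum_heat4 R (option 'I_M) D L t tau.
rewrite big_opt/= => /(_ _ t0 tau0) K.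
have {K} : 0 <= - eta * heat_factor l t ^+ 2 * expR (- (l * heat_factor l t * tau)) - theta1 t tau.
  rewrite /theta1 sumrN opprK; apply: K; first by case.
  move=> s s0; rewrite big_opt/=.
  have := H s s0; rewrite /theta1 sumrN.
  rewrite (eq_bigr (fun j => c j * la j * expR (- (la j * s)))); last first.
    by move=> j _; rewrite /heat_factor mulr0 addr0 invr1 expr1n !mulr1.
  by rewrite mulNr; lra.
rewrite !mulNr => K.
have : 0 < eta * heat_factor l t ^+ 2 * expR (- (l * heat_factor l t * tau)).
  by rewrite !mulr_gt0 ?expR_gt0 ?exprn_gt0 ?heat_factor_gt0.
lra.
Qed.

Lemma theta_decreasing t : (forall tau, 0 <= tau -> theta1 t tau < 0) ->
  forall s u, 0 <= s -> s <= u -> theta t u <= theta t s.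
Proof.
move=> H s u s0; rewrite le_eqVlt => /predU1P[->//|su].
have cont : {within `[s, u], continuous (theta t)}.
  by apply: derivable_within_continuous => x _; have [] := is_derive_theta t x.
have [x] := MVT su (fun x _ => is_derive_theta t x) cont.
rewrite in_itv/= => /andP[sx _] E; rewrite -subr_le0 E nmulr_rle0; first by rewrite subr_ge0 ltW.
exact/H/ltW/(le_lt_trans s0).
Qed.

End theta.

(** * The heat kernel of C^n *)

Section heat_kernel.
Context {R : realType} {n : nat}.
Local Notation coords := (n.-tuple (measurableTypeR R) * n.-tuple (measurableTypeR R))%type.
Notation mu := (@lebesgue_measure R).
Implicit Types (x z : 'rV[R[i]]_n) (p : coords) (s t r e : R) (j : 'I_n).

Definition heat_kernel t z : R := (2 * pi * t)^-1 ^+ n * expR (- (enorm z ^+ 2 / 2 * t^-1)).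

Lemma heat_kernel_gt0 t z : 0 < t -> 0 < heat_kernel t z.
Proof. by move=> t0; rewrite mulr_gt0 ?expR_gt0// exprn_gt0// invr_gt0 !mulr_gt0// pi_gt0. Qed.

Lemma heat_kernel1 z : heat_kernel 1 z = gauss_density z.
Proof. by rewrite /heat_kernel invr1 !mulr1 exprVn. Qed.

Lemma heat_kernel_le t z : 0 < t -> heat_kernel t z <= (2 * pi * t)^-1 ^+ n.
Proof.
move=> t0; rewrite ler_piMr//.
  by rewrite exprn_ge0// invr_ge0 !mulr_ge0 ?pi_ge0// ltW.
rewrite -expR0 ler_expR oppr_le0 mulr_ge0 ?invr_ge0 ?(ltW t0)//.
by rewrite divr_ge0// sqr_ge0.
Qed.

Lemma measurable_heat_kernel t x :
  measurable_fun setT (fun p : coords => heat_kernel t (x - cvec p)).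
Proof.
apply: measurable_funM => //; apply: measurableT_comp => //; apply: measurableT_comp => //.
apply: measurable_funM => //; apply: measurable_funM => //; exact: measurable_sqr_enorm.
Qed.

(** The kernel is a product of one-dimensional normal densities, of total mass
    one. *)
Lemma integral_tuple_pdf m (a : 'I_m -> R) s :
  (\int[tuple_measure mu m]_t (\prod_j normal_pdf (a j) s (tnth t j))%:E = 1)%E /\
  measurable_fun setT (fun t : m.-tuple (measurableTypeR R) => \prod_j normal_pdf (a j) s (tnth t j)).
Proof.
have mp k (b : 'I_k -> R) : measurable_fun setT
    (fun t : k.-tuple (measurableTypeR R) => \prod_j normal_pdf (b j) s (tnth t j)).
  apply: measurable_prod => j _.
  apply: (@measurableT_comp _ _ _ _ _ _ (normal_pdf (b j) s)); first exact: measurable_normal_pdf.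
  exact: measurable_tnth.
split=> //; elim: m a => [|m IH] a.
  rewrite integral_dirac//; last by apply/measurable_EFinP; exact: mp.
  by rewrite diracT mul1e big_ord0.
rewrite integral_tuple_cons; last 2 first.
- by apply/measurable_EFinP; exact: mp.
- by move=> t; rewrite lee_fin prodr_ge0// => j _; exact: normal_pdf_ge0.
rewrite -[RHS](integral_normal_pdf (a ord0) s); apply: eq_integral => y _.
under eq_integral => t _.
  rewrite big_ord_recl tnth0 EFinM.
  under eq_bigr => j _ do rewrite tnthS.
  over.
rewrite ge0_integralZl//; last 3 first.
- by apply/measurable_EFinP; exact: mp.
- by move=> t _; rewrite lee_fin prodr_ge0// => j _; exact: normal_pdf_ge0.
- by rewrite lee_fin normal_pdf_ge0.
by rewrite IH mule1.
Qed.

Lemma heat_kernel_pdf t x p : 0 < t -> heat_kernel t (x - cvec p) =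
  (\prod_j normal_pdf (Re (x 0 j)) (Num.sqrt t) (tnth p.1 j)) *
  (\prod_j normal_pdf (Im (x 0 j)) (Num.sqrt t) (tnth p.2 j)).
Proof.
move=> t0; have st : Num.sqrt t != 0 by rewrite gt_eqF// sqrtr_gt0.
have pt : 0 <= t * pi *+ 2 by rewrite mulrn_wge0// mulr_ge0 ?pi_ge0// ltW.
rewrite -big_split/= [RHS](eq_bigr (fun j => (2 * pi * t)^-1 *
    expR (- ((Re ((x - cvec p) 0 j) ^+ 2 + Im ((x - cvec p) 0 j) ^+ 2) / 2 * t^-1)))); last first.
  move=> j _; rewrite normal_pdfE// normal_pdfE// /normal_peak /normal_fun sqr_sqrtr ?(ltW t0)//.
  rewrite mulrACA -expRD -invfM -expr2 sqr_sqrtr//; congr (_^-1 * expR _).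
    by rewrite -(mulr_natl (t * pi)); ring.
  rewrite -(mulr_natl t) !mxE ReD ImD ReN ImN/=.
  by field; rewrite gt_eqF.
rewrite [RHS]big_split/= prodr_const card_ord /heat_kernel; congr (_ * _).
rewrite -expR_sum; congr expR; rewrite sqr_enorm_ReIm mulrAC mulr_suml mulr_suml -sumrN.
by apply: eq_bigr => j _; ring.
Qed.

Lemma integral_heat_kernel t x : 0 < t ->
  (\int[@lebesgue_cvec R n]_p (heat_kernel t (x - cvec p))%:E = 1)%E.
Proof.
move=> t0; rewrite /lebesgue_cvec fubini_tonelli1; last 2 first.
- by apply/measurable_EFinP; exact: measurable_heat_kernel.
- by move=> p; rewrite lee_fin ltW// heat_kernel_gt0.
have [E1 m1] := integral_tuple_pdf (fun j => Re (x 0 j)) (Num.sqrt t).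
have [E2 m2] := integral_tuple_pdf (fun j => Im (x 0 j)) (Num.sqrt t).
rewrite -[RHS]E1; apply: eq_integral => a _; rewrite /fubini_F.
under eq_integral => b _ do rewrite heat_kernel_pdf//= EFinM.
rewrite ge0_integralZl//; last 3 first.
- exact/measurable_EFinP.
- by move=> b _; rewrite lee_fin prodr_ge0// => j _; exact: normal_pdf_ge0.
- by rewrite lee_fin prodr_ge0// => j _; exact: normal_pdf_ge0.
by rewrite E2 mule1.
Qed.

Definition coord_ball r : set coords := [set p | enorm (0 - cvec p) <= r].

Lemma measurable_coord_ball r : measurable (coord_ball r).
Proof.
have : measurable_fun setT (fun p : coords => enorm (0 - cvec p)) by exact: measurable_enorm.
move=> /(_ measurableT `]-oo, r]%classic (measurable_itv _)); rewrite setTI.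
by congr measurable; apply/seteqP; split=> p /=; rewrite in_itv.
Qed.

(** The kernel at time one has finite integral and is bounded below on the
    ball. *)
Lemma coord_ball_finite r : (@lebesgue_cvec R n (coord_ball r) < +oo)%E.
Proof.
have mD := measurable_coord_ball r.
pose k := (2 * pi * 1)^-1 ^+ n * expR (- (r ^+ 2 / 2 * 1^-1)).
have k0 : 0 < k.
  by rewrite mulr_gt0 ?expR_gt0// exprn_gt0// invr_gt0 !mulr_gt0// pi_gt0.
have : (k%:E * @lebesgue_cvec R n (coord_ball r) <= 1)%E.
  rewrite -(integral_heat_kernel 0 ltr01) -integral_cst//.
  apply: (@le_trans _ _ (\int[@lebesgue_cvec R n]_(p in coord_ball r) (heat_kernel 1 (0 - cvec p))%:E)%E).
    apply: ge0_le_integral => //.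
    - by move=> p _; rewrite lee_fin ltW.
    - by apply/measurable_EFinP; apply: measurable_funTS; exact: measurable_heat_kernel.
    - move=> p pr; rewrite lee_fin /heat_kernel ler_pM2l ?exprn_gt0 ?invr_gt0 ?mulr_gt0 ?pi_gt0//.
      rewrite ler_expR lerN2 invr1 !mulr1 ler_pM2r ?invr_gt0//.
      by rewrite ler_sqr ?nnegrE ?enorm_ge0// (le_trans (enorm_ge0 _) pr).
  apply: ge0_subset_integral => //.
  - by apply/measurable_EFinP; exact: measurable_heat_kernel.
  - by move=> p _; rewrite lee_fin ltW// heat_kernel_gt0.
move=> H; rewrite ltey; apply: contraPneq H => ->.
by rewrite mulry gtr0_sg// mul1e.
Qed.

(** Off the ball of radius [e], the kernel at time [t] is at most
    [2 ^+ n * expR (- (e ^+ 2 / 4 * t^-1))] times the kernel at time [2 * t], which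
    has total mass one. *)
Lemma heat_kernel_tail t x e : 0 < t -> 0 <= e ->
  (1 - 2 ^+ n * expR (- (e ^+ 2 / 4 * t^-1)) <=
   fine (\int[@lebesgue_cvec R n]_(p in [set p | enorm (x - cvec p) <= e]) (heat_kernel t (x - cvec p))%:E))%R.
Proof.
move=> t0 e0; set A := [set p | _].
have mA : measurable A.
  have : measurable_fun setT (fun p : coords => enorm (x - cvec p)) by exact: measurable_enorm.
  move=> /(_ measurableT `]-oo, e]%classic (measurable_itv _)); rewrite setTI.
  by congr measurable; apply/seteqP; split=> p /=; rewrite in_itv.
have mk s : measurable_fun setT (fun p : coords => (heat_kernel s (x - cvec p))%:E).
  by apply/measurable_EFinP; exact: measurable_heat_kernel.
have k0 s p : 0 < s -> (0 <= (heat_kernel s (x - cvec p))%:E)%E.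
  by move=> s0; rewrite lee_fin ltW// heat_kernel_gt0.
have tail : (\int[@lebesgue_cvec R n]_(p in ~` A) (heat_kernel t (x - cvec p))%:E <=
    (2 ^+ n * expR (- (e ^+ 2 / 4 * t^-1)))%:E)%E.
  have t20 : 0 < 2 * t by rewrite mulr_gt0.
  apply: (@le_trans _ _ (\int[@lebesgue_cvec R n]_(p in ~` A)
     ((2 ^+ n * expR (- (e ^+ 2 / 4 * t^-1)))%:E * (heat_kernel (2 * t) (x - cvec p))%:E))%E).
    apply: ge0_le_integral => //.
    - exact: measurableC.
    - by move=> p _; exact: k0.
    - exact: measurable_funTS.
    - by apply: measurable_funTS; apply: measurable_funeM.
    move=> p /= /negP; rewrite -ltNge => ep; rewrite -EFinM lee_fin /heat_kernel.
    rewrite mulrACA -exprMn -expRD.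
    have -> : 2 * (2 * pi * (2 * t))^-1 = (2 * pi * t)^-1.
      by rewrite [X in X^-1]mulrCA invfM mulrA divff ?mul1r// pnatr_eq0.
    rewrite ler_pM2l ?exprn_gt0 ?invr_gt0 ?mulr_gt0 ?pi_gt0// ler_expR.
    have ep2 : e ^+ 2 <= enorm (x - cvec p) ^+ 2 by rewrite ler_sqr ?nnegrE ?enorm_ge0// ltW.
    rewrite -subr_ge0; set S := enorm _ ^+ 2 in ep2 *.
    have -> : - (e ^+ 2 / 4 * t^-1) - S / 2 * (2 * t)^-1 - - (S / 2 * t^-1) = (S - e ^+ 2) / 4 * t^-1.
      by field; rewrite gt_eqF.
    by rewrite mulr_ge0 ?invr_ge0 ?(ltW t0)// divr_ge0// subr_ge0.
  rewrite ge0_integralZl//; last 3 first.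
  - exact: measurableC.
  - exact: measurable_funTS.
  - by move=> p _; exact: k0.
  rewrite -[leRHS]mule1 lee_pmul2l//; last first.
    by rewrite lte_fin mulr_gt0 ?exprn_gt0 ?expR_gt0.
  rewrite -(integral_heat_kernel x t20); apply: ge0_subset_integral => //.
  - exact: measurableC.
  - by move=> p _; exact: k0.
have split : (\int[@lebesgue_cvec R n]_(p in A) (heat_kernel t (x - cvec p))%:E +
    \int[@lebesgue_cvec R n]_(p in ~` A) (heat_kernel t (x - cvec p))%:E = 1)%E.
  rewrite -(integral_heat_kernel x t0) -(setUv A) ge0_integral_setU//.
  - exact: measurableC.
  - by rewrite setUv; exact: mk.
  - by move=> p _; exact: k0.
  - by apply/disj_setPRL.
move: tail split.
have : (0 <= \int[@lebesgue_cvec R n]_(p in A) (heat_kernel t (x - cvec p))%:E)%E.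
  by apply: integral_ge0 => p _; exact: k0.
move: (2 ^+ n * _) => T.
case: (\int[_]_(p in A) _)%E => [a| |]//= _; case: (\int[_]_(p in ~` A) _)%E => [b| |]//=.
rewrite lee_fin => bt ab; have [E] : (a + b)%:E = 1%:E by rewrite EFinD.
by lra.
Qed.

End heat_kernel.

(** * Heat potentials *)

Section heat_potential.
Context {R : realType} {n : nat}.
Local Notation coords := (n.-tuple (measurableTypeR R) * n.-tuple (measurableTypeR R))%type.
Local Notation mu := (@lebesgue_cvec R n).
Context (w : coords -> R) (r B : R).
Hypotheses (w_meas : measurable_fun setT w) (w_ge0 : forall p, 0 <= w p) (w_le : forall p, w p <= B).
Implicit Types (x z : 'rV[R[i]]_n) (p : coords) (s t e : R) (j : 'I_n) (F G : coords -> R).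

Let D : set coords := coord_ball r.
Let mD : measurable D. Proof. exact: measurable_coord_ball. Qed.

(** The solution of the heat equation with initial value [w], cut off to a ball:
    for base points in a bounded set, expansions of the kernel are uniform. *)
Definition heat_potential t x : R := \int[mu]_(p in D) (w p * heat_kernel t (x - cvec p)).

Definition bounded_measurable F := measurable_fun setT F /\ exists C, forall p, D p -> `|F p| <= C.

Lemma bounded_measurable_cst s : bounded_measurable (fun=> s).
Proof. by split=> //; exists `|s|. Qed.

Lemma bounded_measurableD F G : bounded_measurable F -> bounded_measurable G ->
  bounded_measurable (fun p => F p + G p).
Proof.
move=> [mF [C FC]] [mG [C' GC]]; split; first exact: measurable_funD.
by exists (C + C') => p Dp; rewrite (le_trans (ler_normD _ _))// lerD ?FC ?GC.
Qed.

Lemma bounded_measurableM F G : bounded_measurable F -> bounded_measurable G ->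
  bounded_measurable (fun p => F p * G p).
Proof.
move=> [mF [C FC]] [mG [C' GC]]; split; first exact: measurable_funM.
by exists (C * C') => p Dp; rewrite normrM ler_pM ?FC ?GC.
Qed.

Lemma bounded_measurable_expR F : bounded_measurable F -> bounded_measurable (fun p => expR (F p)).
Proof.
move=> [mF [C FC]]; split; first exact: measurableT_comp.
exists (expR C) => p Dp; rewrite ger0_norm ?expR_ge0// ler_expR.
by rewrite (le_trans (ler_norm _))// FC.
Qed.

Lemma enorm_coord_ball x p : D p -> enorm (x - cvec p) <= enorm x + r.
Proof.
move=> Dp; apply: le_trans (enormD _ _) _; rewrite lerD2l//.
by move: Dp; rewrite /D /coord_ball/= sub0r.
Qed.

Lemma bounded_measurable_sqr_enorm x : bounded_measurable (fun p => enorm (x - cvec p) ^+ 2).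
Proof.
split; first exact: measurable_sqr_enorm.
exists ((enorm x + r) ^+ 2) => p Dp; rewrite ger0_norm ?sqr_ge0// ler_sqr ?nnegrE ?enorm_ge0//.
  exact: enorm_coord_ball.
exact: le_trans (enorm_ge0 _) (enorm_coord_ball x Dp).
Qed.

Lemma bounded_measurable_Re x j : bounded_measurable (fun p => Re ((x - cvec p) 0 j)).
Proof.
split.
  rewrite (_ : (fun _ => _) = fun p : coords => Re (x 0 j) - tnth p.1 j); last first.
    by apply/funext => p; rewrite !mxE ReD ReN.
  by apply: measurable_funB => //; exact: measurable_tnth1.
exists (enorm x + r) => p Dp; rewrite (le_trans (cabs_Re _))//.
by rewrite (le_trans (cabs_le_enorm _ _))// enorm_coord_ball.
Qed.

Lemma bounded_measurable_Im x j : bounded_measurable (fun p => Im ((x - cvec p) 0 j)).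
Proof.
split.
  rewrite (_ : (fun _ => _) = fun p : coords => Im (x 0 j) - tnth p.2 j); last first.
    by apply/funext => p; rewrite !mxE ImD ImN.
  by apply: measurable_funB => //; exact: measurable_tnth2.
exists (enorm x + r) => p Dp; rewrite (le_trans (cabs_Im _))//.
by rewrite (le_trans (cabs_le_enorm _ _))// enorm_coord_ball.
Qed.

Section at_a_point.
Context (t0 : R) (x0 : 'rV[R[i]]_n).
Hypothesis t0_gt0 : 0 < t0.

(** Expansions of the potential at [(t0, x0)] are means, for a fixed weight of mass
    at most [B], of expansions of the ratio of two kernels. *)
Definition heat_mean F : R := \int[mu]_(p in D) (w p * heat_kernel t0 (x0 - cvec p) * F p).

Lemma heat_mean_integrable F : bounded_measurable F ->
  mu.-integrable D (EFin \o (fun p => w p * heat_kernel t0 (x0 - cvec p) * F p)).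
Proof.
move=> [mF [C FC]]; apply: measurable_bounded_integrable => //.
- exact: coord_ball_finite.
- apply: measurable_funTS; apply: measurable_funM => //.
  by apply: measurable_funM => //; exact: measurable_heat_kernel.
exists (B * (2 * pi * t0)^-1 ^+ n * C); split; first exact: num_real.
have c0 : 0 <= (2 * pi * t0)^-1 ^+ n by rewrite exprn_ge0// invr_ge0 !mulr_ge0 ?pi_ge0// ltW.
move=> M /ltW CM p Dp; apply: le_trans CM.
have k0 := ltW (heat_kernel_gt0 (x0 - cvec p) t0_gt0).
rewrite normrM; apply: ler_pM; rewrite ?FC// ger0_norm ?mulr_ge0//.
by apply: ler_pM => //; exact: heat_kernel_le.
Qed.

Lemma heat_meanD F G : bounded_measurable F -> bounded_measurable G ->
  heat_mean (fun p => F p + G p) = heat_mean F + heat_mean G.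
Proof.
move=> bF bG; rewrite /heat_mean -RintegralD//; try exact: heat_mean_integrable.
by apply: eq_Rintegral => p _; rewrite mulrDr.
Qed.

Lemma heat_meanZ s F : bounded_measurable F ->
  heat_mean (fun p => s * F p) = s * heat_mean F.
Proof.
move=> bF; rewrite /heat_mean -RintegralZl//; try exact: heat_mean_integrable.
by apply: eq_Rintegral => p _; rewrite mulrCA.
Qed.

Lemma heat_mean_bound F e : bounded_measurable F -> 0 <= e -> (forall p, D p -> `|F p| <= e) ->
  `|heat_mean F| <= e * B.
Proof.
move=> bF e0 Fe.
have kp p : 0 < heat_kernel t0 (x0 - cvec p) by exact: heat_kernel_gt0.
have B0 : 0 <= B by exact: le_trans (w_ge0 (nseq_tuple n 0, nseq_tuple n 0)) (w_le _).
have mk : measurable_fun setT (fun p : coords => (heat_kernel t0 (x0 - cvec p))%:E).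
  by apply/measurable_EFinP; exact: measurable_heat_kernel.
apply: le_trans (le_normr_Rintegral mD (heat_mean_integrable bF)) _.
rewrite -lee_fin /Rintegral fineK; last first.
  have := integrable_abse (heat_mean_integrable bF).
  move=> /(integrable_fin_num mD); apply: etrans; congr (_ \is a fin_num).
apply: (@le_trans _ _ (\int[mu]_(p in D) ((e * B)%:E * (heat_kernel t0 (x0 - cvec p))%:E))%E).
  apply: ge0_le_integral => //.
  - apply/measurable_EFinP; apply: measurable_funTS; apply: measurableT_comp => //.
    apply: measurable_funM; last by case: bF.
    by apply: measurable_funM => //; exact: measurable_heat_kernel.
  - by apply: measurable_funTS; apply: measurable_funeM.
  - move=> p Dp; rewrite -EFinM lee_fin normrM mulrC -mulrA.
    have wk0 := mulr_ge0 (w_ge0 p) (ltW (kp p)).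
    by rewrite (ger0_norm wk0) ler_pM ?Fe// ler_wpM2r ?w_le ?(ltW (kp p)).
rewrite ge0_integralZl//; last 3 first.
- exact: measurable_funTS.
- by move=> p _; rewrite lee_fin ltW.
- by rewrite lee_fin mulr_ge0.
rewrite -[leRHS]mule1 lee_wpmul2l ?lee_fin ?mulr_ge0//.
rewrite -(integral_heat_kernel x0 t0_gt0); apply: ge0_subset_integral => //.
by move=> p _; rewrite lee_fin ltW.
Qed.

(** This is how pointwise expansions are integrated: as the weight has mass at most
    [B], a uniform remainder stays under control. *)
Lemma heat_mean_expand F (s : seq (R * (coords -> R))) e : 0 <= e -> bounded_measurable F ->
  foldr (fun q P => bounded_measurable q.2 /\ P) True s ->
  (forall p, D p -> `|F p - \sum_(q <- s) q.1 * q.2 p| <= e) ->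
  `|heat_mean F - \sum_(q <- s) q.1 * heat_mean q.2| <= e * B.
Proof.
move=> e0; elim: s F => [|[a G] s IH] F bF /=.
  rewrite big_nil subr0 => _ H; apply: heat_mean_bound => // p Dp.
  by have := H p Dp; rewrite big_nil subr0.
move=> [bG bs] H; rewrite big_cons/=.
have bF' : bounded_measurable (fun p => F p + - a * G p).
  apply: bounded_measurableD => //; apply: bounded_measurableM => //.
  exact: bounded_measurable_cst.
have := IH _ bF' bs; rewrite heat_meanD ?heat_meanZ//; last first.
  by apply: bounded_measurableM => //; exact: bounded_measurable_cst.
rewrite opprD addrA mulNr; apply => p Dp.
by have := H p Dp; rewrite big_cons/= opprD addrA mulNr.
Qed.

(** The logarithm of the ratio of the kernels at [(t, x)] and at [(t0, x0)]. *)
Definition heat_exponent t x p : R :=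
  n%:R * ln (t0 / t) + (enorm (x0 - cvec p) ^+ 2 / 2 * t0^-1 - enorm (x - cvec p) ^+ 2 / 2 * t^-1).

Lemma bounded_measurable_heat_exponent t x : bounded_measurable (heat_exponent t x).
Proof.
apply: bounded_measurableD; first exact: bounded_measurable_cst.
apply: bounded_measurableD.
  do 2 (apply: bounded_measurableM; last exact: bounded_measurable_cst).
  exact: bounded_measurable_sqr_enorm.
rewrite (_ : (fun _ => _) = fun p => enorm (x - cvec p) ^+ 2 * (- (2^-1 * t^-1))).
  by apply: bounded_measurableM; [exact: bounded_measurable_sqr_enorm|exact: bounded_measurable_cst].
by apply/funext => p; ring.
Qed.

Lemma heat_potential_mean t x : 0 < t ->
  heat_potential t x = heat_mean (fun p => expR (heat_exponent t x p)).
Proof.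
move=> t_gt0; apply: eq_Rintegral => p _; rewrite -mulrA; congr (_ * _).
rewrite /heat_kernel /heat_exponent (mulr_natl (ln _)) expRD -lnXn ?divr_gt0// lnK ?posrE ?exprn_gt0 ?divr_gt0//.
rewrite [RHS]mulrACA -exprMn -expRD; congr (_ ^+ _ * expR _); last by ring.
by rewrite !(invfM (2 * pi)) -mulrA mulKf// gt_eqF.
Qed.

Lemma heat_potential_mean1 : heat_potential t0 x0 = heat_mean (fun=> 1).
Proof. by apply: eq_Rintegral => p _; rewrite mulr1. Qed.

End at_a_point.

Lemma heat_potential_EFin t x : 0 < t ->
  ((heat_potential t x)%:E = \int[mu]_(p in D) (w p * heat_kernel t (x - cvec p))%:E)%E.
Proof.
move=> t0; rewrite /heat_potential /Rintegral fineK//.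
have := heat_mean_integrable x t0 (bounded_measurable_cst 1).
move=> /(integrable_fin_num mD); apply: etrans; congr (_ \is a fin_num).
by apply: eq_integral => p _ /=; rewrite mulr1.
Qed.

Let wk_ge0 t x p : 0 < t -> 0 <= w p * heat_kernel t (x - cvec p).
Proof. by move=> t0; rewrite mulr_ge0// ltW// heat_kernel_gt0. Qed.

Let wk_meas t x : measurable_fun setT (fun p => w p * heat_kernel t (x - cvec p)).
Proof. by apply: measurable_funM => //; exact: measurable_heat_kernel. Qed.

Lemma heat_potential_ge0 t x : 0 < t -> 0 <= heat_potential t x.
Proof. by move=> t0; apply: Rintegral_ge0 => p _; exact: wk_ge0. Qed.

Lemma heat_potential_le_gauss :
  ((heat_potential 1 0)%:E <= \int[mu]_p (w p * gauss_density (cvec p))%:E)%E.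
Proof.
rewrite heat_potential_EFin//; apply: (@le_trans _ _ (\int[mu]_p (w p * heat_kernel 1 (0 - cvec p))%:E)%E).
  apply: ge0_subset_integral => //; first by apply/measurable_EFinP; exact: wk_meas.
  by move=> p _; rewrite lee_fin wk_ge0.
rewrite le_eqVlt; apply/orP; left; apply/eqP; apply: eq_integral => p _; congr (_%:E); congr (_ * _).
by rewrite heat_kernel1 /gauss_density sub0r enormN.
Qed.

(** By [heat_kernel_tail], the kernel concentrates at [x] for small times. *)
Lemma heat_potential_ge t x e m : 0 < t -> 0 <= e -> 0 <= m -> enorm x + e <= r ->
  (forall p, enorm (x - cvec p) <= e -> m <= w p) ->
  m * (1 - 2 ^+ n * expR (- (e ^+ 2 / 4 * t^-1))) <= heat_potential t x.
Proof.
move=> t0 e0 m0 xr mw; have := heat_kernel_tail x t0 e0.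
set A := [set p | _] => tail.
have mA : measurable A.
  have : measurable_fun setT (fun p : coords => enorm (x - cvec p)) by exact: measurable_enorm.
  move=> /(_ measurableT `]-oo, e]%classic (measurable_itv _)); rewrite setTI.
  by congr measurable; apply/seteqP; split=> p /=; rewrite in_itv.
have AD : A `<=` D.
  move=> p Ap; apply: le_trans xr; rewrite sub0r enormN.
  have -> : cvec p = x - (x - cvec p) by rewrite opprB addrC subrK.
  by apply: le_trans (enormD _ _) _; rewrite enormN lerD2l.
have mk : measurable_fun setT (fun p : coords => (heat_kernel t (x - cvec p))%:E).
  by apply/measurable_EFinP; exact: measurable_heat_kernel.
have k0 p : 0 <= heat_kernel t (x - cvec p) by rewrite ltW// heat_kernel_gt0.
have Afin : (\int[mu]_(p in A) (heat_kernel t (x - cvec p))%:E \is a fin_num)%E.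
  rewrite ge0_fin_numE; last by apply: integral_ge0 => p _; rewrite lee_fin.
  apply: (@le_lt_trans _ _ 1%E); last by rewrite ltry.
  rewrite -(integral_heat_kernel x t0); apply: ge0_subset_integral => //.
  by move=> p _; rewrite lee_fin.
apply: le_trans (ler_wpM2l m0 tail) _; rewrite -lee_fin EFinM fineK// heat_potential_EFin//.
rewrite -ge0_integralZl//; last 2 first.
- exact: measurable_funTS.
- by move=> p _; rewrite lee_fin.
apply: (@le_trans _ _ (\int[mu]_(p in A) (w p * heat_kernel t (x - cvec p))%:E)%E).
  apply: ge0_le_integral => //.
  - by move=> p _; rewrite -EFinM lee_fin mulr_ge0.
  - by apply: measurable_funTS; apply: measurable_funeM.
  - by apply/measurable_EFinP; apply: measurable_funTS; exact: wk_meas.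
  - by move=> p Ap; rewrite -EFinM lee_fin ler_wpM2r// mw.
apply: ge0_subset_integral => //; first by apply/measurable_EFinP; apply: measurable_funTS; exact: wk_meas.
by move=> p _; rewrite lee_fin wk_ge0.
Qed.

End heat_potential.

(** * Uniform expansions of the heat kernel *)

Section exponential_expansions.
Context {R : realType}.
Implicit Types (a b e t L S : R).

Lemma expR_taylor2 e : 0 < e -> exists2 r : R, 0 < r & forall s : R, `|s| < r ->
  `|expR s - (1 + s + s ^+ 2 / 2)| <= e * s ^+ 2.
Proof.
move=> e0; have := @taylor2 R expR expR 1 (@is_derive_expR R).
have d0 : is_derive (0 : R) 1 expR 1 by rewrite -[X in is_derive _ _ _ X]expR0; exact: is_derive_expR.
move=> /(_ d0 e e0)[r r0 H]; exists r => // s /H; rewrite expR0; congr (`|_| <= _); ring.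
Qed.

Lemma expR_taylor1 e : 0 < e -> exists2 r : R, 0 < r & forall s : R, `|s| < r ->
  `|expR s - (1 + s)| <= e * `|s|.
Proof.
move=> e0; have d0 : is_derive (0 : R) 1 expR 1.
  by rewrite -[X in is_derive _ _ _ X]expR0; exact: is_derive_expR.
have [r r0 H] := is_derive_eps d0 e0; exists r => // s /H.
by rewrite add0r expR0 mul1r opprD addrA.
Qed.

(** The second-order expansion of a heat kernel along a complex line, uniformly
    for bounded base points; [a +i* b] is the coordinate of the base point along
    that line and [x +i* y] the increment. *)
Lemma expR_quadratic t L e : 0 < t -> 0 <= L -> 0 < e -> exists2 d : R, 0 < d &
  forall a b x y m, a ^+ 2 + b ^+ 2 <= L ^+ 2 -> 0 <= m -> m ^+ 2 = x ^+ 2 + y ^+ 2 -> m < d ->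
  `|expR (- ((2 * (a * x + b * y) + m ^+ 2) / 2 * t^-1)) -
    (1 + (x * (- a / t) + (- y * (b / t) +
     ((x ^+ 2 - y ^+ 2) * ((a ^+ 2 - b ^+ 2) / (4 * t ^+ 2)) +
      (- (2 * x * y) * (- (2 * a * b) / (4 * t ^+ 2)) +
       m ^+ 2 * ((a ^+ 2 + b ^+ 2) / (4 * t ^+ 2) - (2 * t)^-1))))))| <= e * m ^+ 2.
Proof.
move=> t0 L0 e0; pose A := (2 * L + 1) / 2 * t^-1; pose C := (4 * L + 1) / 8 * t^-1 ^+ 2.
have A0 : 0 < A by rewrite mulr_gt0 ?invr_gt0// divr_gt0//; lra.
have C0 : 0 < C by rewrite mulr_gt0 ?exprn_gt0 ?invr_gt0// divr_gt0//; lra.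
have [|r r0 H] := @expR_taylor2 (e / 2 / A ^+ 2); first by rewrite !divr_gt0 ?exprn_gt0.
pose d := Num.min 1 (Num.min (r / A) (e / 2 / C)).
have rA : 0 < r / A := divr_gt0 r0 A0.
have eC : 0 < e / 2 / C by apply: divr_gt0 => //; exact: divr_gt0.
exists d; first by rewrite !lt_min ltr01 rA eC.
move=> a b x y m abL m0 mE; rewrite !lt_min => /andP[m1 /andP[mr me]].
rewrite ltr_pdivlMr// in mr; rewrite ltr_pdivlMr// in me.
pose rho := a * x + b * y.
have rhoL : `|rho| <= L * m.
  rewrite -ler_sqr ?nnegrE ?mulr_ge0// real_normK ?num_real// exprMn mE.
  apply: (@le_trans _ _ ((a ^+ 2 + b ^+ 2) * (x ^+ 2 + y ^+ 2))); last first.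
    by rewrite ler_wpM2r// addr_ge0 ?sqr_ge0.
  rewrite -subr_ge0 /rho; have := sqr_ge0 (a * y - b * x).
  by congr (_ <= _); ring.
have mm : m ^+ 2 <= m by rewrite expr2 ler_piMl// ltW.
set B := - (_ / 2 * t^-1).
have BA : `|B| <= A * m.
  rewrite /B -/rho normrN !normrM [`|t^-1|]gtr0_norm ?invr_gt0// [`|2^-1|]gtr0_norm//.
  rewrite /A [leRHS]mulrAC ler_pM2r ?invr_gt0// [leRHS]mulrAC ler_pM2r//.
  apply: le_trans (ler_normD _ _) _; rewrite normrM [`|2|]gtr0_norm// [`|m ^+ 2|]ger0_norm ?sqr_ge0//.
  by lra.
have Br : `|B| < r by rewrite (le_lt_trans BA)// mulrC.
have E : B ^+ 2 / 2 - rho ^+ 2 / 2 * t^-1 ^+ 2 = (4 * rho + m ^+ 2) / 8 * t^-1 ^+ 2 * m ^+ 2.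
  by rewrite /B -/rho; field; rewrite gt_eqF.
set T := 1 + (x * _ + _).
have -> : expR B - T = (expR B - (1 + B + B ^+ 2 / 2)) + (4 * rho + m ^+ 2) / 8 * t^-1 ^+ 2 * m ^+ 2.
  by rewrite -E /T /B /rho !mE; field; rewrite gt_eqF.
apply: le_trans (ler_normD _ _) _; rewrite [e]splitr [leRHS]mulrDl; apply: lerD.
  apply: le_trans (H _ Br) _.
  have B2 : B ^+ 2 <= A ^+ 2 * m ^+ 2.
    rewrite -exprMn -(@real_normK _ B) ?num_real// ler_sqr ?nnegrE//.
    by rewrite mulr_ge0// ltW.
  apply: (@le_trans _ _ (e / 2 / A ^+ 2 * (A ^+ 2 * m ^+ 2))).
    by rewrite ler_wpM2l// !divr_ge0 ?sqr_ge0// ltW.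
  by rewrite mulrA divfK// expf_neq0// gt_eqF.
rewrite normrM [`|m ^+ 2|]ger0_norm ?sqr_ge0// ler_wpM2r ?sqr_ge0//.
apply: le_trans (ltW me); have t20 : 0 < t^-1 ^+ 2 by rewrite exprn_gt0 ?invr_gt0.
have -> : m * C = m * (4 * L + 1) / 8 * t^-1 ^+ 2 by rewrite /C; ring.
rewrite normrM (gtr0_norm t20) ler_pM2r// normrM [`|8^-1|]gtr0_norm// ler_pM2r//.
apply: le_trans (ler_normD _ _) _; rewrite normrM [`|4|]gtr0_norm// [`|m ^+ 2|]ger0_norm ?sqr_ge0//.
by lra.
Qed.

(** The exponent is the logarithm of the ratio of the kernels at times [t + s] and
    [t], for a base point whose squared distance is [S]. *)
Lemma expR_time n t L e : 0 < t -> 0 <= L -> 0 < e -> exists2 d : R, 0 < d &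
  forall s S, 0 <= S <= L -> `|s| < d ->
  `|expR (n%:R * ln (t / (t + s)) + (S / 2 * t^-1 - S / 2 * (t + s)^-1)) -
    (1 + s * (S / (2 * t ^+ 2) - n%:R / t))| <= e * `|s|.
Proof.
move=> t0 L0 e0; pose N1 := n%:R + L / 2; pose K := L / 2 * t^-1 ^+ 2 + n%:R * t^-1.
have N10 : 0 <= N1 by rewrite addr_ge0// divr_ge0.
have K0 : 0 <= K by rewrite addr_ge0// mulr_ge0 ?divr_ge0 ?exprn_ge0 ?invr_ge0// ltW.
have K1 : 0 < K + N1 + 1 by lra.
pose e3 := e / 2 / (K + N1 + 1); have e30 : 0 < e3 by rewrite !divr_gt0.
pose e1 := Num.min 1 (e / 2 / (N1 + 1)).
have e10 : 0 < e1 by rewrite lt_min ltr01 !divr_gt0// ltr_wpDl.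
have [r3 r30 H3] := expR_taylor1 e30.
have dln : is_derive t 1 (@ln R) t^-1 by exact: is_derive1_ln.
have [r1 r10 H1] := is_derive_eps dln e10.
have dinv : is_derive t 1 (fun x : R => x^-1) (- t^-1 ^+ 2).
  have tn0 : t != 0 by rewrite gt_eqF.
  have := @is_deriveV R (fun x : R => x) t 1 1 tn0 (is_derive_id t 1).
  by rewrite /GRing.scale/= mulr1 exprVn.
have [r2 r20 H2] := is_derive_eps dinv e10.
pose d := Num.min t (Num.min r1 (Num.min r2 (r3 / (K + N1 + 1)))).
exists d; first by rewrite !lt_min t0 r10 r20 divr_gt0.
move=> s S /andP[S0 SL]; rewrite !lt_min => /andP[st /andP[sr1 /andP[sr2 sr3]]].
have ts : 0 < t + s by move: st; rewrite ltr_norml => /andP[]; lra.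
move: (H1 s sr1) (H2 s sr2); rewrite ln_div ?posrE//.
set u1 := ln (t + s) - ln t - _ => U1; set u2 := (t + s)^-1 - t^-1 - _ => U2.
pose k := S / 2 * t^-1 ^+ 2 - n%:R * t^-1.
have kE : S / (2 * t ^+ 2) - n%:R / t = k by rewrite /k; field; rewrite gt_eqF.
set b := n%:R * _ + _.
have bE : b = s * k - (n%:R * u1 + S / 2 * u2) by rewrite /b /k /u1 /u2; ring.
have bk : `|b - s * k| <= N1 * e1 * `|s|.
  rewrite bE addrC addKr normrN; apply: le_trans (ler_normD _ _) _.
  rewrite !normrM [`|n%:R|]ger0_norm// [`|S|]ger0_norm// [`|2^-1|]gtr0_norm// /N1 2!mulrDl.
  rewrite -!mulrA; apply: lerD; first by rewrite ler_wpM2l.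
  by rewrite ler_pM ?mulr_ge0// ler_pM2l.
have kK : `|k| <= K.
  apply: le_trans (ler_normB _ _) _; rewrite !normrM [`|n%:R|]ger0_norm// [`|S|]ger0_norm//.
  rewrite [`|2^-1|]gtr0_norm// [`|t^-1|]gtr0_norm ?invr_gt0// -expr2.
  by rewrite /K lerD2r ler_wpM2r ?sqr_ge0// ler_pM2r.
have bs : `|b| <= (K + N1) * `|s|.
  have -> : b = s * k + (b - s * k) by ring.
  apply: le_trans (ler_normD _ _) _; rewrite mulrDl normrM mulrC lerD ?ler_wpM2r//.
  apply: le_trans bk _; rewrite ler_wpM2r// ler_piMr//.
  by rewrite ge_min lexx.
have br3 : `|b| < r3.
  apply: (@le_lt_trans _ _ ((K + N1 + 1) * `|s|)).
    by apply: le_trans bs _; rewrite ler_wpM2r// lerDl.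
  by rewrite mulrC -ltr_pdivlMr.
rewrite kE; have -> : expR b - (1 + s * k) = (expR b - (1 + b)) + (b - s * k) by ring.
apply: le_trans (ler_normD _ _) _; rewrite [e]splitr [leRHS]mulrDl; apply: lerD.
  apply: le_trans (H3 _ br3) _; apply: (@le_trans _ _ (e3 * ((K + N1) * `|s|))).
    by rewrite ler_pM2l.
  rewrite mulrA ler_wpM2r// /e3 mulrAC ler_pdivrMr// ler_pM2l ?divr_gt0//; lra.
apply: le_trans bk _; rewrite ler_wpM2r//.
apply: (@le_trans _ _ ((N1 + 1) * e1)); first by rewrite ler_wpM2r ?(ltW e10)// lerDl.
by rewrite mulrC -ler_pdivlMr ?ltr_wpDl// ge_min lexx orbT.
Qed.

Lemma expR_small e : 0 < e -> exists2 r : R, 0 < r & forall s : R, `|s| < r -> `|expR s - 1| <= e.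
Proof.
move=> e0; have [|r r0 H] := @continuous_eps R expR 0 _ _ e0; first exact: continuous_expR.
by exists r => // s sr; have := H s; rewrite subr0 expR0 => /(_ sr)/ltW.
Qed.

(** The quantity under the norm is the logarithm of the ratio of two kernels, the
    squared distances to the base point being [S] and [S']. *)
Lemma heat_exponent_small n t L C e : 0 < t -> 0 <= L -> 0 <= C -> 0 < e -> exists2 d : R, 0 < d &
  forall t' S S' h, `|t' - t| < d -> 0 <= S <= L -> 0 <= h < d -> `|S' - S| <= C * h ->
  `|n%:R * ln (t / t') + (S / 2 * t^-1 - S' / 2 * t'^-1)| <= e.
Proof.
move=> t0 L0 C0 e0; pose N1 := n%:R + L / 2 + 1; have N10 : 0 < N1 by rewrite ltr_wpDl// addr_ge0// divr_ge0.
pose e1 := Num.min 1 (e / 2 / N1); have e10 : 0 < e1 by rewrite lt_min ltr01 !divr_gt0.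
have [r1 r10 H1] := continuous_eps (continuous_ln t0) e10.
have tn0 : t != 0 by rewrite gt_eqF.
have [r2 r20 H2] := continuous_eps (@inv_continuous R t tn0) e10.
have q0 : 0 < (C + 1) * (t^-1 + 1) by rewrite mulr_gt0 ?ltr_wpDl// invr_ge0 ltW.
pose d := Num.min t (Num.min r1 (Num.min r2 (e / ((C + 1) * (t^-1 + 1))))).
exists d; first by rewrite !lt_min t0 r10 r20 divr_gt0.
move=> t' S S' h; rewrite !lt_min => /andP[tt /andP[tr1 /andP[tr2 _]]] /andP[S0 SL].
move=> /andP[h0 /andP[_ /andP[_ /andP[_ hq]]]] SS; rewrite ltr_pdivlMr// in hq.
have t'0 : 0 < t' by move: tt; rewrite ltr_norml => /andP[]; lra.
rewrite ln_div ?posrE//.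
have := H1 _ tr1; have := H2 _ tr2; set u2 := t'^-1 - t^-1; set u1 := ln t' - ln t => U2 U1.
have t'V : t'^-1 <= t^-1 + 1.
  have : u2 <= 1 by rewrite (le_trans (ler_norm _))// ltW// (lt_le_trans U2)// ge_min lexx.
  by rewrite /u2 lerBlDl.
have -> : n%:R * (ln t - ln t') + (S / 2 * t^-1 - S' / 2 * t'^-1) =
    - (n%:R * u1 + S / 2 * u2 + (S' - S) / 2 * t'^-1) by rewrite /u1 /u2; ring.
rewrite normrN; apply: le_trans (ler_normD _ _) _; rewrite [e]splitr; apply: lerD.
  apply: (@le_trans _ _ (N1 * e1)); last by rewrite mulrC -ler_pdivlMr// ge_min lexx orbT.
  apply: le_trans (ler_normD _ _) _; rewrite /N1 !normrM [`|n%:R|]ger0_norm// [`|S|]ger0_norm//.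
  rewrite [`|2^-1|]gtr0_norm// 2!mulrDl.
  have A1 : n%:R * `|u1| <= n%:R * e1 by rewrite ler_wpM2l// ltW.
  have A2 : S / 2 * `|u2| <= L / 2 * e1 by rewrite ler_pM ?divr_ge0// ?ler_pM2r// ltW.
  by lra.
rewrite !normrM [`|2^-1|]gtr0_norm// [`|t'^-1|]gtr0_norm ?invr_gt0// mulrAC ler_pM2r//.
apply: le_trans (ltW hq); rewrite mulrA [h * _]mulrC; apply: ler_pM => //.
  by rewrite invr_ge0 ltW.
by apply: le_trans SS _; rewrite ler_wpM2r// lerDl.
Qed.

End exponential_expansions.

(** * Differentiation of heat potentials *)

Section heat_potential_calculus.
Context {R : realType} {n : nat}.
Local Notation coords := (n.-tuple (measurableTypeR R) * n.-tuple (measurableTypeR R))%type.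
Context (w : coords -> R) (r B : R).
Hypotheses (w_meas : measurable_fun setT w) (w_ge0 : forall p, 0 <= w p) (w_le : forall p, w p <= B).
Context (t0 : R) (x0 : 'rV[R[i]]_n).
Hypothesis t0_gt0 : 0 < t0.
Implicit Types (x : 'rV[R[i]]_n) (p : coords) (t e : R) (j : 'I_n).

Let mean := heat_mean w r t0 x0.
Let v := heat_potential w r.
Let re j p := Re ((x0 - cvec p) 0 j).
Let im j p := Im ((x0 - cvec p) 0 j).
Let L : R := enorm x0 + `|r|.

Let L0 : 0 <= L. Proof. by rewrite addr_ge0 ?enorm_ge0. Qed.

Let DL p : coord_ball r p -> enorm (x0 - cvec p) <= L.
Proof. by move=> Dp; rewrite (le_trans (enorm_coord_ball x0 Dp))// lerD2l ler_norm. Qed.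

Let DLj j p : coord_ball r p -> re j p ^+ 2 + im j p ^+ 2 <= L ^+ 2.
Proof.
move=> Dp; rewrite -sqr_cabs ler_sqr ?nnegrE ?cabs_ge0//.
exact: le_trans (cabs_le_enorm _ _) (DL Dp).
Qed.

(** The coefficients in [heat_potential_line]: the first-order and the holomorphic
    second-order coefficients are complex numbers, given by their real and
    imaginary parts, and [heat_laplacian j] is a quarter of the Laplacian in the
    [j]-th complex coordinate. *)
Definition heat_first_re j := mean (fun p => - re j p / t0).
Definition heat_first_im j := mean (fun p => im j p / t0).
Definition heat_second_re j := mean (fun p => (re j p ^+ 2 - im j p ^+ 2) / (4 * t0 ^+ 2)).
Definition heat_second_im j := mean (fun p => - (2 * re j p * im j p) / (4 * t0 ^+ 2)).
Definition heat_laplacian j := mean (fun p => (re j p ^+ 2 + im j p ^+ 2) / (4 * t0 ^+ 2) - (2 * t0)^-1).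
Definition heat_speed := mean (fun p => enorm (x0 - cvec p) ^+ 2 / (2 * t0 ^+ 2) - n%:R / t0).

Let bM := @bounded_measurableM R n r.
Let bD := @bounded_measurableD R n r.
Let bC := @bounded_measurable_cst R n r.
Let bre j : bounded_measurable r (re j). Proof. exact: bounded_measurable_Re. Qed.
Let bim j : bounded_measurable r (im j). Proof. exact: bounded_measurable_Im. Qed.
Let bsq F : bounded_measurable r F -> bounded_measurable r (fun p => F p ^+ 2).
Proof. by move=> bF; exact: bM. Qed.
Let bN F : bounded_measurable r F -> bounded_measurable r (fun p => - F p).
Proof.
move=> bF; rewrite (_ : (fun _ => _) = fun p => -1 * F p); first by apply: bM => //; exact: bC.
by apply/funext => p; rewrite mulN1r.
Qed.

Let meanD F G := @heat_meanD R n w r B w_meas w_ge0 w_le t0 x0 t0_gt0 F G.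
Let meanZ s F := @heat_meanZ R n w r B w_meas w_ge0 w_le t0 x0 t0_gt0 s F.

(** The heat equation, with half the Laplacian: the integrands agree. *)
Lemma heat_speedE : heat_speed = \sum_j 2 * heat_laplacian j.
Proof.
pose F j p := (re j p ^+ 2 + im j p ^+ 2) / (4 * t0 ^+ 2) - (2 * t0)^-1.
have bF j : bounded_measurable r (F j).
  apply: bD; last exact: bC.
  by apply: bM; [apply: bD; apply: bsq|exact: bC].
have S (s : seq 'I_n) : mean (fun p => \sum_(j <- s) 2 * F j p) = \sum_(j <- s) 2 * mean (F j) /\
    bounded_measurable r (fun p => \sum_(j <- s) 2 * F j p).
  elim: s => [|j s [IH bs]].
    split; last by rewrite (_ : (fun _ => _) = fun=> 0)//; apply/funext => p; rewrite big_nil.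
    rewrite big_nil -[RHS](mul0r (mean (fun=> 0))) -meanZ; last exact: bC.
    by apply: eq_Rintegral => p _; rewrite big_nil mul0r.
  have b2 : bounded_measurable r (fun p => 2 * F j p) by apply: bM => //; exact: bC.
  have E : (fun p => \sum_(i <- j :: s) 2 * F i p) = fun p => 2 * F j p + \sum_(i <- s) 2 * F i p.
    by apply/funext => p; rewrite big_cons.
  by rewrite E big_cons; split; [rewrite /mean meanD// meanZ//; congr (_ + _)|exact: bD].
rewrite -(S (index_enum _)).1; apply: eq_Rintegral => p _; congr (_ * _).
rewrite -mulr_sumr big_split/= sumr_const card_ord -mulr_suml.
rewrite sqr_enorm_ReIm -/(re _ _); set T := \sum_j _.
by rewrite -(mulr_natl _ n); field; rewrite gt_eqF.
Qed.

Lemma heat_potential_line j e : 0 < e -> exists2 d : R, 0 < d & forall z : R[i], cabs z < d ->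
  `|v t0 (x0 + z *: delta_mx 0 j) - v t0 x0 -
    Re ((heat_first_re j +i* heat_first_im j) * z) -
    Re ((heat_second_re j +i* heat_second_im j) * z ^+ 2) -
    heat_laplacian j * cabs z ^+ 2| <= e * cabs z ^+ 2.
Proof.
move=> e0; have B1 : 0 < B + 1.
  by rewrite ltr_wpDl// (le_trans (w_ge0 (nseq_tuple n 0, nseq_tuple n 0)) (w_le _)).
have [d d0 H] := expR_quadratic t0_gt0 L0 (divr_gt0 e0 B1).
exists d => // z zd; set x := Re z; set y := Im z; set m := cabs z.
have em0 : 0 <= e / (B + 1) * m ^+ 2 by rewrite mulr_ge0 ?sqr_ge0// ltW// divr_gt0.
have mE : m ^+ 2 = x ^+ 2 + y ^+ 2 by rewrite /m sqr_cabs.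
have := @heat_mean_expand R n w r B w_meas w_ge0 w_le t0 x0 t0_gt0
  (fun p => expR (heat_exponent t0 x0 t0 (x0 + z *: delta_mx 0 j) p))
  [:: (1, fun=> 1); (x, fun p => - re j p / t0); (- y, fun p => im j p / t0);
    (x ^+ 2 - y ^+ 2, fun p => (re j p ^+ 2 - im j p ^+ 2) / (4 * t0 ^+ 2));
    (- (2 * x * y), fun p => - (2 * re j p * im j p) / (4 * t0 ^+ 2));
    (m ^+ 2, fun p => (re j p ^+ 2 + im j p ^+ 2) / (4 * t0 ^+ 2) - (2 * t0)^-1)] _ em0.
rewrite -(heat_potential_mean w r x0 t0_gt0)// -/v !big_cons !big_nil/=.
rewrite -(heat_potential_mean1 w r t0 x0) -/v -/mean -/(heat_first_re j) -/(heat_first_im j).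
rewrite -/(heat_second_re j) -/(heat_second_im j) -/(heat_laplacian j).
move=> /(_ _ _ _) K.
have flat (a b f1 f2 s1 s2 k : R) : a - b - Re ((f1 +i* f2) * z) - Re ((s1 +i* s2) * z ^+ 2) - k * m ^+ 2 =
    a - (1 * b + (x * f1 + (- y * f2 + ((x ^+ 2 - y ^+ 2) * s1 + (- (2 * x * y) * s2 + (m ^+ 2 * k + 0)))))).
  by rewrite (expr2 z) !ReM ImM/= -/x -/y; ring.
rewrite flat; apply: le_trans (K _ _ _) _; last first.
- rewrite mulrAC ler_wpM2r ?sqr_ge0// -mulrA [_ * B]mulrC mulrA ler_pdivrMr// ler_pM2l//.
  by rewrite lerDl.
- move=> p Dp; rewrite /heat_exponent divff ?gt_eqF// ln1 mulr0 add0r.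
  have := H (re j p) (im j p) x y m (DLj j Dp) (cabs_ge0 z) mE zd.
  rewrite !big_cons big_nil mul1r addr0; congr (`|expR _ - _| <= _).
  have -> : x0 + z *: delta_mx 0 j - cvec p = (x0 - cvec p) + z *: delta_mx 0 j by rewrite addrAC.
  by rewrite enorm_sqr_line ReM/= -/x -/y -/m /re /im; case: ((x0 - cvec p) 0 j) => a b/=; ring.
- refine (conj (bC _) (conj _ (conj _ (conj _ (conj _ (conj _ I)))))).
  + by apply: bM; [exact: bN|exact: bC].
  + by apply: bM; [|exact: bC].
  + by apply: bM; [apply: bD; [exact: bsq|apply: bN; exact: bsq]|exact: bC].
  + by apply: bM; [apply: bN; apply: bM => //; apply: bM => //; exact: bC|exact: bC].
  + apply: bD; last exact: bC.
    by apply: bM; [apply: bD; apply: bsq|exact: bC].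
- apply: bounded_measurable_expR; exact: bounded_measurable_heat_exponent.
Qed.

Lemma heat_potential_time e : 0 < e -> exists2 d : R, 0 < d & forall s, `|s| < d ->
  `|v (t0 + s) x0 - v t0 x0 - heat_speed * s| <= e * `|s|.
Proof.
move=> e0; have B1 : 0 < B + 1.
  by rewrite ltr_wpDl// (le_trans (w_ge0 (nseq_tuple n 0, nseq_tuple n 0)) (w_le _)).
have [d d0 H] := expR_time n t0_gt0 (sqr_ge0 L) (divr_gt0 e0 B1).
exists (Num.min d t0); first by rewrite lt_min d0.
move=> s; rewrite lt_min => /andP[sd st].
have ts : 0 < t0 + s by move: st; rewrite ltr_norml => /andP[]; lra.
have em0 : 0 <= e / (B + 1) * `|s| by rewrite mulr_ge0// ltW// divr_gt0.
have := @heat_mean_expand R n w r B w_meas w_ge0 w_le t0 x0 t0_gt0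
  (fun p => expR (heat_exponent t0 x0 (t0 + s) x0 p))
  [:: (1, fun=> 1); (s, fun p => enorm (x0 - cvec p) ^+ 2 / (2 * t0 ^+ 2) - n%:R / t0)] _ em0.
rewrite -(heat_potential_mean w r x0 t0_gt0)// -/v !big_cons !big_nil/=.
rewrite -(heat_potential_mean1 w r t0 x0) -/v -/mean -/heat_speed mul1r addr0 opprD addrA [s * _]mulrC.
move=> K; apply: le_trans (K _ _ _) _; last first.
- by rewrite mulrAC ler_wpM2r// -mulrA [_ * B]mulrC mulrA ler_pdivrMr// ler_pM2l// lerDl.
- move=> p Dp; rewrite !big_cons big_nil mul1r addr0; apply: H => //.
  rewrite sqr_ge0/= ler_sqr ?nnegrE ?enorm_ge0//; exact: DL.
- refine (conj (bC _) (conj _ I)).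
  apply: bD; last exact: bC.
  by apply: bM; [exact: bounded_measurable_sqr_enorm|exact: bC].
- apply: bounded_measurable_expR; exact: bounded_measurable_heat_exponent.
Qed.

Lemma heat_potential_continuous e : 0 < e -> exists2 d : R, 0 < d & forall t x, 0 < t ->
  `|t - t0| < d -> enorm (x - x0) < d -> `|v t x - v t0 x0| < e.
Proof.
move=> e0; have B1 : 0 < B + 1.
  by rewrite ltr_wpDl// (le_trans (w_ge0 (nseq_tuple n 0, nseq_tuple n 0)) (w_le _)).
have e20 : 0 < e / (B + 1) by exact: divr_gt0.
have [r1 r10 H1] := expR_small e20.
have C0 : 0 <= 2 * L + 1 by rewrite addr_ge0 ?mulr_ge0.
have [d d0 H] := heat_exponent_small n t0_gt0 (sqr_ge0 L) C0 (divr_gt0 r10 (ltr0Sn _ 1)).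
exists (Num.min 1 d); first by rewrite lt_min ltr01.
move=> t x t_gt0; rewrite !lt_min => /andP[_ td] /andP[x1 xd].
have em0 : 0 <= e / (B + 1) by exact: ltW.
have := @heat_mean_expand R n w r B w_meas w_ge0 w_le t0 x0 t0_gt0
  (fun p => expR (heat_exponent t0 x0 t x p)) [:: (1, fun=> 1)] _ em0.
rewrite -(heat_potential_mean w r x0 t0_gt0)// -/v !big_cons !big_nil/=.
rewrite -(heat_potential_mean1 w r t0 x0) -/v mul1r addr0.
move=> K; apply: le_lt_trans (K _ _ _) _; last first.
- by rewrite mulrAC ltr_pdivrMr// ltr_pM2l// ltrDl.
- move=> p Dp; rewrite !big_cons big_nil mul1r addr0; apply: H1.
  apply: (@le_lt_trans _ _ (r1 / 2)); last by rewrite ltr_pdivrMr// ltr_pMr// ltr1n.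
  apply: (H _ _ _ (enorm (x - x0))) => //.
  + by rewrite sqr_ge0/= ler_sqr ?nnegrE ?enorm_ge0//; exact: DL.
  + by rewrite enorm_ge0.
  set a := enorm (x - cvec p); set b := enorm (x0 - cvec p); set h := enorm (x - x0).
  have ab : `|a - b| <= h.
    rewrite ler_norml /a /b /h; have := lerB_enorm (x - cvec p) (x0 - cvec p).
    have := lerB_enorm (x0 - cvec p) (x - cvec p).
    rewrite (_ : x0 - cvec p - (x - cvec p) = x0 - x); last by rewrite opprB addrA subrK.
    rewrite (_ : x - cvec p - (x0 - cvec p) = x - x0); last by rewrite opprB addrA subrK.
    by rewrite (enormB x0 x) => ? ?; apply/andP; split; lra.
  have a0 : 0 <= a by exact: enorm_ge0.
  have b0 : 0 <= b by exact: enorm_ge0.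
  have bL : b <= L by exact: DL.
  have -> : a ^+ 2 - b ^+ 2 = (a + b) * (a - b) by ring.
  rewrite normrM ger0_norm ?addr_ge0// ler_pM ?addr_ge0//.
  by move: ab x1; rewrite ler_norml -/h; lra.
- exact: (conj (bC _) I).
- apply: bounded_measurable_expR; exact: bounded_measurable_heat_exponent.
Qed.

End heat_potential_calculus.

(** * Regularity of theta and distance to the zero set *)

Section theta_regularity.
Context {R : realType} {M : nat} (c la : 'I_M -> R).
Hypothesis la_gt0 : forall j, 0 < la j.
Implicit Types (s t tau e : R).

Lemma theta_lip t a b : 0 <= t -> 0 <= a -> 0 <= b ->
  `|theta c la t a - theta c la t b| <= (\sum_j `|c j| * la j) * `|a - b|.
Proof.
move=> t0; wlog : a b / a <= b => [W a0 b0|ab a0 _].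
  by have [ab|/ltW ba] := leP a b; [exact: W|rewrite distrC (distrC a); exact: W].
move: ab; rewrite le_eqVlt => /predU1P[<-|ab]; first by rewrite !subrr normr0 mulr0.
have cont : {within `[a, b], continuous (theta c la t)}.
  apply: derivable_within_continuous => s _.
  by have [] := is_derive_theta c la t s.
have [|s] := MVT ab _ cont (df := theta1 c la t).
  by move=> s _; exact: is_derive_theta.
rewrite in_itv/= => /andP[/ltW s0 _] E; rewrite distrC E normrM (distrC a) ler_wpM2r//.
apply: le_trans (ler_norm_sum _ _ _) _; apply: ler_sum => j _.
have h0 := heat_factor_gt0 (la_gt0 j) t0.
have h1 : heat_factor (la j) t <= 1.
  rewrite invf_le1; first by rewrite lerDl !mulr_ge0// ltW.
  by rewrite ltr_wpDr// !mulr_ge0// ltW.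
rewrite normrN 3!normrM (gtr0_norm (la_gt0 j)) (ger0_norm (expR_ge0 _)) (gtr0_norm (exprn_gt0 _ h0)).
rewrite -[leLHS]mulrA; apply: ler_piMr; first by rewrite mulr_ge0 ?(ltW (la_gt0 j)).
apply: mulr_ile1; rewrite ?expR_ge0 ?exprn_ge0 ?(ltW h0)//.
  by rewrite exprn_ile1// ltW.
rewrite -expR0 ler_expR oppr_le0 mulr_ge0 ?(le_trans a0 s0)//.
by rewrite mulr_ge0 ?(ltW h0) ?(ltW (la_gt0 j)).
Qed.

Lemma measurable_theta t : measurable_fun setT (theta c la t).
Proof.
apply: continuous_measurable_fun => s; apply/differentiable_continuous/derivable1_diffP.
by have [] := is_derive_theta c la t s.
Qed.

End theta_regularity.

Section distance_to_zeros.
Context {R : realType} {n : nat} (f : 'rV[R[i]]_n -> R[i]).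
Hypotheses (f_holo : holomorphic f) (f_zero : exists p, f p = 0).
Implicit Types x y p q : 'rV[R[i]]_n.

(** The zero set is closed, and only its part in a closed ball matters. *)
Lemma nearest_zero x : exists p, f p = 0 /\ forall q, f q = 0 -> enorm (x - p) <= enorm (x - q).
Proof.
have [p0 fp0] := f_zero; pose r := enorm x + enorm (x - p0).
have cA : compact ([set q | enorm q <= r] `&` f @^-1` [set 0]).
  apply: (subclosed_compact _ (@compact_enorm_ball R n r)); last exact: subIsetl.
  apply: closedI; first by apply: compact_closed; [exact: norm_hausdorff|exact: compact_enorm_ball].
  apply: preimage_closed.
    by move=> y _; exact/differentiable_continuous/f_holo.
  apply: (compact_closed (@norm_hausdorff _ _)); exact: compact_set1.
have cont : {within [set q | enorm q <= r] `&` f @^-1` [set 0], continuous (fun q => enorm (x - q))}.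
  apply: continuous_in_subspaceT => q _; apply: continuous_at_dist => e e0.
  apply/nbhs_enormP; exists e => // q' qe; apply: le_lt_trans qe.
  have E1 : x - q - (x - q') = q' - q by rewrite opprB addrC addrA subrK.
  have E2 : x - q' - (x - q) = q - q' by rewrite opprB addrC addrA subrK.
  have := lerB_enorm (x - q) (x - q'); have := lerB_enorm (x - q') (x - q).
  by rewrite E1 E2 (enormB q) ler_norml => ? ?; apply/andP; split; lra.
have inball q : enorm (x - q) <= enorm (x - p0) -> enorm q <= r.
  move=> xq; have -> : q = x - (x - q) by rewrite opprB addrC subrK.
  by apply: le_trans (enormD _ _) _; rewrite enormN lerD2l.
have [|p] := compact_EVT_min _ cA cont.
  by exists p0; split => //=; exact: inball.
rewrite inE => -[/= pr fp] H; exists p; split => // q fq.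
have [qp|/ltW qp] := leP (enorm (x - q)) (enorm (x - p0)).
  by apply: H; rewrite inE; split => //=; exact: inball.
by apply: le_trans _ qp; apply: H; rewrite inE; split => //=; exact: inball.
Qed.

Lemma zero_dist_exists : {d : 'rV[R[i]]_n -> R | forall x,
  (exists2 p, f p = 0 & d x = enorm (x - p)) /\ forall q, f q = 0 -> d x <= enorm (x - q)}.
Proof.
exists (fun x => enorm (x - sval (cid (nearest_zero x)))) => x.
by case: cid => p [fp H] /=; split => //; exists p.
Qed.

(** The characterization of the distance is kept opaque: two of its values are
    then never compared by unfolding the choice of a nearest zero. *)
Definition zero_dist : 'rV[R[i]]_n -> R := sval zero_dist_exists.

Lemma zero_distP x : exists2 p, f p = 0 & zero_dist x = enorm (x - p).
Proof. exact: (svalP zero_dist_exists x).1. Qed.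

Lemma zero_dist_le x q : f q = 0 -> zero_dist x <= enorm (x - q).
Proof. exact: (svalP zero_dist_exists x).2. Qed.

Lemma zero_dist_ge0 x : 0 <= zero_dist x.
Proof. by have [p _ ->] := zero_distP x; exact: enorm_ge0. Qed.

Lemma zero_dist_lip x y : zero_dist x - zero_dist y <= enorm (x - y).
Proof.
have [p fp ->] := zero_distP y; rewrite lerBlDr (le_trans (zero_dist_le x fp))//.
have -> : x - p = (x - y) + (y - p) by rewrite addrA subrK.
exact: enormD.
Qed.

Lemma zero_dist_distr x y : `|zero_dist x - zero_dist y| <= enorm (x - y).
Proof.
by rewrite ler_norml zero_dist_lip andbT lerNl opprB enormB zero_dist_lip.
Qed.

Lemma dist0_zeros : dist0 (f @^-1` [set 0]) = zero_dist 0.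
Proof.
have [p fp pE] := zero_distP 0; rewrite sub0r enormN in pE.
apply/eqP; rewrite eq_le; apply/andP; split.
  rewrite pE; apply: ge_inf; last by exists p.
  by exists 0 => _ [z _ <-]; exact: enorm_ge0.
apply: lb_le_inf; first by exists (enorm p), p.
by move=> _ [z fz <-]; have := zero_dist_le 0 fz; rewrite sub0r enormN.
Qed.

(** Otherwise [f] would vanish near the origin, hence on the complex line through
    the origin and [y] by the identity principle. *)
Lemma nonzero_near y e : f y != 0 -> 0 < e -> exists2 x, enorm x < e & f x != 0.
Proof.
move=> fy e0; apply: contrapT => H; move/negP: fy; apply; apply/eqP.
have E x : enorm x < e -> f x = 0.
  by move=> xe; apply/eqP; apply: contra_notT H => fx; exists x.
have y1 : 0 < enorm y + 1 by rewrite ltr_wpDl ?enorm_ge0.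
have := @identity_principle R (fun z => f (0 + z *: y)) (e / (enorm y + 1)) (divr_gt0 e0 y1).
move=> /(_ _ _ 1); rewrite add0r scale1r; apply.
  by move=> z; apply: cdiff_line; exact: f_holo.
move=> z; rewrite ltr_pdivlMr// => ze; apply: E; rewrite add0r enormZ.
by apply: le_lt_trans ze; rewrite ler_wpM2l ?cabs_ge0// lerDl.
Qed.

End distance_to_zeros.

(** * Comparison by the maximum principle *)

Section joint_continuity.
Context {R : realType} {n : nat}.
Implicit Types (g h : R -> 'rV[R[i]]_n -> R) (x y : 'rV[R[i]]_n) (s t e : R).

Definition continuous_txat g t x := forall e, 0 < e -> exists2 d : R, 0 < d &
  forall s y, `|s - t| < d -> enorm (y - x) < d -> `|g s y - g t x| < e.

Lemma continuous_txatD g h t x : continuous_txat g t x -> continuous_txat h t x ->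
  continuous_txat (fun s y => g s y + h s y) t x.
Proof.
move=> cg ch e e0; have e20 : 0 < e / 2 by exact: divr_gt0.
have [d1 d10 H1] := cg _ e20; have [d2 d20 H2] := ch _ e20.
exists (Num.min d1 d2); first by rewrite lt_min d10.
move=> s y; rewrite !lt_min => /andP[s1 s2] /andP[y1 y2].
have -> : g s y + h s y - (g t x + h t x) = (g s y - g t x) + (h s y - h t x) by ring.
by apply: le_lt_trans (ler_normD _ _) _; rewrite [e]splitr ltrD ?H1 ?H2.
Qed.

Lemma continuous_txatZ g k t x : continuous_txat g t x -> continuous_txat (fun s y => k * g s y) t x.
Proof.
move=> cg e e0; have k1 : 0 < `|k| + 1 by rewrite ltr_wpDl.
have [d d0 H] := cg _ (divr_gt0 e0 k1); exists d => // s y sd yd.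
rewrite -mulrBr normrM; have := H s y sd yd; rewrite ltr_pdivlMr// mulrC; apply: le_lt_trans.
by rewrite ler_wpM2r// lerDl.
Qed.

(** The maximum principle is applied on a cylinder, where the maximum exists. *)
Lemma compact_argmax g a b r : 0 <= r -> a <= b ->
  (forall t x, a <= t <= b -> continuous_txat g t x) ->
  exists t x, [/\ a <= t <= b, enorm x <= r &
    forall s y, a <= s <= b -> enorm y <= r -> g s y <= g t x].
Proof.
move=> r0 ab cg.
pose A := `[a, b]%classic `*` [set x : 'rV[R[i]]_n | enorm x <= r].
have cA : compact A.
  by apply: compact_setX; [exact: segment_compact|exact: compact_enorm_ball].
have cont : {within A, continuous (fun p => g p.1 p.2)}.
  apply: continuous_in_subspaceT => -[t x]; rewrite inE => -[/=]; rewrite in_itv/= => tab _.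
  apply: continuous_at_dist => e e0; have [d d0 H] := cg t x tab e e0.
  exists (ball t d, [set y | enorm (y - x) < d]) => /=.
    by split; [exact: nbhsx_ballx|apply/nbhs_enormP; exists d].
  by move=> [s y] /= [sd yd]; rewrite /ball/= distrC in sd; exact: H.
have [|[t x]] := compact_EVT_max _ cA cont.
  by exists (a, 0); split; rewrite /= ?in_itv/= ?lexx ?ab// enorm0.
rewrite inE => -[/=]; rewrite in_itv/= => tab xr H; exists t, x; split=> // s y sab yr.
by apply: (H (s, y)); rewrite inE; split; rewrite /= ?in_itv.
Qed.

End joint_continuity.

Section comparison.
Context {R : realType} {n : nat} (f : 'rV[R[i]]_n -> R[i]).
Hypotheses (f_holo : holomorphic f) (f_zero : exists p, f p = 0).
Context {M : nat} (c la : 'I_M -> R).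
Hypothesis la_gt0 : forall j, 0 < la j.
Hypothesis theta1_neg : forall t tau, 0 <= t -> 0 <= tau -> theta1 c la t tau < 0.
Hypothesis theta0_ge0 : forall tau, 0 <= tau -> 0 <= theta c la 0 tau.
Local Notation coords := (n.-tuple (measurableTypeR R) * n.-tuple (measurableTypeR R))%type.
Local Notation th := (theta c la).
Local Notation rho := (zero_dist f_holo f_zero).
Implicit Types (x y p q : 'rV[R[i]]_n) (s t e : R).

Let C : R := \sum_j `|c j|.
Let K : R := \sum_j `|c j| * la j.
Let C0 : 0 <= C. Proof. by apply: sumr_ge0. Qed.
Let K0 : 0 <= K. Proof. by apply: sumr_ge0 => j _; rewrite mulr_ge0// ltW. Qed.
Let thC t tau : 0 <= t -> 0 <= tau -> th t tau <= C.
Proof. by move=> t0 tau0; rewrite (le_trans (ler_norm _))// theta_bound. Qed.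
Let rho2_ge0 x : 0 <= rho x ^+ 2. Proof. exact: sqr_ge0. Qed.

Definition dist_profile (p : coords) : R := th 0 (rho (cvec p) ^+ 2).

Lemma measurable_dist_profile : measurable_fun setT dist_profile.
Proof.
apply: (@measurableT_comp _ _ _ _ _ _ (th 0)); first exact: measurable_theta.
apply: measurable_funX; apply: measurable_lipschitz => x y; exact: zero_dist_lip.
Qed.

Let w_ge0 (p : coords) : 0 <= dist_profile p. Proof. exact: theta0_ge0. Qed.
Let w_le (p : coords) : dist_profile p <= C. Proof. exact: thC. Qed.

Lemma sqr_zero_dist_lip x y r : rho x <= r -> rho y <= r ->
  `|rho x ^+ 2 - rho y ^+ 2| <= 2 * r * enorm (x - y).
Proof.
move=> xr yr; rewrite subr_sqr [_ * (_ + _)]mulrC.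
have x0 := zero_dist_ge0 f_holo f_zero x; have y0 := zero_dist_ge0 f_holo f_zero y.
rewrite normrM ger0_norm ?addr_ge0// ler_pM ?addr_ge0//; last exact: zero_dist_distr.
by rewrite mulr_natl mulr2n lerD.
Qed.

Lemma zero_dist_bound x y : rho y <= rho x + enorm (y - x).
Proof. by have := zero_dist_lip f_holo f_zero y x; rewrite lerBlDl. Qed.

(** At time [0] both sides of the comparison agree, and both move little in a short
    time, uniformly on balls: [theta] by [theta_time_lip], the potential by the
    concentration of the heat kernel. *)
Lemma initial_layer eta r : 0 < eta -> 0 <= r -> exists2 t, 0 < t < 1 &
  forall x, enorm x <= r -> th t (rho x ^+ 2) - heat_potential dist_profile (r + 1) t x <= eta.
Proof.
move=> eta0 r0.
(* [P] bounds the distances to the zero set in the ball of radius [r + 1] *)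
pose P := rho 0 + r + 1; pose K2 := 2 * (P ^+ 2 * \sum_j `|c j| * la j ^+ 2 + K).
have P0 : 0 <= P by rewrite !addr_ge0 ?zero_dist_ge0.
have K20 : 0 <= K2.
  rewrite mulr_ge0// addr_ge0// mulr_ge0 ?sqr_ge0//.
  by apply: sumr_ge0 => j _; rewrite mulr_ge0// sqr_ge0.
have eta3 : 0 < eta / 3 by exact: divr_gt0.
(* [th 0 (rho x ^+ 2)] varies by at most [eta / 3] within distance [e] *)
pose e := Num.min 1 (eta / 3 / (K * (2 * P) + 1)).
have KP : 0 < K * (2 * P) + 1 by rewrite ltr_wpDl// !mulr_ge0.
have e0 : 0 < e by rewrite lt_min ltr01 divr_gt0.
have e1 : e <= 1 by rewrite ge_min lexx.
have eP : K * (2 * P * e) <= eta / 3.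
  apply: (@le_trans _ _ ((K * (2 * P) + 1) * e)); first by rewrite mulrA ler_wpM2r ?(ltW e0)// lerDl.
  by rewrite mulrC -ler_pdivlMr// ge_min lexx orbT.
pose D := C * 2 ^+ n * 4 + 1; have D0 : 0 < D by rewrite ltr_wpDl// !mulr_ge0// exprn_ge0.
(* the variation of [th] in time and the mass of the kernel off the ball of radius
   [e] each cost at most [eta / 3] *)
pose t := Num.min (1 / 2) (Num.min (eta / 3 / (K2 + 1)) (eta / 3 * e ^+ 2 / D)).
have t0 : 0 < t.
  rewrite !lt_min; apply/and3P; split; first by rewrite divr_gt0.
    by rewrite divr_gt0// ltr_wpDl.
  by rewrite divr_gt0// mulr_gt0// exprn_gt0.
exists t; first by rewrite t0/= gt_min; apply/orP; left; lra.
move=> x xr.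
have rx : rho x <= P.
  have := zero_dist_bound 0 x; rewrite subr0 /P; lra.
have tK : K2 * t <= eta / 3.
  apply: (@le_trans _ _ ((K2 + 1) * t)); first by rewrite ler_wpM2r ?(ltW t0)// lerDl.
  by rewrite mulrC -ler_pdivlMr ?ltr_wpDl// !ge_min lexx !orbT.
have tD : C * (2 ^+ n * expR (- (e ^+ 2 / 4 * t^-1))) <= eta / 3.
  have a0 : 0 < e ^+ 2 / 4 * t^-1 by rewrite mulr_gt0 ?invr_gt0// divr_gt0// exprn_gt0.
  apply: (@le_trans _ _ (C * (2 ^+ n * (e ^+ 2 / 4 * t^-1)^-1))).
    rewrite ler_wpM2l// ler_wpM2l ?exprn_ge0// expRN lef_pV2 ?posrE ?expR_gt0//.
    by apply: le_trans (expR_ge1Dx _); rewrite lerDr.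
  have -> : C * (2 ^+ n * (e ^+ 2 / 4 * t^-1)^-1) = C * 2 ^+ n * 4 * t / e ^+ 2.
    by field; rewrite !gt_eqF.
  rewrite ler_pdivrMr ?exprn_gt0//; apply: (@le_trans _ _ (D * t)).
    by rewrite ler_wpM2r ?(ltW t0)// lerDl.
  by rewrite mulrC -ler_pdivlMr// !ge_min lexx !orbT.
pose m := Num.max 0 (th 0 (rho x ^+ 2) - K * (2 * P * e)).
have m0 : 0 <= m by rewrite le_max lexx.
have mC : m <= C.
  rewrite ge_max C0/=; apply: le_trans (thC (lexx 0) (rho2_ge0 x)); rewrite gerBl.
  by rewrite !mulr_ge0// ltW.
have := @heat_potential_ge R n dist_profile (r + 1) C measurable_dist_profile w_ge0 w_le t x e m t0 (ltW e0) m0.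
move=> /(_ _ _) V.
have {V} V : m * (1 - 2 ^+ n * expR (- (e ^+ 2 / 4 * t^-1))) <= heat_potential dist_profile (r + 1) t x.
  apply: V; first by rewrite lerD.
  move=> p xpe; rewrite ge_max w_ge0/= lerBlDr -lerBlDl.
  have rp : rho (cvec p) <= P.
    have := zero_dist_bound x (cvec p); have := zero_dist_bound 0 x.
    by rewrite subr0 (enormB (cvec p)) /P; lra.
  apply: le_trans (ler_norm _) _; apply: le_trans (theta_lip _ la_gt0 (lexx 0) (rho2_ge0 x) (rho2_ge0 (cvec p))) _.
  rewrite ler_wpM2l//; apply: le_trans (sqr_zero_dist_lip rx rp) _.
  by rewrite ler_wpM2l// mulr_ge0.
have T := @theta_time_lip R M c la la_gt0 (P ^+ 2) t (rho x ^+ 2) (ltW t0).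
have {}T : th t (rho x ^+ 2) - th 0 (rho x ^+ 2) <= K2 * t.
  apply: le_trans (ler_norm _) (T _); rewrite rho2_ge0/= ler_sqr ?nnegrE//; exact: zero_dist_ge0.
have mT : m - C * (2 ^+ n * expR (- (e ^+ 2 / 4 * t^-1))) <= m * (1 - 2 ^+ n * expR (- (e ^+ 2 / 4 * t^-1))).
  by rewrite mulrBr mulr1 lerD2l lerN2 ler_wpM2r// mulr_ge0 ?exprn_ge0 ?expR_ge0.
have m1 : th 0 (rho x ^+ 2) - K * (2 * P * e) <= m by rewrite le_max lexx orbT.
by lra.
Qed.

Lemma continuous_theta_zero_dist t x : 0 < t -> continuous_txat (fun s y => th s (rho y ^+ 2)) t x.
Proof.
move=> t0 e e0; have e20 : 0 < e / 2 by exact: divr_gt0.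
have [d1 d10 H1] : exists2 d : R, 0 < d & forall s, `|s - t| < d -> `|th s (rho x ^+ 2) - th t (rho x ^+ 2)| < e / 2.
  apply: continuous_eps e20.
  apply/differentiable_continuous/derivable1_diffP.
  by have [] := is_derive_theta_time c la_gt0 (rho x ^+ 2) (ltW t0).
pose P := rho x + 1; have P0 : 0 < P by rewrite ltr_wpDl ?zero_dist_ge0.
have KP : 0 < K * (2 * P) + 1 by rewrite ltr_wpDl// !mulr_ge0// ltW.
exists (Num.min t (Num.min d1 (Num.min 1 (e / 2 / (K * (2 * P) + 1))))).
  by rewrite !lt_min t0 d10 ltr01 divr_gt0.
move=> s y; rewrite !lt_min => /andP[st /andP[sd _]] /andP[_ /andP[_ /andP[y1 ye]]].
have s0 : 0 <= s by move: st; rewrite ltr_norml => /andP[]; lra.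
rewrite -(subrKA (th s (rho x ^+ 2))).
apply: le_lt_trans (ler_normD _ _) _; rewrite [e]splitr; apply: ler_ltD; last exact: H1.
apply: le_trans (theta_lip _ la_gt0 s0 (rho2_ge0 y) (rho2_ge0 x)) _.
have xP : rho x <= P by rewrite lerDl.
have yP : rho y <= P by have := zero_dist_bound x y; rewrite /P; lra.
apply: (@le_trans _ _ (K * (2 * P * enorm (y - x)))).
  by rewrite ler_wpM2l//; exact: sqr_zero_dist_lip.
move: ye; rewrite ltr_pdivlMr// => /ltW; apply: le_trans.
by rewrite mulrA mulrC ler_wpM2l ?enorm_ge0// lerDl.
Qed.


Section barrier.
Context (r eps ep k : R).
Hypotheses (eps_gt0 : 0 < eps) (ep_gt0 : 0 < ep) (k_gt0 : 0 < k).
Let v := heat_potential dist_profile (r + 1).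

(** The term in [eps] makes the differential inequality strict and keeps the maximum
    away from the boundary of a large ball.  The logarithm keeps it away from the
    zero set, where [rho] vanishes and [line_touch] says nothing; it is
    truncated at the level [k] for the sake of continuity. *)
Definition barrier t x : R := th t (rho x ^+ 2) - v t x -
  eps * ((2 * n%:R + 1) * t + enorm x ^+ 2) + ep * ln (Num.max (cabs (f x)) k).

Let v_cont t x : 0 < t -> continuous_txat v t x.
Proof.
move=> t0 e e0; have [d d0 H] := heat_potential_continuous (r + 1) measurable_dist_profile w_ge0 w_le x t0 e0.
exists (Num.min t d); first by rewrite lt_min t0.
move=> s y; rewrite !lt_min => /andP[st sd] /andP[_ yd]; apply: H => //.
by move: st; rewrite ltr_norml => /andP[]; lra.
Qed.

Lemma continuous_barrier t x : 0 < t -> continuous_txat barrier t x.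
Proof.
move=> t0; apply: continuous_txatD; last first.
  apply: continuous_txatZ => e e0.
  have m0 : 0 < Num.max (cabs (f x)) k by rewrite lt_max k_gt0 orbT.
  have [d d0 H] := continuous_eps (continuous_ln m0) e0.
  have [d' d'0 H'] := holomorphic_continuous (@f_holo x) d0.
  exists d' => // s y _ yd; apply: H.
  apply: le_lt_trans (H' y yd); apply: le_trans (ler_dist_cabs _ _).
  rewrite ler_norml; have := ler_norm (cabs (f y) - cabs (f x)).
  have := ler_norm (cabs (f x) - cabs (f y)); rewrite distrC.
  set a := cabs (f x); set b := cabs (f y) => H1 H2.
  have ab := normr_ge0 (b - a).
  by rewrite /Num.max; case: ltP => ?; case: ltP => ?; apply/andP; split; lra.
have E : (fun s y => th s (rho y ^+ 2) - v s y - eps * ((2 * n%:R + 1) * s + enorm y ^+ 2)) =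
    (fun s y => th s (rho y ^+ 2) + (-1) * v s y + (- eps) * ((2 * n%:R + 1) * s + enorm y ^+ 2)).
  by apply/funext => s; apply/funext => y; rewrite mulN1r mulNr.
rewrite E; apply: continuous_txatD.
  by apply: continuous_txatD; [exact: continuous_theta_zero_dist|apply: continuous_txatZ; exact: v_cont].
apply: continuous_txatZ; apply: continuous_txatD.
  apply: continuous_txatZ => e e0; exists e => //.
move=> e e0; pose L := 2 * enorm x + 1.
have L1 : 0 < L by rewrite ltr_wpDl// mulr_ge0// enorm_ge0.
exists (Num.min 1 (e / L)); first by rewrite lt_min ltr01 divr_gt0.
move=> s y _; rewrite lt_min => /andP[y1 ye]; rewrite ltr_pdivlMr// in ye.
apply: le_lt_trans ye; rewrite subr_sqr normrM.
have yx : `|enorm y - enorm x| <= enorm (y - x).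
  by rewrite ler_norml lerB_enorm andbT lerNl opprB enormB lerB_enorm.
apply: ler_pM => //; rewrite ger0_norm ?addr_ge0 ?enorm_ge0//.
by rewrite /L; move: (lerB_enorm y x); lra.
Qed.

(** At such a maximum, [theta] grows in time at least as fast as [v] plus
    [eps * (2 * n%:R + 1)].  On the other hand, [line_touch] in each of the [n] complex
    directions, summed up, bounds half the Laplacian of [v] from below by that of
    the model solution [theta], with a loss of [2 * n%:R * eps] only.  Both [v] and
    [theta] solve the heat equation, a contradiction. *)
Lemma no_interior_max t1 t x : 0 < t1 -> t1 < t -> enorm x < r -> k < cabs (f x) ->
  ~ (forall s y, t1 <= s <= t -> enorm y <= r -> barrier s y <= barrier t x).
Proof.
move=> t10 t1t xr kf H; have t0 : 0 < t := lt_trans t10 t1t.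
have fx : f x != 0 by rewrite -cabs_gt0 (lt_trans k_gt0).
have [p fp px] := zero_distP f_holo f_zero x.
set tau := enorm (x - p) ^+ 2.
have tauE : rho x ^+ 2 = tau by rewrite px.
have tau0 : 0 < tau.
  rewrite exprn_gt0// lt_def enorm_ge0 andbT; apply: contraNneq fx => E.
  have xp j : x 0 j = p 0 j.
    apply/eqP; rewrite -subr_eq0 -cabs_eq0 eq_le cabs_ge0 andbT -E.
    by have := cabs_le_enorm (x - p) j; rewrite !mxE.
  by rewrite (_ : x = p) ?fp//; apply/rowP => j; exact: xp.
pose T := tau * theta2 c la t tau + theta1 c la t tau.
pose V := heat_speed dist_profile (r + 1) t x.
have time : V + eps * (2 * n%:R + 1) <= 2 * T.
  apply/ler_addgt0Pr => e e0; have e20 : 0 < e / 2 by exact: divr_gt0.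
  have [d1 d10 H1] := is_derive_eps (is_derive_theta_time c la_gt0 tau (ltW t0)) e20.
  have [d2 d20 H2] := heat_potential_time (r + 1) measurable_dist_profile w_ge0 w_le x t0 e20.
  pose s := Num.min (t - t1) (Num.min d1 d2) / 2.
  have m0 : 0 < Num.min (t - t1) (Num.min d1 d2) by rewrite !lt_min subr_gt0 t1t d10.
  have s0 : 0 < s by exact: divr_gt0.
  have sm : s < Num.min (t - t1) (Num.min d1 d2) by rewrite ltr_pdivrMr// ltr_pMr// ltr1n.
  move: sm; rewrite !lt_min => /andP[st /andP[sd1 sd2]].
  have := H (t - s) x; rewrite (ltW xr) => /(_ _ isT) HH.
  have {HH} : barrier (t - s) x <= barrier t x by apply: HH; apply/andP; split; lra.
  have := H1 (- s); have := H2 (- s); rewrite normrN gtr0_norm// => /(_ sd2) B2 /(_ sd1) B1.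
  rewrite /barrier tauE -/v lerD2r.
  move: B2 B1; rewrite -/v -/T -/V !ler_norml.
  move: (th t tau) (th (t - s) tau) (v t x) (v (t - s) x) => a1 a2 b1 b2.
  move=> /andP[_ B2] /andP[B1 _] HH; rewrite -(ler_pM2r s0).
  have -> : (V + eps * (2 * n%:R + 1)) * s = V * s + eps * (2 * n%:R + 1) * s by ring.
  by move: (n%:R : R) B1 B2 HH => n' B1 B2 HH; lra.
have space j : 4 * tau * T * cabs ((x - p) 0 j) ^+ 2 / (4 * tau ^+ 2) <=
    heat_laplacian dist_profile (r + 1) t x j + eps.
  set b1 := heat_first_re dist_profile (r + 1) t x j; set b2 := heat_first_im dist_profile (r + 1) t x j.
  set g1 := heat_second_re dist_profile (r + 1) t x j; set g2 := heat_second_im dist_profile (r + 1) t x j.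
  set ka := heat_laplacian _ _ _ _ _.
  apply: (@line_touch R n f x p j (th t) (theta1 c la t tau) _ _ ep
    ((b1 +i* b2) + (2 * eps)%:C * (x 0 j)^*) (g1 +i* g2) f_holo fp fx (ltW ep_gt0)).
  - by apply: theta1_neg; rewrite ltW.
  - by move=> s u s0 su; apply: theta_decreasing su => // w w0; apply: theta1_neg => //; exact: ltW.
  - by move=> e e0; exact: theta_taylor1.
  - by move=> e e0; exact: theta_taylor2.
  move=> e e0; have [d d0 HV] := heat_potential_line (r + 1) measurable_dist_profile w_ge0 w_le x t0 j e0.
  have [d2 d20 Hf] := holomorphic_continuous (@f_holo x) (ltac:(rewrite subr_gt0; exact: kf) : 0 < cabs (f x) - k).
  exists (Num.min d (Num.min d2 (r - enorm x))); first by rewrite !lt_min d0 d20 subr_gt0.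
  move=> z; rewrite !lt_min => /andP[zd /andP[zd2 zr]] q fq.
  set y := x + z *: delta_mx 0 j.
  have ed : enorm (z *: delta_mx 0 j : 'rV[R[i]]_n) = cabs z.
    have := enorm_sqr_line (0 : 'rV[R[i]]_n) z j.
    rewrite add0r enorm0 mxE rmorph0 mul0r /= mulr0 expr0n/= !add0r => /eqP.
    by rewrite eqrXn2 ?enorm_ge0 ?cabs_ge0// => /eqP.
  have yr : enorm y <= r by rewrite (le_trans (enormD _ _))// ed; lra.
  have fy : k < cabs (f y).
    have := Hf y; rewrite /y addrC addKr ed => /(_ zd2).
    by have := lerB_cabs (f x) (f y); rewrite /y addrC cabsB; lra.
  have HH : barrier t y <= barrier t x by apply: H yr; rewrite lexx andbT ltW.
  have thq : th t (enorm (y - q) ^+ 2) <= th t (rho y ^+ 2).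
    apply: theta_decreasing; first by move=> w w0; apply: theta1_neg => //; exact: ltW.
      exact: rho2_ge0.
    by rewrite ler_sqr ?nnegrE ?enorm_ge0 ?zero_dist_ge0// zero_dist_le.
  have := HV z zd; rewrite -/v -/b1 -/b2 -/g1 -/g2 -/ka -/y ler_norml => /andP[_ Hv].
  move: HH; rewrite /barrier tauE -/v !max_l ?(ltW fy) ?(ltW kf)//.
  have -> : enorm y ^+ 2 = enorm x ^+ 2 + 2 * Re ((x 0 j)^* * z) + cabs z ^+ 2 by exact: enorm_sqr_line.
  have -> : Re ((b1 +i* b2 + (2 * eps)%:C * (x 0 j)^*) * z) =
      Re ((b1 +i* b2) * z) + 2 * eps * Re ((x 0 j)^* * z).
    by rewrite mulrDl ReD -mulrA ReZ.
  rewrite -/tau.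
  move: Hv thq; set R1 := Re _; set R2 := Re _; set R3 := Re _; set Z := cabs z ^+ 2.
  set lx := ln _; set ly := ln _.
  move: (th t tau) (th t (rho y ^+ 2)) (th t (enorm (y - q) ^+ 2)) (v t x) (v t y) (enorm x ^+ 2).
  move=> a1 a2 a3 v1 v2 xx; move: (n%:R : R) => n' Hv thq HH.
  by lra.
have : \sum_j 4 * tau * T * cabs ((x - p) 0 j) ^+ 2 / (4 * tau ^+ 2) <=
    \sum_j (heat_laplacian dist_profile (r + 1) t x j + eps) by apply: ler_sum.
rewrite -mulr_suml -mulr_sumr -sqr_enorm -/tau big_split/= sumr_const card_ord -(mulr_natl eps).
have -> : 4 * tau * T * tau / (4 * tau ^+ 2) = T by field; rewrite gt_eqF.
have := heat_speedE (r + 1) measurable_dist_profile w_ge0 w_le x t0; rewrite -mulr_sumr -/V.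
move: (\sum_j _) => S VS TS; move: time; rewrite VS.
have absurd (a b e m : R) : 0 < e -> a <= b + m * e -> 2 * b + e * (2 * m + 1) <= 2 * a -> False.
  by lra.
exact: absurd eps_gt0 TS.
Qed.

End barrier.

(** A point where the inequality fails makes the barrier positive there, once [eps],
    the radius of the ball, [ep] and [k] have been chosen, in this order.  The
    maximum over the cylinder is then neither at the initial time, nor on the
    boundary of the ball, nor where the modulus of [f] is at most [k], so
    that [no_interior_max] applies. *)
Lemma comparison_off_zeros eta : 0 < eta -> exists r, forall x, enorm x <= 1 -> f x != 0 ->
  th 1 (rho x ^+ 2) <= heat_potential dist_profile r 1 x + eta.
Proof.

move=> eta0.
(* at time [1], for [enorm x <= 1], the term in [eps] is at most [eta / 4] *)
pose eps := eta / 4 / (2 * n%:R + 2).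
have n2 : 0 < 2 * n%:R + 2 :> R by rewrite ltr_wpDl// mulr_ge0.
have eps0 : 0 < eps by rewrite !divr_gt0.
(* at radius [r] the term in [eps] outweighs the bound [C] on [theta] *)
pose r := 2 + (C + eta) / eps.
have Ce : 0 < (C + eta) / eps by rewrite divr_gt0// ltr_wpDl.
have r2 : 2 < r by rewrite ltrDl.
have r0 : 0 < r by lra.
have epsr : C + eta <= eps * r ^+ 2.
  rewrite mulrC -ler_pdivrMr// expr2; apply: (@le_trans _ _ r); first by rewrite /r lerDr.
  by rewrite ler_peMl; lra.
exists (r + 1) => x x1 fx; rewrite leNgt; apply/negP => lt.
have cf : {within [set y | enorm y <= r], continuous (fun y => cabs (f y))}.
  apply: continuous_in_subspaceT => y _; apply: continuous_at_dist => e e0.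
  have [d d0 H] := holomorphic_continuous (@f_holo y) e0.
  apply/nbhs_enormP; exists d => // z /H; apply: le_lt_trans; exact: ler_dist_cabs.
have [|y0 _ fmax] := compact_EVT_max _ (@compact_enorm_ball R n r) cf.
  by exists 0; rewrite /= enorm0 ltW.
pose B := Num.max (cabs (f y0)) 1.
have B1 : 1 <= B by rewrite le_max lexx orbT.
have fB y : enorm y <= r -> cabs (f y) <= B.
  by move=> yr; rewrite le_max fmax// inE.
have fx0 : 0 < cabs (f x) by rewrite cabs_gt0.
(* the logarithmic term is at most [ep * La] on the ball, at least [- (ep * La)] at [x] *)
pose La := ln B + `|ln (cabs (f x))| + 1.
have lB : 0 <= ln B by rewrite ln_ge0.
have La0 : 0 < La by rewrite ltr_wpDl// addr_ge0.
pose ep := eta / 4 / La; have ep0 : 0 < ep by rewrite !divr_gt0.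
have epLa : ep * La = eta / 4 by rewrite /ep divfK// gt_eqF.
(* where [cabs (f y) <= k], the logarithmic term outweighs the bound on [theta] *)
pose k := Num.min (cabs (f x)) (expR (- ((C + eta) / ep))).
have k0 : 0 < k by rewrite lt_min fx0 expR_gt0.
have kx : k <= cabs (f x) by rewrite ge_min lexx.
have kl : ep * ln k <= - (C + eta).
  rewrite mulrC -ler_pdivlMr// mulNr -[leRHS]expRK ler_ln ?posrE ?expR_gt0//.
  by rewrite ge_min lexx orbT.
pose g := barrier r eps ep k.
have lgB y : enorm y <= r -> ep * ln (Num.max (cabs (f y)) k) <= eta / 4.
  move=> yr; rewrite -epLa ler_pM2l//.
  apply: (@le_trans _ _ (ln B)).
    have mk : 0 < Num.max (cabs (f y)) k by rewrite lt_max k0 orbT.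
    rewrite ler_ln ?posrE ?(lt_le_trans ltr01 B1)// ge_max fB//=.
    by apply: le_trans kx _; apply: fB; lra.
  by rewrite /La -addrA lerDl addr_ge0.
have lgx : - (eta / 4) <= ep * ln (Num.max (cabs (f x)) k).
  rewrite max_l// -epLa -mulrN ler_pM2l//.
  have := ler_norm (- ln (cabs (f x))); rewrite normrN /La; lra.
have gx : eta / 2 < g 1 x.
  have ex : eps * ((2 * n%:R + 1) * 1 + enorm x ^+ 2) <= eta / 4.
    have -> : eta / 4 = eps * (2 * n%:R + 2) by rewrite /eps divfK// gt_eqF.
    rewrite ler_pM2l// mulr1; have : enorm x ^+ 2 <= 1 by rewrite expr_le1// enorm_ge0.
    have aux (a b : R) : b <= 1 -> 2 * a + 1 + b <= 2 * a + 2 by lra.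
    exact: aux.
  move: lt lgx ex; rewrite /g /barrier.
  move: (th 1 _) (heat_potential _ _ _ _) (eps * _) (ep * _) => a1 a2 a3 a4; lra.
have eta8 : 0 < eta / 8 by exact: divr_gt0.
have [t1 /andP[t10 t11] H1] := initial_layer eta8 (ltW r0).
have [|t [y [/andP[tt1 t1' yr] gmax]]] := @compact_argmax R n g t1 1 r (ltW r0) (ltW t11).
  by move=> s z /andP[s1 _]; apply: continuous_barrier => //; exact: lt_le_trans t10 s1.
have gy : eta / 2 < g t y.
  by apply: lt_le_trans gx _; apply: gmax; [rewrite (ltW t11) lexx|lra].
have t0 : 0 < t := lt_le_trans t10 tt1.
have v0 := heat_potential_ge0 (r + 1) w_ge0 y t0.
have thy := thC (ltW t0) (rho2_ge0 y).
have q0 : 0 <= eps * ((2 * n%:R + 1) * t).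
  by rewrite mulr_ge0 ?(ltW eps0)// mulr_ge0 ?(ltW t0)// addr_ge0// mulr_ge0.
have q1 : 0 <= eps * enorm y ^+ 2 by rewrite mulr_ge0 ?sqr_ge0// ltW.
have gE : g t y = th t (rho y ^+ 2) - heat_potential dist_profile (r + 1) t y -
  (eps * ((2 * n%:R + 1) * t) + eps * enorm y ^+ 2) + ep * ln (Num.max (cabs (f y)) k).
  by rewrite /g /barrier mulrDr.
have lgy := lgB y yr.
have tlt : t1 < t.
  rewrite lt_neqAle tt1 andbT; apply/eqP => E.
  have := H1 y yr; rewrite E; move: gy; rewrite gE.
  move: q0 q1 lgy; move: (th _ _) (heat_potential _ _ _ _) (eps * _) (eps * _) (ep * _) => a1 a2 a3 a4 a5; lra.
have ylt : enorm y < r.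
  rewrite lt_neqAle yr andbT; apply/eqP => E.
  move: gy q0 q1 lgy v0 thy; rewrite gE E; move: epsr.
  move: (th _ _) (heat_potential _ _ _ _) (eps * _) (eps * _) (ep * _) => a1 a2 a3 a4 a5; lra.
have ky : k < cabs (f y).
  rewrite ltNge; apply/negP => yk; move: gy q0 q1 lgy v0 thy kl; rewrite gE max_r//.
  move: (th _ _) (heat_potential _ _ _ _) (eps * _) (eps * _) (ep * _) => a1 a2 a3 a4 a5; lra.
have NI := no_interior_max eps0 ep0 k0 t10 tlt ylt ky; apply: NI => s z /andP[s1 st].
by apply: gmax; rewrite s1 (le_trans st).
Qed.

(** The origin, which may be a zero, is approached by points where [f] does not
    vanish; both sides of [comparison_off_zeros] are continuous. *)
Lemma theta_le_gauss : (exists y, f y != 0) ->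
  ((th 1 (rho 0 ^+ 2))%:E <= \int[@lebesgue_cvec R n]_p (dist_profile p * gauss_density (cvec p))%:E)%E.
Proof.
move=> [y fy]; apply/lee_addgt0Pr => eta eta0.
have eta3 : 0 < eta / 3 by exact: divr_gt0.
have [r Hr] := comparison_off_zeros eta3.
apply: le_trans (leeD2r _ (heat_potential_le_gauss r measurable_dist_profile w_ge0 w_le)).
rewrite -EFinD lee_fin.
have [d1 d10 H1] := continuous_theta_zero_dist 0 ltr01 eta3.
have [d2 d20 H2] := heat_potential_continuous r measurable_dist_profile w_ge0 w_le 0 ltr01 eta3.
have m0 : 0 < Num.min 1 (Num.min d1 d2) by rewrite !lt_min ltr01 d10.
have [x + fx] := nonzero_near f_holo fy m0; rewrite !lt_min => /andP[x1 /andP[xd1 xd2]].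
have := Hr x (ltW x1) fx.
have := H1 1 x; rewrite subrr normr0 subr0 => /(_ d10 xd1).
have := H2 1 x ltr01; rewrite subrr normr0 subr0 => /(_ d20 xd2).
rewrite !ltr_norml; move: (th 1 _) (th 1 _) (heat_potential _ _ _ _) (heat_potential _ _ _ _) => a1 a2 a3 a4.
by move=> /andP[_ ?] /andP[? _] ?; lra.
Qed.

End comparison.

(** * Slabs and tubes *)

Section step_profiles.
Context {R : realType}.
Implicit Types (P : {poly R}) (b tau u e : R) (M : nat).

(** The weights and rates for which [theta 0] is a polynomial [P] without constant
    term, evaluated at [expR (- b * tau)]. *)
Definition poly_weight P M (j : 'I_M) : R := P`_j.+1.
Definition poly_rate b M (j : 'I_M) : R := b * j.+1%:R.

Lemma theta_poly P M b tau : (size P <= M.+1)%N -> P`_0 = 0 ->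
  theta (@poly_weight P M) (@poly_rate b M) 0 tau = P.[expR (- (b * tau))].
Proof.
move=> sP P0; rewrite (horner_coef_wide _ sP) big_ord_recl P0 mul0r add0r.
apply: eq_bigr => j _; rewrite /heat_factor mulr0 addr0 invr1 !mulr1 -expRM_natl; congr (_ * expR _).
by rewrite lift0 /poly_rate; ring.
Qed.

Lemma theta1_poly P M b tau : (size P <= M.+1)%N ->
  theta1 (@poly_weight P M) (@poly_rate b M) 0 tau =
  - (b * expR (- (b * tau)) * P^`().[expR (- (b * tau))]).
Proof.
move=> sP; have sP' : (size P^`() <= M)%N.
  have [->|P0] := eqVneq P 0; first by rewrite deriv0 size_poly0.
  by rewrite -ltnS (leq_trans (lt_size_deriv P0)).
rewrite (horner_coef_wide _ sP') /theta1 sumrN mulr_sumr; congr (- _).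
apply: eq_bigr => j _; rewrite coef_deriv /heat_factor mulr0 addr0 invr1 expr1n !mulr1.
rewrite /poly_weight /poly_rate -(mulr_natr P`_j.+1).
have -> : - (b * j.+1%:R * tau) = j.+1%:R * - (b * tau) by ring.
by rewrite expRM_natl exprS; ring.
Qed.

(** The linear term makes the profile strictly decreasing in [tau]. *)
Definition step_poly M e : {poly R} := 1 - (1 - 'X) ^+ M + e *: 'X.

Lemma horner_step_poly M e u : (step_poly M e).[u] = 1 - (1 - u) ^+ M + e * u.
Proof. by rewrite /step_poly !hornerE. Qed.

Lemma deriv_step_poly M e u : (step_poly M e)^`().[u] = M%:R * (1 - u) ^+ M.-1 + e.
Proof.
rewrite /step_poly derivD derivB derivC sub0r derivZ derivX deriv_exp derivB derivX derivC sub0r.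
rewrite hornerD hornerN hornerZ hornerMn hornerM horner_exp !hornerE.
by rewrite mulN1r mulNrn opprK mulr_natl.
Qed.

Lemma bernoulli M u : 0 <= u <= 1 -> 1 - (1 - u) ^+ M <= M%:R * u.
Proof.
move=> /andP[u0 u1]; elim: M => [|M IH]; first by rewrite expr0 subrr mul0r.
have : (1 - u) ^+ M <= 1 by rewrite exprn_ile1// ?subr_ge0// gerBl.
by rewrite exprS -natr1 => H; nra.
Qed.

(** The expression [1 - (1 - u) ^+ M] with [u = expR (- b * tau)] is close to [1] when
    [M * u] is large and to [0] when [M * u] is small; for large [b] and
    [M] of the order of [expR (b * a)], the transition takes place between [a] and
    [a']. *)
Lemma step_profile a a' e : 0 < a -> a < a' -> 0 < e -> e <= 1 ->
  exists M b, [/\ 0 < b,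
    forall tau, 0 <= tau -> 0 <= (step_poly M e).[expR (- (b * tau))] <= 1 + e,
    forall tau, 0 <= tau <= a -> 1 - e <= (step_poly M e).[expR (- (b * tau))] &
    forall tau, a' <= tau -> (step_poly M e).[expR (- (b * tau))] <= 2 * e].
Proof.
move=> a0 aa' e0 e1; have d0 : 0 < a' - a by rewrite subr_gt0.
(* [M * expR (- (b * tau))] is at least [e^-1] for [tau = a], at most [e] for [tau = a'] *)
pose b := 2 / e ^+ 2 / (a' - a); have b0 : 0 < b by rewrite !divr_gt0// exprn_gt0.
pose M := (Num.truncn (expR (b * a) / e)).+1.
have x0 : 0 <= expR (b * a) / e by rewrite divr_ge0 ?expR_ge0// ltW.
have M1 : expR (b * a) / e <= M%:R by apply/ltW; exact: truncnS_gt.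
have M2 : M%:R <= 2 * (expR (b * a) / e).
  rewrite /M -natr1; have := truncn_le (expR (b * a) / e); rewrite x0 => H.
  have : 1 <= expR (b * a) / e.
    rewrite ler_pdivlMr// mul1r (le_trans e1)// -expR0 ler_expR mulr_ge0// ltW//.
  by move: H; lra.
have u01 tau : 0 <= tau -> 0 <= expR (- (b * tau)) <= 1.
  by move=> t0; rewrite expR_ge0/= -expR0 ler_expR oppr_le0 mulr_ge0// ltW.
exists M, b; split => //.
- move=> tau t0; have /andP[u0 u1] := u01 _ t0; rewrite horner_step_poly.
  have p0 : 0 <= (1 - expR (- (b * tau))) ^+ M by rewrite exprn_ge0// subr_ge0.
  have p1 : (1 - expR (- (b * tau))) ^+ M <= 1 by rewrite exprn_ile1// ?subr_ge0// gerBl.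
  have eu : 0 <= e * expR (- (b * tau)) <= e by rewrite mulr_ge0 ?(ltW e0)//= ler_piMr// ltW.
  by move: p0 p1 eu; move: (_ ^+ M) (e * _) => A B ? ? /andP[? ?]; apply/andP; split; lra.
- move=> tau /andP[t0 ta]; have /andP[u0 u1] := u01 _ t0; rewrite horner_step_poly.
  have eu : 0 <= e * expR (- (b * tau)) by rewrite mulr_ge0// ltW.
  set u := expR _ in u0 u1 eu *.
  have Mu : e^-1 <= M%:R * u.
    apply: (@le_trans _ _ (expR (b * a) / e * u)); last by rewrite ler_wpM2r.
    rewrite mulrAC -expRD ler_peMl ?invr_ge0 ?(ltW e0)// -expR0 ler_expR.
    by rewrite subr_ge0 ler_pM2l.
  have Mu0 : 0 < M%:R * u by rewrite (lt_le_trans _ Mu)// invr_gt0.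
  have : (1 - u) ^+ M <= e.
    apply: (@le_trans _ _ (expR (- u) ^+ M)).
      by rewrite lerXn2r ?nnegrE ?expR_ge0 ?subr_ge0// expR_ge1Dx.
    rewrite -expRM_natl mulrN expRN -[leRHS]invrK lef_pV2 ?posrE ?expR_gt0 ?invr_gt0//.
    by apply: le_trans Mu _; apply: le_trans (expR_ge1Dx _); rewrite lerDr.
  by lra.
move=> tau ta; have t0 : 0 <= tau by rewrite (le_trans _ ta)// ltW// (lt_trans a0).
have uu := u01 _ t0; have /andP[u0 u1] := uu; rewrite horner_step_poly.
have := bernoulli M uu; set u := expR _ in u0 u1 *.
have eu : e * u <= e by rewrite ler_piMr// ltW.
have : M%:R * u <= e; last by lra.
apply: (@le_trans _ _ (2 * (expR (b * a) / e) * u)); first by rewrite ler_wpM2r.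
have ue : expR (b * a) * u <= (2 / e ^+ 2)^-1.
  rewrite -expRD; have -> : b * a + - (b * tau) = - (b * (tau - a)) by ring.
  rewrite expRN lef_pV2 ?posrE ?expR_gt0 ?divr_gt0 ?exprn_gt0//.
  apply: (@le_trans _ _ (b * (a' - a))); first by rewrite /b divfK// gt_eqF.
  apply: (@le_trans _ _ (b * (tau - a))); first by rewrite ler_pM2l// lerB.
  by apply: le_trans (expR_ge1Dx _); rewrite lerDr.
have -> : 2 * (expR (b * a) / e) * u = 2 / e * (expR (b * a) * u) by ring.
apply: (@le_trans _ _ (2 / e * (2 / e ^+ 2)^-1)); first by rewrite ler_pM2l// divr_gt0.
by rewrite le_eqVlt; apply/orP; left; apply/eqP; field; rewrite gt_eqF.
Qed.

End step_profiles.

Section slabs_and_tubes.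
Context {R : realType} {n : nat}.
Local Notation coords := (n.-tuple (measurableTypeR R) * n.-tuple (measurableTypeR R))%type.
Local Notation mu := (@lebesgue_cvec R n).
Local Notation ga p := (gauss_density (cvec p)).
Implicit Types (z q : 'rV[R[i]]_n) (p : coords) (s e : R).

Lemma hdotB z w q : hdot (z - w) q = hdot z q - hdot w q.
Proof. by rewrite /hdot -sumrB; apply: eq_bigr => j _; rewrite !mxE mulrBl. Qed.

Lemma cabs_hdot z q : cabs (hdot z q) <= enorm z * enorm q.
Proof.
apply: le_trans (cabs_sum _) _; apply: sum_le_enorm => j.
by rewrite cabsM cabs_conj.
Qed.

Lemma measurable_hdot (cc : R[i]) q : enorm q = 1 ->
  measurable_fun setT (fun p : coords => cabs (cc - hdot (cvec p) q)).
Proof.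
move=> q1; apply: (@measurable_lipschitz R n (fun z => cabs (cc - hdot z q))) => x y.
apply: le_trans (lerB_cabs _ _) _.
have -> : cc - hdot x q - (cc - hdot y q) = hdot (y - x) q by rewrite hdotB; ring.
by rewrite (le_trans (cabs_hdot _ _))// q1 mulr1 enormB.
Qed.

Lemma integral_gauss_density : (\int[mu]_p (ga p)%:E = 1)%E.
Proof.
rewrite -[RHS](integral_heat_kernel (0 : 'rV[R[i]]_n) ltr01); apply: eq_integral => p _.
by rewrite heat_kernel1 /gauss_density sub0r enormN.
Qed.

(** The model case of a complex hyperplane, in which the comparison is an
    equality. *)
Lemma integral_theta_hdot M (c la : 'I_M -> R) (cc : R[i]) q :
  (forall j, 0 < la j) -> enorm q = 1 ->
  (\int[mu]_p (theta c la 0 (cabs (cc - hdot (cvec p) q) ^+ 2) * ga p)%:E =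
   (theta c la 1 (cabs cc ^+ 2))%:E)%E.
Proof.
move=> la0 q1.
pose h j p := expR (- (la j * cabs (cc - hdot (cvec p) q) ^+ 2)) * ga p.
have h0 j p : 0 <= h j p by rewrite mulr_ge0 ?expR_ge0 ?gauss_density_ge0.
have hI j : (\int[mu]_p (h j p)%:E =
    ((1 + 2 * la j)^-1 * expR (- (la j / (1 + 2 * la j) * cabs cc ^+ 2)))%:E)%E.
  exact: integral_hdot_gauss.
have hm j : measurable_fun setT (h j).
  apply: measurable_funM; last exact: measurable_gauss_density.
  apply: measurableT_comp => //; apply: measurableT_comp => //.
  by apply: measurable_funM => //; apply: measurable_funX; exact: measurable_hdot.
have hint j : mu.-integrable setT (fun p => (h j p)%:E).
  apply/integrableP; split; first exact/measurable_EFinP.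
  under eq_integral => p _ do rewrite gee0_abs ?lee_fin//.
  by rewrite hI ltry.
under eq_integral => p _.
  rewrite /theta mulr_suml (eq_bigr (fun j => c j * h j p)); last first.
    by move=> j _; rewrite /h /heat_factor mulr0 addr0 invr1 !mulr1 mulrA.
  rewrite -sumEFin; under eq_bigr => j _ do rewrite EFinM.
  over.
rewrite integral_sum//; last by move=> j; exact: integrableZl.
rewrite /theta -sumEFin; apply: eq_bigr => j _.
by rewrite integralZl// hI -EFinM /heat_factor !mulr1 mulrA.
Qed.

Let gm D : measurable_fun D (fun p : coords => (ga p)%:E).
Proof. by apply/measurable_EFinP; apply: measurable_funTS; exact: measurable_gauss_density. Qed.

Let g0 p : (0 <= (ga p)%:E)%E. Proof. by rewrite lee_fin gauss_density_ge0. Qed.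

Let gZ (A : set coords) k : measurable A -> 0 <= k ->
  (\int[mu]_(p in A) (k%:E * (ga p)%:E) = k%:E * \int[mu]_(p in A) (ga p)%:E)%E.
Proof. by move=> mA k0; rewrite ge0_integralZl. Qed.

Lemma gauss_setC (A : set coords) : measurable A ->
  exists2 a : R, (\int[mu]_(p in A) (ga p)%:E = a%:E)%E &
    0 <= a <= 1 /\ (\int[mu]_(p in ~` A) (ga p)%:E = (1 - a)%:E)%E.
Proof.
move=> mA.
have : (\int[mu]_(p in A) (ga p)%:E + \int[mu]_(p in ~` A) (ga p)%:E = 1)%E.
  rewrite -integral_gauss_density -(setUv A) ge0_integral_setU//.
  - exact: measurableC.
  - exact/disj_setPRL.
have : (0 <= \int[mu]_(p in A) (ga p)%:E)%E by exact: integral_ge0.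
have : (0 <= \int[mu]_(p in ~` A) (ga p)%:E)%E by exact: integral_ge0.
case: (\int[mu]_(p in A) _)%E => [a| |]//=; case: (\int[mu]_(p in ~` A) _)%E => [b| |]//=.
rewrite !lee_fin => b0 a0 ab; have [E] : (a + b)%:E = 1%:E by rewrite EFinD.
by exists a => //; split; [apply/andP; split; lra|congr (_%:E); lra].
Qed.

Context (f : 'rV[R[i]]_n -> R[i]).
Hypotheses (f_holo : holomorphic f) (f_zero : exists z, f z = 0) (f_nz : exists y, f y != 0).
Local Notation rho := (zero_dist f_holo f_zero).

Let rho_meas : measurable_fun setT (fun p : coords => rho (cvec p)).
Proof. by apply: measurable_lipschitz => x y; exact: zero_dist_lip. Qed.

Let slab_meas (cc : R[i]) q s : enorm q = 1 ->
  measurable [set p : coords | cabs (cc - hdot (cvec p) q) <= s].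
Proof.
move=> q1; have := measurable_hdot cc q1.
move=> /(_ measurableT `]-oo, s]%classic (measurable_itv _)); rewrite setTI.
by congr measurable; apply/seteqP; split=> p /=; rewrite in_itv.
Qed.

Let tube_meas s : measurable [set p : coords | s < rho (cvec p)].
Proof.
have := rho_meas measurableT (measurable_itv `]s, +oo[); rewrite setTI.
by congr measurable; apply/seteqP; split=> p /=; rewrite in_itv/= andbT.
Qed.

(** [theta_le_gauss] for a profile that is at least [1 - e] on the slab, and at most
    [2 * e] at distance more than [s'] from the zero set. *)
Lemma slab_far_mass_le1 (cc : R[i]) q s s' a g : enorm q = 1 -> cabs cc = rho 0 -> 0 < s -> s < s' ->
  (\int[mu]_(p in [set p : coords | (cabs (cc - hdot (cvec p) q) <= s)%R]) (ga p)%:E = a%:E)%E ->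
  (\int[mu]_(p in [set p : coords | (s' < rho (cvec p))%R]) (ga p)%:E = g%:E)%E -> a + g <= 1.
Proof.
have absurd (e d : R) : (1 - e) * a <= 2 * e * g + (1 + e) * (1 - g) -> e * a <= e -> e * g <= e ->
  e <= d / 4 -> 0 < d -> a + g <= 1 + d by lra.
move=> q1 ccE s0 ss'; set A := [set p | _]; set B := [set p | _] => Aa Bg.
have mA : measurable A by exact: slab_meas.
have mB : measurable B by exact: tube_meas.
have [a1] := gauss_setC mA; rewrite Aa => -[<-] [/andP[a0 a11] _].
have [g1] := gauss_setC mB; rewrite Bg => -[<-] [/andP[gg0 gg1] Bc].
apply/ler_addgt0Pr => d d0; pose e := Num.min 1 (d / 4).
have e0 : 0 < e by rewrite lt_min ltr01 divr_gt0.
have e1 : e <= 1 by rewrite ge_min lexx.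
have ed : e <= d / 4 by rewrite ge_min lexx orbT.
have s2 : 0 < s ^+ 2 by rewrite exprn_gt0.
have ss2 : s ^+ 2 < s' ^+ 2 by rewrite ltr_sqr ?nnegrE// ltW// (lt_trans s0).
have [M [b [b0 H1 H2 H3]]] := step_profile s2 ss2 e0 e1.
set P := step_poly M e in H1 H2 H3.
have P0 : P`_0 = 0 by rewrite -horner_coef0 horner_step_poly subr0 expr1n subrr mulr0 addr0.
have sP : (size P <= (size P).-1.+1)%N by case: (size P).
pose c := @poly_weight R P (size P).-1; pose la := @poly_rate R b (size P).-1.
have la0 j : 0 < la j by rewrite mulr_gt0// ltr0n.
have thE tau : theta c la 0 tau = P.[expR (- (b * tau))] by exact: theta_poly.
have th0 tau : 0 <= tau -> 0 <= theta c la 0 tau by move=> /H1; rewrite thE => /andP[].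
have th1 t tau : 0 <= t -> 0 <= tau -> theta1 c la t tau < 0.
  apply: (@theta1_lt0 R _ c la la0 (b * e) b) => //; first exact: mulr_gt0.
  move=> w w0; rewrite theta1_poly// lerN2 deriv_step_poly [leLHS]mulrAC.
  rewrite ler_pM2l ?mulr_gt0 ?expR_gt0// lerDr mulr_ge0// exprn_ge0// subr_ge0 -expR0 ler_expR.
  by rewrite oppr_le0 mulr_ge0// ltW.
have key := theta_le_gauss f_holo f_zero la0 th1 th0 f_nz.
rewrite -ccE -(integral_theta_hdot c cc la0 q1) in key.
pose F (k : coords -> R) p := theta c la 0 (k p ^+ 2) * ga p.
have F0 k p : (0 <= (F k p)%:E)%E.
  by rewrite lee_fin mulr_ge0 ?gauss_density_ge0// th0// sqr_ge0.
have Fm k D : measurable_fun setT k -> measurable_fun D (fun p => (F k p)%:E).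
  move=> km; apply/measurable_EFinP; apply: measurable_funTS; apply: measurable_funM.
    apply: (@measurableT_comp _ _ _ _ _ _ (theta c la 0)); first exact: measurable_theta.
    exact: measurable_funX.
  exact: measurable_gauss_density.
have lower : (((1 - e) * a)%:E <= \int[mu]_p (F (fun p => cabs (cc - hdot (cvec p) q)) p)%:E)%E.
  have -> : ((1 - e) * a)%:E = (\int[mu]_(p in A) ((1 - e)%:E * (ga p)%:E))%E by rewrite (gZ mA) ?subr_ge0// Aa.
  apply: (@le_trans _ _ (\int[mu]_(p in A) (F (fun p => cabs (cc - hdot (cvec p) q)) p)%:E)%E).
    apply: ge0_le_integral => //.
    - by move=> p _; rewrite -EFinM lee_fin mulr_ge0 ?subr_ge0 ?gauss_density_ge0.
    - by apply: measurable_funeM.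
    - by apply: Fm; exact: measurable_hdot.
    - move=> p Ap; rewrite -EFinM lee_fin ler_wpM2r ?gauss_density_ge0// thE H2// sqr_ge0/=.
      by rewrite ler_sqr ?nnegrE ?cabs_ge0// ltW.
  by apply: ge0_subset_integral => //; apply: Fm; exact: measurable_hdot.
have upper : (\int[mu]_p (F (fun p => rho (cvec p)) p)%:E <= (2 * e * g + (1 + e) * (1 - g))%:E)%E.
  rewrite -(setUv B) ge0_integral_setU//; last 3 first.
  - exact: measurableC.
  - exact: Fm.
  - exact/disj_setPRL.
  rewrite EFinD; apply: leeD.
    have -> : (2 * e * g)%:E = (\int[mu]_(p in B) ((2 * e)%:E * (ga p)%:E))%E by rewrite (gZ mB) ?mulr_ge0 ?(ltW e0)// Bg.
    apply: ge0_le_integral => //.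
    - exact: Fm.
    - by apply: measurable_funeM.
    - move=> p Bp; rewrite -EFinM lee_fin ler_wpM2r ?gauss_density_ge0// thE H3//.
      by rewrite ler_sqr ?nnegrE ?zero_dist_ge0// ltW// (lt_trans s0).
  have mBc : measurable (~` B) by exact: measurableC.
  have -> : ((1 + e) * (1 - g))%:E = (\int[mu]_(p in ~` B) ((1 + e)%:E * (ga p)%:E))%E.
    by rewrite (gZ mBc) ?addr_ge0 ?(ltW e0)// Bc.
  apply: ge0_le_integral => //.
  - exact: Fm.
  - by apply: measurable_funeM.
  - move=> p _; rewrite -EFinM lee_fin ler_wpM2r ?gauss_density_ge0// thE.
    by have /andP[] := H1 _ (sqr_ge0 (rho (cvec p))).
have := le_trans lower (le_trans key upper); rewrite lee_fin => H.
have ea : e * a <= e by rewrite ler_piMr// ltW.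
have eg : e * g <= e by rewrite ler_piMr// ltW.
exact: absurd H ea eg ed d0.
Qed.

(** The limit of [slab_far_mass_le1] for [s'] decreasing to [s]. *)
Lemma slab_le_tube (cc : R[i]) q s : enorm q = 1 -> cabs cc = rho 0 -> 0 < s ->
  (\int[mu]_(p in [set p : coords | (cabs (cc - hdot (cvec p) q) <= s)%R]) (ga p)%:E <=
   \int[mu]_(p in [set p : coords | (rho (cvec p) <= s)%R]) (ga p)%:E)%E.
Proof.
move=> q1 ccE s0; have [a Aa _] := gauss_setC (slab_meas cc s q1).
have [g Bg [_ Bc]] := gauss_setC (tube_meas s).
have Ec : ~` [set p : coords | s < rho (cvec p)] = [set p | rho (cvec p) <= s].
  by apply/seteqP; split => p /=; [move=> /negP; rewrite -leNgt|move=> H; apply/negP; rewrite -leNgt].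
rewrite Ec in Bc; rewrite Aa Bc lee_fin lerBrDr.
pose Bk k := [set p : coords | s + k.+1%:R^-1 < rho (cvec p)].
have mBk k : measurable (Bk k) by exact: tube_meas.
have Bsub : [set p : coords | s < rho (cvec p)] = \bigcup_k Bk k.
  apply/seteqP; split => p /=.
    rewrite -subr_gt0 => r0; have [k kr] := ltr_add_invr r0; exists k => //.
    by move: kr; rewrite add0r ltrBrDl.
  by move=> [k _]; apply: le_lt_trans; rewrite lerDl.
have nd : nondecreasing_seq Bk.
  move=> i j ij; apply/subsetPset => p; apply: le_lt_trans.
  by rewrite lerD2l lef_pV2 ?posrE// ler_nat ltnS.
have lim : (\int[mu]_(p in Bk k) (ga p)%:E @[k --> \oo] --> \int[mu]_(p in \bigcup_k Bk k) (ga p)%:E)%E.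
  by apply: ge0_nondecreasing_set_cvg_integral.
rewrite -Bsub Bg in lim.
have : (g%:E <= (1 - a)%:E)%E; last by rewrite lee_fin lerBrDr addrC.
rewrite -(cvg_lim _ lim)//; apply: lime_le.
  exact: cvgP lim.
near=> k; have [gk Ek _] := gauss_setC (mBk k); rewrite Ek lee_fin lerBrDl.
by apply: (slab_far_mass_le1 q1 ccE s0 _ Aa Ek); rewrite ltrDl.
Unshelve. all: by end_near.
Qed.

End slabs_and_tubes.

(** * Supporting hyperplanes of circled convex bodies *)

Section phases.
Context {R : realType}.

Lemma unit_circle_param (a b : R) : a ^+ 2 + b ^+ 2 = 1 -> exists t, cos t = a /\ sin t = b.
Proof.
move=> ab; have a1 : -1 <= a <= 1.
  by rewrite -ler_norml -[leRHS]ger0_norm// -ler_sqr ?nnegrE// !real_normK ?num_real// expr1n -ab lerDl sqr_ge0.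
have s : sin (acos a) = `|b| by rewrite sin_acos// -ab addrAC subrr add0r sqrtr_sqr.
have c : cos (acos a) = a by rewrite acosK// in_itv.
have [b0|b0] := leP 0 b; first by exists (acos a); rewrite s ger0_norm.
by exists (- acos a); rewrite cosN sinN s ltr0_norm// opprK.
Qed.

Lemma phase_cabs (w : R[i]) : exists t, (cos t +i* sin t) * w = (cabs w)%:C.
Proof.
have [->|w0] := eqVneq w 0; first by exists 0; rewrite mulr0 cabs0.
have W0 : cabs w != 0 by rewrite cabs_eq0.
have [|t [ct st]] := @unit_circle_param (Re w / cabs w) (- (Im w / cabs w)).
  by rewrite sqrrN !exprMn -mulrDl -sqr_cabs -exprMn divff// expr1n.
exists t; rewrite ct st; move: (sqr_cabs w) W0; case: w {w0 ct st} => x y /=.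
set W := cabs _ => E W0; simpc; apply/eqP; rewrite eq_complex/=; apply/andP; split; apply/eqP.
  by apply: (mulIf W0); rewrite -expr2 E; field.
by field.
Qed.

End phases.

Section support.
Context {R : realType} {n : nat}.
Implicit Types (K : set 'rV[R[i]]_n) (x y z q k : 'rV[R[i]]_n) (s t e r : R).

Lemma convex_real K x y t : convex_set K -> 0 <= t <= 1 -> K x -> K y ->
  K (t%:C *: x + (1 - t)%:C *: y).
Proof.
move=> cK /andP[t0 t1] Kx Ky.
have t0' : (0 : R[i]) <= t%:C by rewrite ler0c.
have t1' : t%:C <= (1 : R[i]) by rewrite lecR.
have := cK x y (Itv01 t0' t1'); rewrite !inE => /(_ Kx Ky).
have -> : (1 - t)%:C = 1 - t%:C by rewrite rmorphB rmorph1.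
by apply.
Qed.

Lemma Re_hdot_self q : hdot q q = (enorm q ^+ 2)%:C.
Proof.
rewrite /hdot (eq_bigr (fun j => (cabs (q 0 j) ^+ 2)%:C)); last by move=> j _; exact: mul_conj.
by rewrite -rmorph_sum sqr_enorm.
Qed.

Lemma hdotZ (c : R[i]) z q : hdot (c *: z) q = c * hdot z q.
Proof. by rewrite /hdot mulr_sumr; apply: eq_bigr => j _; rewrite mxE mulrA. Qed.

Lemma hdotD z w q : hdot (z + w) q = hdot z q + hdot w q.
Proof. by rewrite /hdot -big_split; apply: eq_bigr => j _; rewrite !mxE mulrDl. Qed.

Lemma sqr_enorm_sub q z t : enorm (q - t%:C *: z) ^+ 2 =
  enorm q ^+ 2 - 2 * t * Re (hdot z q) + t ^+ 2 * enorm z ^+ 2.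
Proof.
rewrite !sqr_enorm /hdot raddf_sum !mulr_sumr -sumrN -!big_split/=; apply: eq_bigr => j _.
rewrite !mxE !sqr_cabs ReD ImD ReN ImN; case: (q 0 j) => a b; case: (z 0 j) => c d /=; simpc.
by rewrite /=; ring.
Qed.

(** A circled body is symmetric, so the midpoints of an interior ball and of its
    opposite form a ball around the origin. *)
Lemma convex_body_ball K : convex_body K -> circled K ->
  exists2 r, 0 < r & forall y, enorm y < r -> K y.
Proof.
move=> [_ cK [x0 /nbhs_enormP[r r0 H]]] circ; exists r => // y yr.
have neg z : K z -> K (- z).
  move=> Kz; rewrite -(circ pi); exists z => //.
  by rewrite cospi sinpi -(scaleN1r z); congr (_ *: _); apply/eqP; rewrite eq_complex/= oppr0 !eqxx.
have K1 : K (x0 + y) by apply: H; rewrite addrC addKr.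
have K2 : K (- (x0 - y)) by apply: neg; apply: H; rewrite addrC addKr enormN.
have := @convex_real K _ _ (1 / 2) cK _ K1 K2; rewrite div1r.
have -> : 1 - 2^-1 = 2^-1 :> R by field.
have -> : (2^-1)%:C *: (x0 + y) + (2^-1)%:C *: - (x0 - y) = y.
  rewrite -scalerDr opprB [y - x0]addrC addrACA subrr add0r scalerDr -scalerDl -rmorphD.
  by rewrite -[X in X + X]div1r -splitr rmorph1 scale1r.
by apply; rewrite invr_ge0 ler0n/= invf_le1// ler1n.
Qed.

(** A point nearest to the origin among the limits of points off [K]: the ball
    through it lies in [K], and the supporting hyperplane of the ball there is
    also one of [K], because the convex hull of the ball and a point beyond
    that hyperplane is a neighbourhood of the touching point. *)
Lemma touching_point K : (0 < n)%N -> convex_body K -> circled K ->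
  exists q, [/\ 0 < enorm q, forall y, enorm y <= enorm q -> K y &
    forall z, K z -> Re (hdot z q) <= enorm q ^+ 2].
Proof.
move=> n0 Kb circ; have [r0 r00 Hr0] := convex_body_ball Kb circ.
have [cK vK _] := Kb.
have Kcl : closed K by apply: compact_closed => //; exact: norm_hausdorff.
pose F := closure (~` K).
have encont x : {for x, continuous (@enorm R n)}.
  apply: continuous_at_dist => e e0; apply/nbhs_enormP; exists e => // y; apply: le_lt_trans.
  by rewrite ler_norml lerB_enorm andbT lerNl opprB enormB lerB_enorm.
have [y0 Ky0] : exists y, ~ K y.
  have cE : {within K, continuous (@enorm R n)}.
    by apply: continuous_in_subspaceT => x _; exact: encont.
  have [|m Km mmax] := compact_EVT_max _ cK cE; first by exists 0; apply: Hr0; rewrite enorm0.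
  pose e1 : 'rV[R[i]]_n := delta_mx 0 (Ordinal n0).
  exists ((enorm m + 1)%:C *: e1) => Ky.
  have := mmax _ (mem_set Ky); have := cabs_le_enorm ((enorm m + 1)%:C *: e1) (Ordinal n0).
  rewrite !mxE !eqxx mulr1 cabs_real ger0_norm ?addr_ge0 ?enorm_ge0// => A B.
  by have := le_trans A B; rewrite gerDl ler10.
have Fy0 : F y0 by exact: subset_closure.
have cA : compact ([set y | enorm y <= enorm y0] `&` F).
  apply: (subclosed_compact _ (@compact_enorm_ball R n (enorm y0))); last exact: subIsetl.
  apply: closedI; last exact: closed_closure.
  by apply: compact_closed; [exact: norm_hausdorff|exact: compact_enorm_ball].
have cE : {within [set y | enorm y <= enorm y0] `&` F, continuous (@enorm R n)}.
  by apply: continuous_in_subspaceT => x _; exact: encont.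
have [|q] := compact_EVT_min _ cA cE; first by exists y0; split => /=.
move=> /set_mem[qy0 Fq] qmin.
have Fnear y e : F y -> 0 < e -> exists2 w, ~ K w & enorm (w - y) < e.
  move=> Fy e0; have /Fy[w [Kw we]] : nbhs y [set w | enorm (w - y) < e] by apply/nbhs_enormP; exists e.
  by exists w.
have inK y : enorm y < enorm q -> K y.
  move=> yq; apply: contrapT => Ky.
  have yF : F y by exact: subset_closure.
  have yA : ([set y | enorm y <= enorm y0] `&` F) y.
    by split => //; exact: ltW (lt_le_trans yq qy0).
  by have := qmin y (mem_set yA); rewrite leNgt yq.
have q0 : 0 < enorm q.
  rewrite lt_def enorm_ge0 andbT; apply/eqP => E.
  have [w Kw wq] := Fnear q r0 Fq r00; apply: Kw; apply: Hr0; rewrite -(subrK q w).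
  by apply: le_lt_trans (enormD _ _) _; rewrite E addr0.
exists q; split=> //.
- move=> y yq; apply: Kcl => B /nbhs_enormP[e e0 HB].
  have [y1|y1] := ltP (enorm y) (enorm q); first by exists y; split; [exact: inK|apply: HB; rewrite subrr enorm0].
  pose t := Num.min 1 (e / 2 / enorm q).
  have t0 : 0 < t by rewrite lt_min ltr01 !divr_gt0.
  have t1 : t <= 1 by rewrite ge_min lexx.
  have te : t * enorm q < e.
    apply: (@le_lt_trans _ _ (e / 2)); last by rewrite ltr_pdivrMr// ltr_pMr// ltr1n.
    by rewrite -ler_pdivlMr// ge_min lexx orbT.
  exists ((1 - t)%:C *: y); split.
    apply: inK; rewrite enormZ cabs_real ger0_norm ?subr_ge0//.
    apply: (@le_lt_trans _ _ ((1 - t) * enorm q)); first by rewrite ler_wpM2l ?subr_ge0.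
    by rewrite gtr_pMl// ltrBlDr ltrDl.
  apply: HB; have -> : (1 - t)%:C *: y - y = (- t)%:C *: y.
    by rewrite rmorphB rmorph1 scalerBl scale1r addrAC subrr add0r rmorphN scaleNr.
  rewrite enormZ cabs_real normrN gtr0_norm//; apply: le_lt_trans te.
  by rewrite ler_wpM2l// ltW.
move=> z Kz; rewrite leNgt; apply/negP => zq.
set h := Re (hdot z q) in zq; set N := enorm q in zq q0 *.
(* [t] is so small that [q - t z] is shorter than [(1 - t) q]: then [q] is a convex
   combination of [z] and an interior point of the ball *)
pose t := Num.min (1 / 2) ((h - N ^+ 2) / (enorm z ^+ 2 + 1)).
have z1 : 0 < enorm z ^+ 2 + 1 by rewrite ltr_wpDl ?sqr_ge0.
have t0 : 0 < t by rewrite lt_min !divr_gt0 ?subr_gt0.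
have t1 : t <= 1 / 2 by rewrite ge_min lexx.
have tz : t * (enorm z ^+ 2 + 1) <= h - N ^+ 2 by rewrite -ler_pdivlMr// ge_min lexx orbT.
have t11 : 0 < 1 - t by lra.
have lt : enorm (q - t%:C *: z) < (1 - t) * N.
  rewrite -ltr_sqr ?nnegrE ?mulr_ge0 ?enorm_ge0 ?(ltW t11)// sqr_enorm_sub -/N -/h.
  set S := enorm z ^+ 2 in z1 tz *; have S0 : 0 <= S by exact: sqr_ge0.
  rewrite -subr_gt0.
  have -> : ((1 - t) * N) ^+ 2 - (N ^+ 2 - 2 * t * h + t ^+ 2 * S) =
     t * (2 * (h - N ^+ 2) - t * S + t * N ^+ 2) by ring.
  rewrite mulr_gt0//; have : 0 <= t * N ^+ 2 by rewrite mulr_ge0 ?sqr_ge0// ltW.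
  have : 0 < h - N ^+ 2 by rewrite subr_gt0.
  by move: tz; rewrite mulrDr mulr1; lra.
have [w Kw] := Fnear q ((1 - t) * N - enorm (q - t%:C *: z)) Fq (ltac:(rewrite subr_gt0; exact: lt)).
move=> wq; apply: Kw.
pose u := (1 - t)^-1%:C *: (w - t%:C *: z).
have t1n : (1 - t)%:C != 0 by rewrite eq_complex/= eqxx andbT gt_eqF.
have uw : w = t%:C *: z + (1 - t)%:C *: u.
  by rewrite /u scalerA -rmorphM divff ?gt_eqF// rmorph1 scale1r addrC subrK.
have Ku : K u.
  apply: inK; rewrite /u enormZ cabs_real ger0_norm ?invr_ge0 ?(ltW t11)// mulrC ltr_pdivrMr// mulrC.
  have -> : w - t%:C *: z = (w - q) + (q - t%:C *: z) by rewrite addrA subrK.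
  by apply: le_lt_trans (enormD _ _) _; rewrite -ltrBrDr.
by rewrite uw; apply: convex_real => //; apply/andP; split; lra.
Qed.

End support.

(** * Complex hyperplanes and the tubes around them *)

Section hyperplanes.
Context {R : realType} {n : nat}.
Implicit Types (K : set 'rV[R[i]]_n) (x y z q a : 'rV[R[i]]_n).

Lemma hdot_scaler (t : R) z q : hdot z (t%:C *: q) = t%:C * hdot z q.
Proof.
rewrite /hdot mulr_sumr; apply: eq_bigr => j _; rewrite mxE rmorphM mulrCA; congr (_ * _).
by apply/eqP; rewrite eq_complex/= oppr0 !eqxx.
Qed.

(** For a circled body the supporting half-space becomes a supporting slab around
    a complex hyperplane. *)
Lemma circled_slab K : (0 < n)%N -> convex_body K -> circled K ->
  exists q r, [/\ enorm q = 1, 0 < r, forall y, enorm y <= r -> K y &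
    forall z, K z -> cabs (hdot z q) <= r].
Proof.
move=> n0 Kb circ; have [q [q0 qK Kq]] := touching_point n0 Kb circ.
exists ((enorm q)^-1%:C *: q), (enorm q); split => //.
  by rewrite enormZ cabs_real ger0_norm ?invr_ge0 ?enorm_ge0// mulVf// gt_eqF.
move=> z Kz; rewrite hdot_scaler cabsM cabs_real ger0_norm ?invr_ge0 ?enorm_ge0//.
rewrite mulrC ler_pdivrMr// -expr2; have [t tE] := phase_cabs (hdot z q).
have Kt : K ((cos t +i* sin t) *: z) by rewrite -(circ t); exists z.
by have := Kq _ Kt; rewrite hdotZ tE.
Qed.

Lemma complex_hyperplane q : enorm q = 1 ->
  exists H : {vspace 'rV[R[i]]_n}, \dim H = n.-1 /\ forall h, (h \in H) = (hdot h q == 0).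
Proof.
move=> q1; pose A : 'cV[R[i]]_n := \col_j (q 0 j)^*.
have hA z : (z *m A) 0 0 = hdot z q by rewrite mxE; apply: eq_bigr => j _; rewrite mxE.
pose f : 'Hom('rV[R[i]]_n, 'rV[R[i]]_1) := linfun (mulmxr A).
have fE z : f z = z *m A by rewrite lfunE.
exists (lker f); split; last first.
  move=> h; rewrite memv_ker fE -hA; apply/eqP/eqP => [->|E]; first by rewrite mxE.
  by apply/matrixP => i j; rewrite !ord1 E mxE.
have E : (\dim (lker f) + \dim (f @: fullv) = n)%N.
  by rewrite -[X in \dim X]capfv limg_ker_dim dimvf dim_matrix -[RHS]mul1n.
have d1 : (\dim (f @: fullv) <= 1)%N.
  by rewrite (leq_trans (dimvS (subvf _)))// dimvf dim_matrix.
have d0 : (0 < \dim (f @: fullv))%N.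
  rewrite lt0n dimv_eq0; apply/eqP => E0.
  have := memv_img f (memvf q); rewrite E0 memv0 fE => /eqP fq.
  have := hA q; rewrite fq mxE Re_hdot_self q1 expr1n rmorph1 => /esym/eqP.
  by rewrite oner_eq0.
have {d0 d1} d : \dim (f @: fullv) = 1%N by apply/eqP; rewrite eqn_leq d1.
by move/(congr1 predn): E; rewrite d addn1.
Qed.

(** Every point of the translate has the same inner product with [q] as [a]; the
    distance is attained at the multiple of [q] with this property. *)
Lemma dist0_hyperplane (H : {vspace 'rV[R[i]]_n}) a q : enorm q = 1 ->
  (forall h, (h \in H) = (hdot h q == 0)) ->
  dist0 [set a + h | h in [set` H]] = cabs (hdot a q).
Proof.
move=> q1 HE; apply/eqP; rewrite eq_le; apply/andP; split.
  apply: ge_inf; first by exists 0 => _ [z _ <-]; exact: enorm_ge0.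
  exists (hdot a q *: q); last by rewrite enormZ q1 mulr1.
  exists (hdot a q *: q - a); last by rewrite addrC subrK.
  by rewrite /= HE hdotB hdotZ Re_hdot_self q1 expr1n rmorph1 mulr1 subrr.
apply: lb_le_inf; first by exists (enorm (a + 0)), (a + 0) => //; exists 0 => //=; rewrite mem0v.
move=> _ [_ [h /= hH <-] <-]; move: hH; rewrite HE => /eqP h0.
have := cabs_hdot (a + h) q; rewrite q1 mulr1.
by rewrite /hdot (eq_bigr (fun j => a 0 j * (q 0 j)^* + h 0 j * (q 0 j)^*)) ?big_split/= -?/(hdot _ _) ?h0 ?addr0// => j _; rewrite mxE mulrDl.
Qed.

End hyperplanes.

(** For a nonnegative function, the integral is a supremum over simple functions
    below its restriction; this covers arbitrary domains, such as Minkowski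
    sums. *)
Lemma ge0_integral_subset d (T : measurableType d) (R : realType)
    (mu : {measure set T -> \bar R}) (A B : set T) (f : T -> \bar R) :
  A `<=` B -> (forall x, 0 <= f x)%E -> (\int[mu]_(x in A) f x <= \int[mu]_(x in B) f x)%E.
Proof.
move=> AB f0; rewrite !ge0_integralE//; apply: ereal_sup_le => _ [h hf <-].
exists h => // x; apply: le_trans (hf x) _; rewrite !patchE.
case: ifPn => [xA|_]; first by rewrite mem_set//; exact/AB/set_mem.
by case: ifPn.
Qed.

Section tube_comparison.
Context {R : realType} {n : nat}.
Implicit Types (A B K Z : set 'rV[R[i]]_n) (x y z q a : 'rV[R[i]]_n).

Lemma gauss_measure_subset A B : A `<=` B -> (gauss_measure A <= gauss_measure B)%E.
Proof.
move=> AB; apply: ge0_integral_subset => [p|p]; first exact: AB.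
by rewrite lee_fin gauss_density_ge0.
Qed.

Lemma hyperplane_tube_sub (H : {vspace 'rV[R[i]]_n}) K a q (r s : R) :
  (forall h, (h \in H) = (hdot h q == 0)) -> (forall z, K z -> cabs (hdot z q) <= s) -> 0 <= r ->
  minkowski_sum [set a + h | h in [set` H]] (dilate r%:C K) `<=`
  [set z | cabs (hdot a q - hdot z q) <= r * s].
Proof.
move=> HE Ks r0 _ [_ [h /= hH <-] [_ [k Kk <-] <-]] /=.
move: hH; rewrite HE => /eqP h0.
have -> : hdot a q - hdot (a + h + r%:C *: k) q = - (r%:C * hdot k q).
  by rewrite !hdotD h0 hdotZ addr0 opprD addrA subrr add0r.
by rewrite cabsN cabsM cabs_real ger0_norm// ler_wpM2l// Ks.
Qed.

(** A point close to its nearest zero [p] differs from it by an element of [r K],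
    since [K] contains a ball. *)
Lemma tube_sub (f : 'rV[R[i]]_n -> R[i]) K (r s : R) (f_holo : holomorphic f)
    (f_zero : exists z, f z = 0) : (forall y, enorm y <= s -> K y) -> 0 < r ->
  [set z | zero_dist f_holo f_zero z <= r * s] `<=`
  minkowski_sum (f @^-1` [set 0]) (dilate r%:C K).
Proof.
move=> Ks r0 z /=; have [p fp ->] := zero_distP f_holo f_zero z => zp.
exists p => //; exists (z - p); last by rewrite addrC subrK.
exists (r^-1%:C *: (z - p)); last by rewrite scalerA -rmorphM divff ?gt_eqF// rmorph1 scale1r.
by apply: Ks; rewrite enormZ cabs_real ger0_norm ?invr_ge0 ?(ltW r0)// mulrC ler_pdivrMr// mulrC.
Qed.

End tube_comparison.

Theorem corollary1p3 (R : realType) (n : nat) (n_gt0 : (0 < n)%N)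
    (K : set 'rV[R[i]]_n) (K_body : convex_body K) (K_circled : circled K) :
  exists H : {vspace 'rV[R[i]]_n}, \dim H = n.-1 /\
    forall f : 'rV[R[i]]_n -> R[i], holomorphic f ->
    let Z := f @^-1` [set 0] in Z !=set0 ->
    forall r : R, 0 < r ->
    forall H1 : set 'rV[R[i]]_n,
      (exists a : 'rV[R[i]]_n, H1 = [set a + h | h in [set` H]]) ->
      dist0 H1 = dist0 Z ->
      (gauss_measure (minkowski_sum H1 (dilate r%:C K)) <=
       gauss_measure (minkowski_sum Z (dilate r%:C K)))%E.
Proof.
have [q [s [q1 s0 sK Ks]]] := circled_slab n_gt0 K_body K_circled.
have [H [dimH HE]] := complex_hyperplane q1.
exists H; split => // f f_holo Z Z0 r r0 H1 [a ->] dist.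
have f_zero : exists z, f z = 0 by case: Z0 => z fz; exists z.
have [f_nz|f0] := pselect (exists y, f y != 0); last first.
  apply: gauss_measure_subset => z _; have Kk : K 0 by apply: sK; rewrite enorm0 ltW.
  exists z; last by exists 0; [exists 0; rewrite ?scaler0|rewrite addr0].
  by apply/eqP; apply: contra_notT f0 => fz; exists z.
have dE : cabs (hdot a q) = zero_dist f_holo f_zero 0.
  by rewrite -(dist0_hyperplane a q1 HE) dist dist0_zeros.
apply: le_trans (gauss_measure_subset (hyperplane_tube_sub HE Ks (ltW r0))) _.
have tube := gauss_measure_subset (@tube_sub R n f K r s f_holo f_zero sK r0).
have slab := slab_le_tube f_nz q1 dE (mulr_gt0 r0 s0).
exact: le_trans slab tube.
Qed.
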